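(* Let $Q\in\mathbb{R}[x]$. Then the two-parameter sequence $\big(Q(\Omega(m^2+n^2))\big)_{m,n\in\mathbb{N}}$ is uniformly distributed mod $1$ if and only if at least one of the coefficients of $Q$ is irrational.
   Context: For $n\in\mathbb{N}=\{1,2,\dots\}$, $\Omega(n)$ is the number of prime factors of $n$ counted with multiplicity. A two-parameter sequence $(a(m,n))_{m,n\in\mathbb{N}}$ of real numbers is called uniformly distributed mod $1$ if for every interval $I\subset[0,1)$, $\lim_{N\to\infty}\frac1{N^2}\sum_{1\le m,n\le N}1_I(a(m,n)\bmod 1)=|I|$, where $1_I$ is the indicator function of $I$ and $|I|$ is the length of $I$.
   Formalization: ''At least one of the coefficients of Q is irrational'' is taken to mean at least one non-constant coefficient, since the literal claim fails for example for Q = √2, whose sequence is constant mod 1. *)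

(* Defs.v *)
From HB Require Import structures.
From mathcomp Require Import all_boot all_order all_algebra.
From mathcomp Require Import all_classical all_reals all_analysis.

Set Implicit Arguments.
Unset Strict Implicit.
Unset Printing Implicit Defensive.
Import Order.TTheory GRing.Theory Num.Theory.
Import numFieldNormedType.Exports.

Local Open Scope classical_set_scope.
Local Open Scope ring_scope.

Definition Omega (n : nat) : nat := (\sum_(p <- primes n) logn p n)%N.

Definition mod1 {R : realType} (x : R) : R := x - (Num.floor x)%:~R.

(* Only the values a m n with m, n >= 1 matter.  I ranges over all intervals
   contained in [0, 1), with either kind of endpoint; such a set has finite
   Lebesgue measure, so [fine] loses nothing. *)
Definition uniformly_distributed_mod1 {R : realType} (a : nat -> nat -> R) :=
  forall I : interval R, [set` I] `<=` `[0, 1[ ->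
    (fun N : nat => (N%:R ^+ 2)^-1 *
       \sum_(1 <= m < N.+1) \sum_(1 <= n < N.+1) \1_[set` I] (mod1 (a m n)))
      @ \oo --> fine (lebesgue_measure [set` I]).

(* Main.v *)
(** Let F be bounded.  In the limit along an ultrafilter, let g_k(z) be the
    average of F(Omega(|w|^2) + k) over the Gaussian integers w with zw in a
    large box, with a Lipschitz cutoff.  As Omega(|w pi|^2) = Omega(|w|^2) + 1
    for a Gaussian prime pi above some p = 1 mod 4, the Turan-Kubilius
    inequality shows that g_k(z) is close to the harmonic mean of g_{k+1}(z pi)
    over any set of such primes with a large sum of 1/p; moreover g_k is
    Lipschitz in log z.

    Hence the mean square of g_k, taken against a measure on the Gaussian
    integers which is almost invariant under multiplication by small primes, is
    almost nondecreasing in k, so that it is nearly constant on some long window.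
    There g_{k+1}(z pi) is close to g_k(z) for most pi.  A sieve bounds the primes
    of a scale by a constant multiple of the invariant measure; therefore, e being
    a fixed small prime, some of the translates by 1, e, ..., e^J of a
    neighbourhood of most primes of the scale must overlap: e^i x is close to
    e^j y for primes x, y and i < j <= J.  Comparing the two ways of reaching this
    point gives g_m = g_{m+j-i} approximately, hence g_0(1) = g_r(1) with r = J!.
    So the distribution of Omega(m^2 + n^2) is asymptotically invariant under
    translation by r.

    Under such an invariance van der Corput's inequality makes the exponential
    means of Q vanish when some nonconstant coefficient is irrational, and the
    Fejer kernel turns this into equidistribution.  When these coefficients are all
    rational, Q takes finitely many values modulo 1 on the integers. *)
Require Import Defs.
From mathcomp Require Import all_boot all_order all_algebra.
From mathcomp Require Import all_classical all_reals all_analysis.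
From mathcomp Require Import ring lra zify.
Set Implicit Arguments.
Unset Strict Implicit.
Unset Printing Implicit Defensive.
Import Order.TTheory GRing.Theory Num.Theory.
Import numFieldNormedType.Exports.
Local Open Scope classical_set_scope.
Local Open Scope ring_scope.

(** * Gaussian integers *)

(** Nothing is known here about how the Gaussian primes of a scale are spread in modulus and
    argument, so x and e y cannot simply be chosen close to each other. The pigeonhole on powers of
    e needs only an upper bound for primes, with a constant [C0] common to all scales. Its price is
    that the exponent difference is unknown, which r = J! absorbs. As J depends on [C0] alone, r is
    fixed before the accuracy, the function F and the Lipschitz constant of the cutoff; so the
    accuracy can go to 0 first, and the cutoff can sharpen to the indicator of the box afterwards.

    The almost invariant measure is close to |z|^-2 between two radii that are powers of a parameter
    y. Its mass has order ln y, which is also what the sieve saves, so [C0] stays bounded;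
    multiplication by a fixed prime changes its integrals by O(1), negligible against ln y.

    Ultrafilter limits make averages exactly additive and divisibility by distinct primes exactly
    independent, so that no error depending on the box survives in the Turan-Kubilius inequality. *)

Definition gint := (int * int)%type.

Definition gmul (z w : gint) : gint :=
  (z.1 * w.1 - z.2 * w.2, z.1 * w.2 + z.2 * w.1).

Definition gN (z : gint) : nat := (`|z.1| ^ 2 + `|z.2| ^ 2)%N.

Lemma gNE (z : gint) : (gN z)%:Z = z.1 ^+ 2 + z.2 ^+ 2.
Proof. by rewrite /gN PoszD -!abszX !abszE !ger0_norm ?sqr_ge0. Qed.

Lemma gmulC z w : gmul z w = gmul w z.
Proof. by rewrite /gmul; congr pair; ring. Qed.

Lemma gmulA x y z : gmul x (gmul y z) = gmul (gmul x y) z.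
Proof. by rewrite /gmul /=; congr pair; ring. Qed.

Lemma gmulBr x y z : gmul x (y - z) = gmul x y - gmul x z.
Proof. by case: x y z => [a b] [c d] [e f]; apply/pair_equal_spec; split => /=; ring. Qed.

Lemma gmulBl x y z : gmul (y - z) x = gmul y x - gmul z x.
Proof. by rewrite gmulC gmulBr ![gmul x _]gmulC. Qed.

Lemma gmul1 z : gmul (1, 0) z = z.
Proof. by case: z => a b; rewrite /gmul /=; congr pair; ring. Qed.

Lemma gN_mul z w : gN (gmul z w) = (gN z * gN w)%N.
Proof. by apply/eqP; rewrite -eqz_nat PoszM !gNE /gmul /=; apply/eqP; ring. Qed.

Lemma gN_eq0 z : (gN z == 0%N) = (z == 0).
Proof.
by case: z => a b; rewrite /gN /= addn_eq0 !expn_eq0 /= !andbT !absz_eq0 xpair_eqE.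
Qed.

Lemma gmul_inj z : z != 0 -> injective (gmul z).
Proof.
move=> z0 x y /eqP; rewrite -subr_eq0 -gmulBr -gN_eq0 gN_mul muln_eq0 !gN_eq0.
by rewrite (negPf z0) /= subr_eq0 => /eqP.
Qed.

Section norm.
Variable R : realType.
Implicit Types z w : gint.

Definition nm z : R := Num.sqrt (gN z)%:R.

Lemma nm_ge0 z : 0 <= nm z. Proof. exact: sqrtr_ge0. Qed.

Lemma nm_sqr z : nm z ^+ 2 = (gN z)%:R.
Proof. by rewrite sqr_sqrtr ?ler0n. Qed.

Lemma nm_mul z w : nm (gmul z w) = nm z * nm w.
Proof. by rewrite /nm gN_mul natrM sqrtrM ?ler0n. Qed.

Lemma gNr z : (gN z)%:R = z.1%:~R ^+ 2 + z.2%:~R ^+ 2 :> R.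
Proof. by rewrite -[LHS]/((gN z)%:Z%:~R) gNE rmorphD !rmorphXn. Qed.

Lemma nm_triangle z w : nm (z + w) <= nm z + nm w.
Proof.
rewrite -(ler_pXn2r (n := 2)) ?nnegrE ?addr_ge0 ?nm_ge0 // sqrrD !nm_sqr !gNr.
case: z w => [a b] [c d]; rewrite !rmorphD /=.
(* Cauchy-Schwarz, from (ac + bd)^2 + (ad - bc)^2 = |z|^2 |w|^2. *)
suff : a%:~R * c%:~R + b%:~R * d%:~R <= nm (a, b) * nm (c, d) by nra.
rewrite -nm_mul; apply: le_trans (ler_norm _) _.
rewrite -(ler_pXn2r (n := 2)) ?nnegrE ?normr_ge0 ?nm_ge0 //.
rewrite nm_sqr gN_mul natrM !gNr real_normK ?num_real //=.
have := sqr_ge0 (a%:~R * d%:~R - b%:~R * c%:~R : R); nra.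
Qed.

Lemma nmN z : nm (- z) = nm z.
Proof. by rewrite /nm /gN /= !abszN. Qed.

Lemma nmB z w : nm (z - w) = nm (w - z).
Proof. by rewrite -nmN opprB. Qed.

Lemma nm_gt0 z : (0 < nm z) = (z != 0).
Proof. by rewrite sqrtr_gt0 ltr0n lt0n gN_eq0. Qed.

Lemma nm0 : nm 0 = 0.
Proof. by rewrite /nm /gN /= sqrtr0. Qed.

(* A Lipschitz condition for the scale-invariant distance |z - w| / |z|. *)
Definition tame (l : R) (g : gint -> R) :=
  forall z w, `|g z - g w| * nm z <= l * nm (z - w).

End norm.
Arguments nm {R}.

(** * Weighted averages *)

Section weighted_average.
Variables (R : realType).

Definition wav (T : Type) (s : seq T) (c : T -> R) (f : T -> R) : R :=
  \sum_(x <- s) c x * f x.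

Variables (T : eqType) (s : seq T) (c : T -> R).
Implicit Types f g : T -> R.
Notation W := (wav s c).

Lemma wav_ext f g : (forall x, x \in s -> f x = g x) -> W f = W g.
Proof. by move=> h; apply: eq_big_seq => x xs; rewrite h. Qed.

Lemma wavD f g : W (fun x => f x + g x) = W f + W g.
Proof. by rewrite -big_split; apply: eq_bigr => x _; rewrite mulrDr. Qed.

Lemma wavZ a f : W (fun x => a * f x) = a * W f.
Proof. by rewrite mulr_sumr; apply: eq_bigr => x _; rewrite mulrCA. Qed.

Lemma wavB f g : W (fun x => f x - g x) = W f - W g.
Proof.
by rewrite -sumrB; apply: eq_bigr => x _; rewrite mulrBr.
Qed.

Lemma wav_sum (I : Type) (r : seq I) (P : pred I) (F : I -> T -> R) :
  W (fun x => \sum_(i <- r | P i) F i x) = \sum_(i <- r | P i) W (F i).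
Proof.
rewrite exchange_big; apply: eq_bigr => x _; by rewrite mulr_sumr.
Qed.

Hypothesis c0 : forall x, x \in s -> 0 <= c x.

Lemma wav_le f g : (forall x, x \in s -> f x <= g x) -> W f <= W g.
Proof. by move=> h; rewrite /wav !big_seq; apply: ler_sum => x xs; rewrite ler_wpM2l ?c0 ?h. Qed.

Lemma wav_ge0 f : (forall x, x \in s -> 0 <= f x) -> 0 <= W f.
Proof. by move=> h; rewrite /wav big_seq sumr_ge0 // => x xs; rewrite mulr_ge0 ?c0 ?h. Qed.

Hypothesis c1 : W (fun=> 1) = 1.

Lemma wav_cst a : W (fun=> a) = a.
Proof. by rewrite -[RHS]mulr1 -c1 -wavZ; apply: wav_ext => x _; rewrite mulr1. Qed.

Lemma wav_norm f : `|W f| <= W (fun x => `|f x|).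
Proof.
rewrite /wav big_seq [leRHS]big_seq; apply: le_trans (ler_norm_sum _ _ _) _.
by apply: ler_sum => x xs; rewrite normrM ger0_norm ?c0.
Qed.

Lemma wav_le_cst f a : (forall x, x \in s -> f x <= a) -> W f <= a.
Proof. by move=> h; rewrite -[leRHS]wav_cst wav_le. Qed.

Lemma wav_exists_le f a : W f <= a -> exists2 x, x \in s & f x <= a.
Proof.
move=> h; apply: contrapT => /forall2NP H.
have {}H x : x \in s -> a < f x.
  by move=> xs; case: (H x) => [//|/negP]; rewrite -ltNge.
have [x xs cx] : exists2 x, x \in s & 0 < c x.
  apply: contrapT => /forall2NP G.
  suff : W (fun=> 1) <= 0 by rewrite c1 ler10.
  rewrite /wav big_seq sumr_le0 // => x xs; rewrite mulr1.
  by case: (G x) => [//|/negP]; rewrite -leNgt.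
suff : a < W f by rewrite ltNge h.
rewrite -subr_gt0 -[X in _ - X]wav_cst -wavB /wav.
rewrite (perm_big _ (perm_to_rem xs)) big_cons /=.
apply: ltr_pwDl; first by rewrite mulr_gt0 // subr_gt0 H.
rewrite big_seq sumr_ge0 // => y /mem_rem ys.
by rewrite mulr_ge0 ?c0 // subr_ge0 ltW ?H.
Qed.

(** Expanding the square, the cross term is 2a times the mean of [f], which is [a ^+ 2] doubled up
    to the error. Used with [f] the values g_{k+1}(z pi) and [a] = g_k(z): it turns an approximate
    mean value relation into a bound of the spread by the growth of the mean square. *)
Lemma wav_variance_le f a d : `|a| <= 1 -> `|a - W f| <= d ->
  W (fun x => (f x - a) ^+ 2) <= W (fun x => f x ^+ 2) - a ^+ 2 + 2 * d.
Proof.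
move=> a1 ad.
have -> : W (fun x => (f x - a) ^+ 2) =
    W (fun x => f x ^+ 2) - (2 * a) * W f + a ^+ 2.
  rewrite -wavZ -wavB -[X in _ + X]wav_cst -wavD.
  by apply: wav_ext => x _; ring.
suff : a * (a - W f) <= d by nra.
apply: le_trans (ler_norm _) _; rewrite normrM -[leRHS]mul1r.
by rewrite ler_pM.
Qed.

Lemma wav_jensen f : W f ^+ 2 <= W (fun x => f x ^+ 2).
Proof.
have : 0 <= W (fun x => (f x - W f) ^+ 2) by apply: wav_ge0 => x _; apply: sqr_ge0.
have -> : W (fun x => (f x - W f) ^+ 2) = W (fun x => f x ^+ 2) - W f ^+ 2.
  transitivity (W (fun x => f x ^+ 2) - (2 * W f) * W f + W f ^+ 2); last by ring.
  rewrite -wavZ -wavB -[X in _ + X]wav_cst -wavD.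
  by apply: wav_ext => x _; ring.
by rewrite subr_ge0.
Qed.

End weighted_average.

Lemma wav_exchange (R : realType) (T T' : Type) (s : seq T) (s' : seq T') c c'
    (f : T -> T' -> R) :
  wav s c (fun x => wav s' c' (f x)) = wav s' c' (fun y => wav s c (f^~ y)).
Proof.
rewrite /wav; under eq_bigr do rewrite mulr_sumr.
rewrite exchange_big; apply: eq_bigr => y _; rewrite mulr_sumr.
by apply: eq_bigr => x _; rewrite mulrCA.
Qed.

Lemma sum_sqr_le (R : realType) (n : nat) (a : nat -> R) :
  (\sum_(i < n) a i) ^+ 2 <= n%:R * \sum_(i < n) a i ^+ 2.
Proof.
elim: n => [|n IH]; first by rewrite !big_ord0 mulr0 expr2 mul0r.
rewrite !big_ord_recr /= -natr1.
set S := \sum_(i < n) a i in IH *; set Q := \sum_(i < n) _ in IH *; set b := a n.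
have Q0 : 0 <= Q by apply: sumr_ge0 => i _; apply: sqr_ge0.
suff : 2 * (S * b) <= Q + n%:R * b ^+ 2 by nra.
case: n => [|n] in @S @Q IH Q0 b *.
  by rewrite /S /Q !big_ord0 /=; nra.
have n0 : 0 < n.+1%:R :> R by rewrite ltr0n.
have : S ^+ 2 / n.+1%:R <= Q by rewrite ler_pdivrMr // mulrC.
have -> : S ^+ 2 = (S / n.+1%:R) ^+ 2 * n.+1%:R * n.+1%:R by field; lra.
rewrite mulfK; last by lra.
have := mulr_ge0 (ltW n0) (sqr_ge0 (S / n.+1%:R - b)).
have -> : S * b = (S / n.+1%:R) * b * n.+1%:R by field; lra.
move: (S / n.+1%:R) => t; clear IH Q0 n0; clearbody Q b; move: (n.+1%:R : R) => m h1 h2; move: b h1 => b' h1.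
have -> : 2 * (t * b' * m) = m * t ^+ 2 + m * b' ^+ 2 - m * (t - b') ^+ 2 by ring.
by rewrite [m * _]mulrC; lra.
Qed.

(** * Scales of split primes *)

Definition sp (p : nat) := prime p && (p %% 4 == 1)%N.

(* A Gaussian prime above [p]; the junk value is 0 when [p] is not a norm. *)
Definition gpr (p : nat) : gint :=
  if pselect (exists z, gN z = p) is left h then projT1 (cid h) else 0.

Definition inv_mass (R : realType) (s : seq nat) : R := \sum_(p <- s) p%:R^-1.

Definition pwt (R : realType) (s : seq nat) (p : nat) : R :=
  (inv_mass R s)^-1 * p%:R^-1.

(* A scale: a finite set [s] of split primes beyond [S], whose harmonic averages
   are dominated by a probability [kap] on Gaussian integers which is itself
   nearly invariant under multiplication by the split primes up to [S]. *)
Definition is_scale (R : realType) (c0 C0 l d : R) (S : nat) (s : seq nat) :=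
  [/\ uniq s, {in s, forall p, sp p && (S < p)%N}, c0 <= inv_mass R s &
    exists (zs : seq gint) (kap : gint -> R),
    [/\ forall z, 0 <= kap z, wav zs kap (fun=> 1) = 1,
      forall psi, tame l psi -> (forall z, 0 <= psi z <= 1) ->
        wav s (pwt R s) (psi \o gpr) <= C0 * wav zs kap psi + d
    & forall q psi, sp q -> (q <= S)%N -> tame l psi -> (forall z, `|psi z| <= 1) ->
        `|wav zs kap (fun z => psi (gmul z (gpr q))) - wav zs kap psi| <= d]].

Section scales.
Variable R : realType.
Implicit Types (s : seq nat) (l d : R).

Lemma pwt_ge0 s p : 0 <= pwt R s p.
Proof.
by rewrite mulr_ge0 ?invr_ge0 ?ler0n // sumr_ge0 // => q _; rewrite invr_ge0 ler0n.
Qed.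

Lemma pwt_sum1 s : 0 < inv_mass R s -> wav s (pwt R s) (fun=> 1) = 1.
Proof.
move=> s0; rewrite /wav /pwt; under eq_bigr do rewrite mulr1.
by rewrite -mulr_sumr mulVf // gt_eqF.
Qed.

Lemma pwtE s f : wav s (pwt R s) f = (inv_mass R s)^-1 * \sum_(p <- s) p%:R^-1 * f p.
Proof. by rewrite /wav mulr_sumr; apply: eq_bigr => p _; rewrite mulrA. Qed.

Variables (c0 C0 : R).
Hypothesis c0_gt0 : 0 < c0.
Hypothesis scaleP : forall l d S, 0 < l -> 0 < d -> exists s, is_scale c0 C0 l d S s.

(** One scale guarantees only the mass [c0], while the Turan-Kubilius error is small only for a
    large mass; hence the union of many scales. Each new one is taken beyond all primes of the
    others, which makes them disjoint. *)
Lemma multiscale l d S m : 0 < l -> 0 < d -> exists ss : seq (seq nat),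
  [/\ size ss = m, uniq (flatten ss) & {in ss, forall s, is_scale c0 C0 l d S s}].
Proof.
move=> l0 d0; elim: m => [|m [ss [szs us hs]]]; first by exists [::].
pose S' := maxn S (\max_(p <- flatten ss) p).
have [s [us' hs' m' [zs [kap [k0 k1 dom inv]]]]] := scaleP S' l0 d0.
have HS : (S <= S')%N by rewrite leq_maxl.
exists (s :: ss); split => /=; [by rewrite szs|rewrite cat_uniq us' us andbT /=|].
  apply/hasPn => p pss; apply/negP => /hs' /andP[_]; rewrite ltnNge => /negP; apply.
  by rewrite leq_max (leq_bigmax_seq (P := xpredT) (F := id)) ?orbT.
move=> t; rewrite inE => /orP[/eqP->|/hs//]; split => // [p /hs' /andP[-> /=]|].
  exact: leq_ltn_trans.
exists zs, kap; split => // q psi sq qS; apply: inv => //; exact: leq_trans qS HS.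
Qed.

Lemma flatten_scale l d S ss : {in ss, forall s, is_scale c0 C0 l d S s} ->
  {in flatten ss, forall p, sp p && (S < p)%N}.
Proof. by move=> h p /flattenP[s /h[_ hs _ _]]; apply: hs. Qed.

Lemma inv_mass_flatten ss : inv_mass R (flatten ss) = \sum_(s <- ss) inv_mass R s.
Proof. by rewrite /inv_mass big_flatten. Qed.

Lemma inv_mass_flatten_ge l d S ss : {in ss, forall s, is_scale c0 C0 l d S s} ->
  (size ss)%:R * c0 <= inv_mass R (flatten ss).
Proof.
move=> h; rewrite inv_mass_flatten -sum1_size natr_sum mulr_suml !big_seq.
by apply: ler_sum => s /h[_ _ + _]; rewrite mul1r.
Qed.

Lemma wav_flatten (ss : seq (seq nat)) f : {in ss, forall s, 0 < inv_mass R s} ->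
  wav (flatten ss) (pwt R (flatten ss)) f =
  (inv_mass R (flatten ss))^-1 * \sum_(s <- ss) inv_mass R s * wav s (pwt R s) f.
Proof.
move=> h; rewrite pwtE big_flatten; congr (_ * _).
rewrite big_seq [RHS]big_seq; apply: eq_bigr => s /h s0.
by rewrite pwtE mulrA mulfV ?gt_eqF // mul1r.
Qed.

Lemma wav_flatten_le (ss : seq (seq nat)) f a : ss != [::] ->
  {in ss, forall s, 0 < inv_mass R s} ->
  {in ss, forall s, wav s (pwt R s) f <= a} ->
  wav (flatten ss) (pwt R (flatten ss)) f <= a.
Proof.
move=> ss0 h ha; rewrite wav_flatten //.
have M0 : 0 < inv_mass R (flatten ss).
  rewrite inv_mass_flatten; case: ss ss0 h {ha} => // s ss _ h.
  rewrite big_cons ltr_pwDl ?h ?mem_head // big_seq sumr_ge0 // => t ts.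
  by rewrite ltW // h // inE ts orbT.
rewrite mulrC ler_pdivrMr // inv_mass_flatten mulr_sumr !big_seq.
by apply: ler_sum => s sss; rewrite mulrC ler_wpM2r ?ha // ltW ?h.
Qed.

End scales.

(** * Tent functions around translates of a set of primes *)

Section bumps.
Variable R : realType.
Variable w : R.
Hypothesis w01 : 0 < w <= 1.
Implicit Types (P : seq nat) (u z : gint).

(** A Lipschitz substitute for the indicator of a neighbourhood of the translate of P by u. The
    width is relative to the modulus of the centre, so that multiplication carries bumps to bumps; a
    maximum instead of a sum keeps the values in [0, 1] and the Lipschitz constant independent of
    the number of primes. *)
Definition bump P u z : R :=
  \big[Num.max/0]_(p <- P)
    (1 - nm (z - gmul u (gpr p)) / (w * nm (gmul u (gpr p)))).

Let w_gt0 : 0 < w. Proof. by case/andP: w01. Qed.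

Lemma bump_ge P u z p : p \in P ->
  1 - nm (z - gmul u (gpr p)) / (w * nm (gmul u (gpr p))) <= bump P u z.
Proof. move=> pP; exact: (@le_bigmax_seq _ R _ P 0 p xpredT (fun p => 1 - nm (z - gmul u (gpr p)) / (w * nm (gmul u (gpr p))))). Qed.

Lemma bump_ge0 P u z : 0 <= bump P u z.
Proof. by rewrite /bump; elim/big_rec: _ => // p x _ x0; rewrite le_max x0 orbT. Qed.

Lemma bump_le P u z a : 0 <= a ->
  (forall p, p \in P ->
    1 - nm (z - gmul u (gpr p)) / (w * nm (gmul u (gpr p))) <= a) ->
  bump P u z <= a.
Proof. by move=> a0 h; rewrite /bump big_seq bigmax_le. Qed.

Lemma bump01 P u z : 0 <= bump P u z <= 1.
Proof.
rewrite bump_ge0 bump_le // => p _.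
by rewrite gerBl divr_ge0 ?mulr_ge0 ?nm_ge0 // ltW.
Qed.

Lemma bump_center P u p : p \in P -> bump P u (gmul u (gpr p)) = 1.
Proof.
move=> pP; apply/eqP; rewrite eq_le (andP (bump01 _ _ _)).2 /=.
by apply: le_trans (bump_ge _ _ pP); rewrite subrr nm0 mul0r subr0.
Qed.

Lemma bump_mul P e u z : e != 0 -> bump P (gmul u e) (gmul z e) = bump P u z.
Proof.
rewrite -(nm_gt0 R) => e0; apply: eq_bigr => p _.
have -> : gmul (gmul u e) (gpr p) = gmul (gmul u (gpr p)) e.
  by rewrite -!gmulA (gmulC e).
by rewrite -gmulBl !nm_mul [w * _]mulrA -mulf_div divff ?mulr1 // gt_eqF.
Qed.

Lemma bump_gt0 P u z : {in P, forall p, gpr p != 0} -> u != 0 -> 0 < bump P u z ->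
  exists2 p, p \in P & nm (z - gmul u (gpr p)) <= w * nm (gmul u (gpr p)) :> R.
Proof.
move=> P0 u0 h; apply: contrapT => /forall2NP H.
suff : bump P u z <= 0 by rewrite leNgt h.
apply: bump_le => // p pP; case: (H p) => [//|/negP]; rewrite -ltNge => {}H.
have b0 : 0 < w * nm (gmul u (gpr p)) by rewrite mulr_gt0 // nm_mul mulr_gt0 ?nm_gt0 ?P0.
by rewrite subr_le0 ler_pdivlMr // mul1r ltW.
Qed.

(** If |z - z'| is at least |z|/2 the bound is trivial. Otherwise a tent positive at one of the two
    points has a centre of modulus at least |z|/4, since w <= 1, so its slope is at most 4 / (w
    |z|). *)
Lemma bump_tame P u : {in P, forall p, gpr p != 0} -> u != 0 ->
  tame (4 / w) (bump P u).
Proof.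
move=> P0 u0 z z'.
have [->|z0] := eqVneq z 0.
  by rewrite nm0 mulr0 mulr_ge0 ?nm_ge0 // divr_ge0 // ltW.
have nz0 : 0 < nm z :> R by rewrite nm_gt0.
set D := nm (z - z'); have D0 : 0 <= D by apply: nm_ge0.
have iw : 1 <= w^-1 by rewrite invf_ge1 //; case/andP: w01.
have [hD|hD] := leP (nm z) (2 * D).
  have h1 : `|bump P u z - bump P u z'| <= 1.
    have /andP[? ?] := bump01 P u z; have /andP[? ?] := bump01 P u z'.
    by rewrite ler_norml; lra.
  have : 1 * (2 * D) <= 4 / w * D by nra.
  by move: (normr_ge0 (bump P u z - bump P u z')); nra.
have tri p x : 0 < nm (gmul u (gpr p)) :> R -> forall y,
    1 - nm (x - gmul u (gpr p)) / (w * nm (gmul u (gpr p))) <=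
    1 - nm (y - gmul u (gpr p)) / (w * nm (gmul u (gpr p))) +
      nm (x - y) / (w * nm (gmul u (gpr p))) :> R.
  move=> b0 y; rewrite -addrA lerD2l -subr_ge0.
  have -> : - (nm (y - gmul u (gpr p)) / (w * nm (gmul u (gpr p)))) +
      nm (x - y) / (w * nm (gmul u (gpr p))) -
      - (nm (x - gmul u (gpr p)) / (w * nm (gmul u (gpr p)))) =
      (nm (x - y) + nm (x - gmul u (gpr p)) - nm (y - gmul u (gpr p))) /
      (w * nm (gmul u (gpr p))) :> R.
    by field; rewrite !gt_eqF.
  rewrite divr_ge0 ?mulr_ge0 ?(ltW w_gt0) ?nm_ge0 // subr_ge0.
  have -> : y - gmul u (gpr p) = (y - x) + (x - gmul u (gpr p)) by rewrite addrA subrK.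
  by apply: le_trans (nm_triangle _ _ _) _; rewrite (nmB _ x y).
have key x y : nm z <= 2 * nm x :> R -> nm (x - y) = D ->
    bump P u x <= bump P u y + 4 / w * D / nm z.
  move=> hx hxy; have K0 : 0 <= 4 / w * D / nm z.
    by rewrite divr_ge0 ?mulr_ge0 ?invr_ge0 ?(ltW w_gt0) // ltW.
  apply: bump_le => [|p pP]; first by rewrite addr_ge0 ?bump_ge0.
  have b0 : 0 < nm (gmul u (gpr p)) :> R by rewrite nm_mul mulr_gt0 ?nm_gt0 ?P0.
  set b := nm (gmul u (gpr p)) in b0 *.
  have [hf|hf] := leP (1 - nm (x - gmul u (gpr p)) / (w * b)) 0.
    by apply: le_trans hf _; rewrite addr_ge0 ?bump_ge0.
  have xb : nm x <= 2 * b.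
    move: hf; rewrite subr_gt0 ltr_pdivrMr ?mulr_gt0 // mul1r => hf.
    have := nm_triangle R (x - gmul u (gpr p)) (gmul u (gpr p)).
    rewrite subrK -/b; have : w * b <= b by rewrite ler_piMl ?(ltW b0) //; case/andP: w01.
    by lra.
  apply: le_trans (tri p x b0 y) _; apply: lerD; first exact: bump_ge.
  rewrite hxy -/b ler_pdivrMr ?mulr_gt0 //.
  have -> : 4 / w * D / nm z * (w * b) = D * (4 * b / nm z).
    by field; rewrite !gt_eqF.
  by rewrite -{1}[D]mulr1 ler_wpM2l // ler_pdivlMr // mul1r; lra.
have k1 := key z z' _ erefl.
have k2 : bump P u z' <= bump P u z + 4 / w * D / nm z.
  apply: key; last by rewrite nmB.
  have := nm_triangle R (z - z') z'; rewrite subrK -/D; lra.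
rewrite -ler_pdivlMr // ler_norml.
have {}k1 := k1 ltac:(lra).
apply/andP; split; lra.
Qed.

End bumps.

(** * Primes congruent to 1 modulo 4 are norms *)

Section two_squares.
Variable p : nat.
Hypothesis spp : sp p.

Let p_pr : prime p. Proof. by case/andP: spp. Qed.

(** Wilson's theorem: for p = 4k + 1 the upper half of (p-1)! consists of the negatives of the lower
    half, and their number 2k is even, so the square of (2k)! is -1 modulo p. *)
Lemma exists_sqrtN1 : exists x : nat, (p %| x ^ 2 + 1)%N.
Proof.
have p1 := prime_gt1 p_pr.
set k := (p %/ 4)%N.
have pk : p = (4 * k + 1)%N.
  by case/andP: spp => _ /eqP h; rewrite {1}(divn_eq p 4) h mulnC.
exists (2 * k)`!%N.
have cF (n : nat) : (p %| n)%N = (n%:R == 0 :> 'F_p).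
  by rewrite (dvdn_pcharf (pchar_Fp p_pr)).
have : (p %| (p.-1)`!.+1)%N by rewrite -Wilson.
rewrite !cF -[(p.-1)`!.+1]addn1 !natrD natrX.
suff -> : ((p.-1)`!)%:R = ((2 * k)`!)%:R ^+ 2 :> 'F_p by [].
have -> : p.-1 = (2 * k + 2 * k)%N by rewrite pk; lia.
rewrite expr2 !fact_prod (@big_cat_nat _ _ _ (2 * k).+1) //=; last by lia.
rewrite natrM; congr (_ * _).
rewrite -{1}[(2 * k).+1]add1n -addSn big_addn.
have -> : ((2 * k).+1 + 2 * k - (2 * k) = (2 * k).+1)%N by lia.
rewrite big_nat_rev !(big_morph _ (@natrM 'F_p) (erefl _)) /=.
have -> : \prod_(1 <= i < (2 * k).+1) i%:R =
   \prod_(1 <= i < (2 * k).+1) (- 1) * \prod_(1 <= i < (2 * k).+1) (- i%:R) :> 'F_p.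
  by rewrite -big_split; apply: eq_bigr => i _ /=; rewrite mulN1r opprK.
have -> : \prod_(1 <= i < (2 * k).+1) (-1) = 1 :> 'F_p.
  by rewrite prodr_const_nat subn1 exprM sqrrN !expr1n.
rewrite mul1r !big_nat; apply: eq_bigr => i /andP[i1 i2].
apply/eqP; rewrite -addr_eq0 -natrD -cF.
by have -> : (1 + (2 * k).+1 - i.+1 + 2 * k + i = p)%N by lia.
Qed.

(** Thue's argument. With k the integer part of the square root of p, the (k+1)^2 > p pairs (u, v)
    cannot have distinct u + v x modulo p; the difference of two colliding pairs has a nonzero norm
    divisible by p and at most 2 k^2 < 2 p, hence equal to p. *)
Lemma exists_two_squares : exists a b : nat, (a ^ 2 + b ^ 2 = p)%N.
Proof.
have [x px] := exists_sqrtN1.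
have p1 := prime_gt1 p_pr.
have [k [kp pk]] : exists k, (k ^ 2 <= p)%N /\ (p < k.+1 ^ 2)%N.
  have h0 : exists k, (k ^ 2 <= p)%N by exists 0%N.
  have hb k : (k ^ 2 <= p)%N -> (k <= p)%N by nia.
  exists (ex_maxn h0 hb); case: ex_maxnP => k hk hm; split => //.
  by rewrite ltnNge; apply/negP => /hm; rewrite ltnn.
have {}kp : (k ^ 2 < p)%N.
  rewrite ltn_neqAle kp andbT; apply/eqP => e.
  have kp' : (k %| p)%N by rewrite -e expnS dvdn_mulr.
  by case/primeP: p_pr => _ /(_ k kp') /orP[] /eqP h; move: e p1; rewrite h; nia.
pose f (uv : 'I_k.+1 * 'I_k.+1) : 'I_p := Ordinal (ltn_pmod (uv.1 + uv.2 * x)%N (ltnW p1)).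
have /injectivePn[[u v] [[u' v'] /eqP neq /(congr1 val) /= heq]] : ~~ injectiveb f.
  apply/negP => /injectiveP /leq_card; rewrite card_prod !card_ord.
  by rewrite leqNgt -[(k.+1 * _)%N]/(k.+1 ^ 2)%N pk.
pose z : gint := ((u : nat)%:Z - (u' : nat)%:Z, (v : nat)%:Z - (v' : nat)%:Z).
have z0 : gN z != 0%N.
  rewrite gN_eq0 xpair_eqE !subr_eq0 !eqz_nat; apply: contra_notN neq.
  by case/andP => /eqP/val_inj -> /eqP/val_inj ->.
have pz : (p%:Z %| (gN z)%:Z)%Z.
  have h1 : (p%:Z %| z.1 + z.2 * x%:Z)%Z.
    have -> : z.1 + z.2 * x%:Z = (u + v * x)%N%:Z - (u' + v' * x)%N%:Z.
      by rewrite /z /=; lia.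
    by rewrite -eqz_mod_dvd !modz_nat heq.
  have h2 : (p%:Z %| (x ^ 2 + 1)%N%:Z)%Z by rewrite dvdzE.
  have -> : (gN z)%:Z = (z.1 + z.2 * x%:Z) * (z.1 - z.2 * x%:Z) + z.2 ^+ 2 * (x ^ 2 + 1)%N%:Z.
    by rewrite gNE PoszD -mulnn PoszM; ring.
  by apply: rpredD; [apply: dvdz_mulr|apply: dvdz_mull].
have zk : (gN z <= 2 * k ^ 2)%N.
  have hu (a b : 'I_k.+1) : (`|(a : nat)%:Z - (b : nat)%:Z|%N <= k)%N.
    by have := ltn_ord a; have := ltn_ord b; lia.
  by rewrite /gN /z /= mul2n -addnn leq_add // leq_exp2r.
exists `|z.1|%N, `|z.2|%N; rewrite -/(gN z).
move: pz; rewrite dvdzE /= => /dvdnP[m hm].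
by move: z0 zk kp; rewrite hm; case: m {hm} => [|[|m]]; rewrite ?mul1n //; nia.
Qed.

Lemma gprN : gN (gpr p) = p.
Proof.
rewrite /gpr; case: pselect => [h|[]]; first exact: projT2 (cid h).
by have [a [b h]] := exists_two_squares; exists (a%:Z, b%:Z).
Qed.

Lemma gpr_neq0 : gpr p != 0.
Proof. by rewrite -gN_eq0 gprN -lt0n prime_gt0. Qed.

End two_squares.

(** * Rigidity of sequences satisfying a Turan-Kubilius inequality *)

Definition gpow (e : gint) (i : nat) : gint := iter i (gmul^~ e) (1, 0).

Lemma gpow0 e : gpow e 0 = (1, 0). Proof. by []. Qed.

Lemma gpowS e i : gpow e i.+1 = gmul (gpow e i) e. Proof. by []. Qed.

Lemma gpowD e i j : gpow e (i + j) = gmul (gpow e i) (gpow e j).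
Proof.
by elim: j => [|j IH]; rewrite ?addn0 ?addnS ?gpowS ?IH ?gmulA // gmulC gmul1.
Qed.

Lemma gpow_neq0 e i : e != 0 -> gpow e i != 0.
Proof.
move=> e0; elim: i => // i IH; rewrite gpowS -gN_eq0 gN_mul muln_eq0 !gN_eq0.
by rewrite (negPf e0) (negPf IH).
Qed.

Lemma two_positive (R : realType) n (a : 'I_n -> R) :
  (forall i, 0 <= a i <= 1) -> 1 < \sum_i a i ->
  exists i j : 'I_n, [/\ (i < j)%N, 0 < a i & 0 < a j].
Proof.
move=> a01 sa.
have [i ai] : exists i, 0 < a i.
  apply: contrapT => /forallNP H; have : \sum_i a i <= 0; last by lra.
  by apply: sumr_le0 => i _; have /negP := H i; rewrite -leNgt.
have [j ji aj] : exists2 j, j != i & 0 < a j.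
  apply: contrapT => /forall2NP H; have : \sum_i a i <= 1; last by lra.
  rewrite (bigD1 i) //=; have /andP[_ h1] := a01 i.
  suff : \sum_(k | k != i) a k <= 0 by lra.
  by apply: sumr_le0 => k ki; case: (H k) => [//|/negP]; rewrite -leNgt.
case: (ltngtP i j) => h; [by exists i, j|by exists j, i|].
by rewrite (val_inj h) eqxx in ji.
Qed.

(** * Overlap of the translates of a large part of a scale *)

Section pigeonhole.
Variables (R : realType) (c0 C0 w d : R) (S : nat) (s E : seq nat) (e J : nat).
Hypothesis C0_gt0 : 0 < C0.
Hypothesis w01 : 0 < w <= 1.
Hypothesis scale_s : is_scale c0 C0 (4 / w) d S s.
Hypothesis subE : {subset E <= s}.
Hypothesis massE : 2^-1 <= wav s (pwt R s) (fun p => (p \in E)%:R).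
Hypothesis spe : sp e.
Hypothesis eS : (e <= S)%N.
Hypothesis J_ge : 4 * C0 <= J%:R.
Hypothesis d_small : d * (1 + J%:R * C0) <= 4^-1.
Hypothesis d_ge0 : 0 <= d.

(** Since E carries half of the scale, domination by [kap] gives the bump around E a mean of about
    1/(2 C0). Each translation by e costs at most d, so all J + 1 translated bumps keep means of at
    least 1/(4 C0), and together more than 1. At some point two of them are positive; dividing by
    e^i there gives the inequality. *)
Lemma scale_pigeonhole : exists i j x y,
  [/\ (i < j <= J)%N, x \in E, y \in E &
    nm (gpr x - gmul (gpow (gpr e) (j - i)) (gpr y)) <=
    w * (nm (gpr x) + nm (gmul (gpow (gpr e) (j - i)) (gpr y))) :> R].
Proof.
case: scale_s => us ssp sm [zs [kap [k0 k1 dom inv]]].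
have E0 : {in E, forall p, gpr p != 0}.
  by move=> p /subE /ssp /andP[h _]; apply: gpr_neq0.
have e0 : gpr e != 0 by apply: gpr_neq0.
have w0 : 0 < w by case/andP: w01.
have l0 : 0 < 4 / w by rewrite divr_gt0.
pose psi i := bump w E (gpow (gpr e) i).
have psi01 i z : 0 <= psi i z <= 1 by apply: bump01.
have psiT i : tame (4 / w) (psi i) by apply: bump_tame => //; apply: gpow_neq0.
have W0 : 2^-1 <= C0 * wav zs kap (psi 0%N) + d.
  apply: le_trans massE _; apply: le_trans (dom _ (psiT 0%N) (psi01 0%N)).
  apply: wav_le => [p _|p _]; first exact: pwt_ge0.
  case pE : (p \in E) => /=; last by case/andP: (psi01 0%N (gpr p)).
  by rewrite /psi gpow0 -[X in bump _ _ _ X]gmul1 bump_center.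
have WS i : wav zs kap (psi i) <= wav zs kap (psi i.+1) + d.
  have := inv _ _ spe eS (psiT i.+1).
  have -> : wav zs kap (fun z => psi i.+1 (gmul z (gpr e))) = wav zs kap (psi i).
    by apply: wav_ext => z _; rewrite /psi gpowS bump_mul.
  move=> /(_ _)/ler_normlP [|_].
    by move=> z; have /andP[h1 h2] := psi01 i.+1 z; rewrite ger0_norm.
  by lra.
have Wi i : wav zs kap (psi 0%N) - i%:R * d <= wav zs kap (psi i).
  elim: i => [|i IH]; first by rewrite mul0r subr0.
  by have := WS i; rewrite -natr1 mulrDl mul1r; lra.
have : 1 < wav zs kap (fun z => \sum_(i < J.+1) psi i z).
  rewrite wav_sum.
  apply: (@lt_le_trans _ _ (\sum_(i < J.+1) ((4 * C0)^-1))); last first.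
    apply: ler_sum => i _; apply: le_trans (Wi i).
    have iJ : (i : nat)%:R <= J%:R :> R by rewrite ler_nat -ltnS.
    have : (i : nat)%:R * d <= J%:R * d by rewrite ler_wpM2r.
    suff : (4 * C0)^-1 <= wav zs kap (psi 0%N) - J%:R * d by lra.
    rewrite -[(4 * C0)^-1]div1r ler_pdivrMr ?mulr_gt0 //.
    by move: W0 d_small; lra.
  rewrite sumr_const card_ord -[_ *+ J.+1]mulr_natl ltr_pdivlMr ?mulr_gt0 // mul1r.
  by move: J_ge; rewrite -natr1; lra.
move=> big; have [z] : exists z, 1 < \sum_(i < J.+1) psi i z.
  apply: contrapT => /forallNP H; move: big; apply/negP; rewrite -leNgt.
  by apply: wav_le_cst => // x _; rewrite leNgt; apply/negP/H.
case/two_positive => // i [j [ij hi' hj']].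
have hi := bump_gt0 w01 _ _ hi'; have hj := bump_gt0 w01 _ _ hj'.
have [x xE hx] := hi E0 (gpow_neq0 _ e0).
have [y yE hy] := hj E0 (gpow_neq0 _ e0).
exists i, j, x, y; split => //; first by rewrite ij -ltnS ltn_ord.
have jE : gpow (gpr e) j = gmul (gpow (gpr e) i) (gpow (gpr e) (j - i)).
  by rewrite -gpowD subnKC // ltnW.
have n0 : 0 < nm (gpow (gpr e) i) :> R by rewrite nm_gt0 gpow_neq0.
rewrite -(ler_pM2l n0) -nm_mul gmulBr mulrCA mulrDr -!nm_mul gmulA -jE.
set X := gmul _ (gpr x) in hx *; set Y := gmul _ (gpr y) in hy *.
have -> : X - Y = (X - z) + (z - Y) by rewrite addrA subrK.
by apply: le_trans (nm_triangle _ _ _) _; rewrite mulrDr lerD // nmB.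
Qed.

End pigeonhole.

(** * Mean squares under almost invariant measures *)

Section invariance.
Variables (R : realType) (l0 d : R) (S : nat) (zs : seq gint) (kap : gint -> R).
Notation W := (wav zs kap).
Hypothesis l0_gt0 : 0 < l0.
Hypothesis kap0 : forall z, 0 <= kap z.
Hypothesis kap1 : W (fun=> 1) = 1.
Hypothesis inv : forall q psi, sp q -> (q <= S)%N -> tame (2 * l0) psi ->
  (forall z, `|psi z| <= 1) -> `|W (fun z => psi (gmul z (gpr q))) - W psi| <= d.
Implicit Types f : gint -> R.

Let kap0' z : z \in zs -> 0 <= kap z. Proof. by []. Qed.

(** Squaring doubles the Lipschitz constant; this is why invariance is assumed for constants up to
    [2 * l0]. *)
Lemma tame_sqr l f : tame l f -> (forall z, `|f z| <= 1) ->
  tame (2 * l) (fun z => f z ^+ 2).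
Proof.
move=> tf f1 z w; have h1 := tf z w.
have h2 : `|f z + f w| <= 2.
  by apply: le_trans (ler_normD _ _) _; move: (f1 z) (f1 w); lra.
rewrite subr_sqr normrM.
have -> : `|f z - f w| * `|f z + f w| * nm z = `|f z + f w| * (`|f z - f w| * nm z) by ring.
have -> : 2 * l * nm (z - w) = 2 * (l * nm (z - w)) by ring.
by rewrite ler_pM ?mulr_ge0 ?nm_ge0.
Qed.

Lemma tame_mul l f u : tame l f -> u != 0 -> tame l (fun z => f (gmul z u)).
Proof.
move=> tf u0 z w; have n0 : 0 < nm u :> R by rewrite nm_gt0.
by rewrite -(ler_pM2r n0) -!mulrA -!nm_mul gmulBl tf.
Qed.

Lemma sqr_inv f q : sp q -> (q <= S)%N -> tame l0 f -> (forall z, `|f z| <= 1) ->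
  W (fun z => f (gmul z (gpr q)) ^+ 2) <= W (fun z => f z ^+ 2) + d.
Proof.
move=> sq qS tf f1; have := inv sq qS (tame_sqr tf f1).
move=> /(_ _)/ler_normlP[|_]; last by lra.
by move=> z; rewrite normrX expr_le1 // normr_ge0.
Qed.

Lemma sqr_inv_pow f e i : sp e -> (e <= S)%N -> tame l0 f -> (forall z, `|f z| <= 1) ->
  W (fun z => f (gmul z (gpow (gpr e) i)) ^+ 2) <= W (fun z => f z ^+ 2) + i%:R * d.
Proof.
move=> se eS; elim: i f => [|i IH] f tf f1.
  rewrite mul0r addr0 le_eqVlt; apply/orP; left; apply/eqP.
  by apply: wav_ext => z _; rewrite gpow0 gmulC gmul1.
have e0 := gpr_neq0 se.
have := IH _ (tame_mul tf e0) (fun z => f1 _).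
have := sqr_inv se eS tf f1; rewrite -natr1 mulrDl mul1r.
under [X in _ -> X <= _ -> _]wav_ext => z _ do rewrite -gmulA -gpowS.
by lra.
Qed.

Lemma diff_inv_pow f f' e i : sp e -> (e <= S)%N -> tame l0 f -> (forall z, `|f z| <= 1) ->
  tame l0 f' -> (forall z, `|f' z| <= 1) ->
  W (fun z => (f (gmul z (gpow (gpr e) i)) - f' (gmul z (gpow (gpr e) i))) ^+ 2) <=
  W (fun z => (f z - f' z) ^+ 2) + i%:R * (4 * d).
Proof.
move=> se eS tf f1 tf' f1'.
(* Halving the difference restores both the bound 1 and the constant [l0]; after squaring this
   accounts for the factor in [4 * d]. *)
have t z w : `|(f z - f' z) / 2 - (f w - f' w) / 2| * nm z <= l0 * nm (z - w).
  have -> : (f z - f' z) / 2 - (f w - f' w) / 2 = (f z - f w) / 2 - (f' z - f' w) / 2 by field.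
  have := tf z w; have := tf' z w.
  have : `|(f z - f w) / 2 - (f' z - f' w) / 2| <= `|f z - f w| / 2 + `|f' z - f' w| / 2.
    by apply: le_trans (ler_normB _ _) _; rewrite !normrM (ger0_norm (x := 2^-1)) // invr_ge0.
  by have := nm_ge0 R z; nra.
have b z : `|(f z - f' z) / 2| <= 1.
  rewrite normrM (ger0_norm (x := 2^-1)) ?invr_ge0 //.
  by have := ler_normB (f z) (f' z); move: (f1 z) (f1' z); lra.
have := sqr_inv_pow i se eS t b.
have h4 (F : gint -> R) : W (fun z => (F z / 2) ^+ 2) = 4^-1 * W (fun z => F z ^+ 2).
  by rewrite -wavZ; apply: wav_ext => z _; field.
rewrite (h4 (fun z => f (gmul z (gpow (gpr e) i)) - f' (gmul z (gpow (gpr e) i)))).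
rewrite (h4 (fun z => f z - f' z)); lra.
Qed.

End invariance.

(** * Near constancy of the mean square and its consequences *)

Lemma window_arith (R : realType) (eta a b c e : R) : 0 < eta -> a - b <= e ->
  4 * c <= eta -> e <= eta / 4 -> a - b + c <= eta.
Proof. by move=> *; lra. Qed.

(* [e] is chosen in [Pa]; [ssb] lists scales, one of which is used for the pigeonhole
   argument with the powers of [e]; [kap] is almost invariant under both. *)
Section square_mean.
Variables (R : realType) (c0 C0 l0 d dl eta w db : R) (S J Sa : nat).
Variables (zs : seq gint) (kap : gint -> R) (g : nat -> gint -> R).
Variables (Pa : seq nat) (ssb : seq (seq nat)) (K : nat).
Notation W := (wav zs kap).
Notation Pb := (flatten ssb).
Notation U P := (wav P (pwt R P)).
Variables r n : nat.
Hypothesis nE : n = r.+1.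
Hypothesis r_dvd : forall D, (0 < D <= J)%N -> (D %| r)%N.

Hypothesis c0_gt0 : 0 < c0.
Hypothesis C0_gt0 : 0 < C0.
Hypothesis l0_gt0 : 0 < l0.
Hypothesis w01 : 0 < w <= 1.
Hypothesis eta_gt0 : 0 < eta.
Hypothesis d_ge0 : 0 <= d.
Hypothesis dl01 : 0 <= dl <= 1.
Hypothesis w_small : 4 * w * l0 <= eta.
Hypothesis eta1 : eta <= 1.
Hypothesis w_half : w <= 2^-1.
Hypothesis kap0 : forall z, 0 <= kap z.
Hypothesis kap1 : W (fun=> 1) = 1.
Hypothesis inv : forall q psi, sp q -> (q <= S)%N -> tame (2 * l0) psi ->
  (forall z, `|psi z| <= 1) -> `|W (fun z => psi (gmul z (gpr q))) - W psi| <= d.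
Hypothesis g1 : forall k z, `|g k z| <= 1.
Hypothesis g_tame : forall k, tame l0 (g k).
Hypothesis Pa_sp : {in Pa, forall p, sp p && (p <= Sa)%N}.
Hypothesis Pa_mass : 0 < inv_mass R Pa.
Hypothesis SaS : (Sa <= S)%N.
Hypothesis ssb0 : 0 < inv_mass R Pb.
Hypothesis ssb_scale : {in ssb, forall s, is_scale c0 C0 (4 / w) db Sa s}.
Hypothesis Pb_S : {in Pb, forall p, (p <= S)%N}.
Hypothesis db_ge0 : 0 <= db.
Hypothesis db_small : db * (1 + J%:R * C0) <= 4^-1.
Hypothesis J_ge : 4 * C0 <= J%:R.
Hypothesis TKa : forall k z, `|g k z - U Pa (fun p => g k.+1 (gmul z (gpr p)))| <= dl.
Hypothesis TKb : forall k z, `|g k z - U Pb (fun p => g k.+1 (gmul z (gpr p)))| <= dl.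
Hypothesis K_ge : 4 <= K%:R * eta.
Hypothesis err_small : 4 * (n%:R * (d + 2 * dl)) <= eta.

Let kap0' z : z \in zs -> 0 <= kap z. Proof. by []. Qed.
Let Pb_sp p : p \in Pb -> sp p && (p <= S)%N.
Proof.
by move=> pP; rewrite Pb_S // andbT; have /andP[] := flatten_scale ssb_scale pP.
Qed.

Let dev k p : R := W (fun z => (g k.+1 (gmul z (gpr p)) - g k z) ^+ 2).

Let dev_ge0 k p : 0 <= dev k p.
Proof. by apply: wav_ge0 => // z _; apply: sqr_ge0. Qed.

Let normW k : R := W (fun z => g k z ^+ 2).

Let normW01 k : 0 <= normW k <= 1.
Proof.
rewrite wav_ge0 => //= [|z _]; last exact: sqr_ge0.
by apply: wav_le_cst => // z _; have /ler_normlP[] := g1 k z; nra.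
Qed.

(** As g_k(z) is nearly the mean of g_{k+1}(z pi), the mean square deviation is the difference of
    the mean squares of g_{k+1}(z pi) and g_k(z), and almost invariance of [kap] removes pi from the
    former. *)
Let dev_le P k : {in P, forall p, sp p && (p <= S)%N} -> 0 < inv_mass R P ->
  (forall z, `|g k z - U P (fun p => g k.+1 (gmul z (gpr p)))| <= dl) ->
  U P (dev k) <= normW k.+1 - normW k + (d + 2 * dl).
Proof.
move=> PS P0 tk.
have U0 p : p \in P -> 0 <= pwt R P p by rewrite pwt_ge0.
have -> : U P (dev k) =
    W (fun z => U P (fun p => (g k.+1 (gmul z (gpr p)) - g k z) ^+ 2)).
  by rewrite wav_exchange.
apply: (@le_trans _ _ (W (fun z => U P (fun p => g k.+1 (gmul z (gpr p)) ^+ 2) -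
    g k z ^+ 2 + 2 * dl))).
  apply: wav_le => // z _; apply: wav_variance_le => //; exact: pwt_sum1.
rewrite wavD wavB wav_cst // wav_exchange.
suff : U P (fun p => W (fun z => g k.+1 (gmul z (gpr p)) ^+ 2)) <= normW k.+1 + d.
  by rewrite /normW; lra.
apply: wav_le_cst => //; first exact: pwt_sum1.
by move=> p /PS /andP[sp1 pS]; apply: (sqr_inv inv).
Qed.

(** Mean squares lie in [0, 1], so among K consecutive windows of length n one has an increase of at
    most 1/K. The window is selected by the mean squares of the g_k alone, hence the same one serves
    for [Pa] and for [Pb]. *)
Let good_window : exists2 k, (0 < k <= K * n)%N &
  \sum_(i < n) U Pa (dev (k + i)) <= eta /\ \sum_(i < n) U Pb (dev (k + i)) <= eta.
Proof.
have K0 : (0 < K)%N by rewrite lt0n; apply/eqP => h; move: K_ge; rewrite h mul0r; lra.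
(* The windows start at index 1 because the conclusion is carried back to g_1. *)
pose X j := normW (1 + j * n).
have [j jK hj] : exists2 j, (j < K)%N & X j.+1 - X j <= K%:R^-1.
  have iK : 0 < K%:R :> R by rewrite ltr0n.
  have c0' (j : nat) : j \in iota 0 K -> 0 <= (fun=> K%:R^-1) j :> R by rewrite invr_ge0 ltW.
  have [||j] := @wav_exists_le _ _ _ _ c0' _ (fun j => X j.+1 - X j) K%:R^-1.
  - rewrite /wav; under eq_bigr do rewrite mulr1.
    by rewrite big_const_seq count_predT size_iota iter_addr_0 -[_ *+ K]mulr_natl divff // gt_eqF.
  - rewrite /wav -mulr_sumr -[leRHS]mulr1 ler_wpM2l ?invr_ge0 ?(ltW iK) //.
    rewrite -[X in iota 0 X]subn0 -/(index_iota 0 K) telescope_sumr //.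
    by have /andP[? ?] := normW01 (1 + K * n); have /andP[? ?] := normW01 (1 + 0 * n); rewrite /X; lra.
  - by rewrite mem_iota add0n /= => jK hj; exists j.
exists (1 + j * n)%N; first rewrite add1n /=.
  by apply: leq_trans (_ : j.+1 * n <= _)%N; [rewrite mulSn -add1n leq_add2r nE|rewrite leq_mul2r jK orbT].
have win P : {in P, forall p, sp p && (p <= S)%N} -> 0 < inv_mass R P ->
    (forall k z, `|g k z - U P (fun p => g k.+1 (gmul z (gpr p)))| <= dl) ->
    \sum_(i < n) U P (dev (1 + j * n + i)) <= eta.
  move=> PS P0 tk.
  apply: (@le_trans _ _ (\sum_(i < n) (normW (1 + j * n + i).+1 - normW (1 + j * n + i) + (d + 2 * dl)))).
    by apply: ler_sum => i _; apply: dev_le.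
  rewrite big_split /= sumr_const card_ord -[_ *+ n]mulr_natl.
  under eq_bigr do rewrite -addnS.
  rewrite -(big_mkord xpredT (fun i => normW (1 + j * n + i.+1) - normW (1 + j * n + i))).
  rewrite (telescope_sumr (fun i => normW (1 + j * n + i))) // addn0.
  have -> : (1 + j * n + n = 1 + j.+1 * n)%N by rewrite mulSn -addnA (addnC n).
  have : K%:R^-1 <= eta / 4.
    by rewrite -[_^-1]div1r ler_pdivrMr ?ltr0n //; move: K_ge; lra.
  move: hj err_small; rewrite -/(X j.+1) -/(X j).
  by move: (X j.+1) (X j) (n%:R * (d + 2 * dl)) (K%:R^-1 : R) => a b c e h1 h2 h3; exact: (window_arith eta_gt0 h1 h2 h3).
by split; apply: win => // p /Pa_sp /andP[-> /leq_trans]; apply.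
Qed.

Let exists_e k : \sum_(i < n) U Pa (dev (k + i)) <= eta ->
  exists2 e, e \in Pa & forall i, (i < n)%N -> dev (k + i) e <= eta.
Proof.
rewrite -wav_sum => h.
have [||e ePa he] := wav_exists_le _ _ h; first by move=> p _; apply: pwt_ge0.
  exact: pwt_sum1.
exists e => // i ni; apply: le_trans he.
rewrite (bigD1 (Ordinal ni)) //= lerDl sumr_ge0 // => *; exact: dev_ge0.
Qed.

(** Averaging over the scales gives one whose mean total deviation is at most eta; by Markov's
    inequality at least half of its mass has total deviation at most 2 eta. A single scale is needed
    because the domination by [kap] holds scale by scale. *)
Let exists_E k : \sum_(i < n) U Pb (dev (k + i)) <= eta ->
  exists s (E : seq nat), [/\ s \in ssb, {subset E <= s},
    2^-1 <= U s (fun p => (p \in E)%:R) &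
    forall p i, p \in E -> (i < n)%N -> dev (k + i) p <= 2 * eta].
Proof.
rewrite -wav_sum; set D := fun p => _ => h.
have mass_gt0 : {in ssb, forall s, 0 < inv_mass R s}.
  by move=> s /ssb_scale[_ _ + _]; apply: lt_le_trans.
have [s sb hs] : exists2 s, s \in ssb & U s D <= eta.
  have c0' s : s \in ssb -> 0 <= (inv_mass R Pb)^-1 * inv_mass R s.
    by move=> /mass_gt0/ltW ?; rewrite mulr_ge0 // invr_ge0 ltW.
  apply: (wav_exists_le c0').
    rewrite /wav; under eq_bigr do rewrite mulr1.
    by rewrite -mulr_sumr -inv_mass_flatten mulVf // gt_eqF.
  move: h; rewrite wav_flatten // mulr_sumr.
  by under eq_bigr do rewrite mulrA.
exists s, [seq p <- s | D p <= 2 * eta]; split => //.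
- by move=> p; rewrite mem_filter => /andP[].
- have p0 p : p \in s -> 0 <= pwt R s p by rewrite pwt_ge0.
  have : U s (fun p => 1 - (p \in [seq p <- s | D p <= 2 * eta])%:R) <= U s (fun p => (2 * eta)^-1 * D p).
    apply: wav_le => // p ps; rewrite mem_filter ps andbT.
    have D0 : 0 <= D p by apply: sumr_ge0 => i _; apply: dev_ge0.
    have e2 : 0 < 2 * eta by rewrite mulr_gt0.
    case: (lerP (D p) (2 * eta)) => h' /=; first by rewrite subrr mulr_ge0 // invr_ge0 ltW.
    by rewrite subr0 mulrC ler_pdivlMr // mul1r ltW.
  rewrite wavB wavZ pwt_sum1 ?mass_gt0 //.
  have : (2 * eta)^-1 * U s D <= 2^-1.
    by have e2 := eta_gt0; rewrite mulrC ler_pdivrMr; lra.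
  by lra.
- move=> p i; rewrite mem_filter => /andP[hp _] ni; apply: le_trans hp.
  rewrite /D (bigD1 (Ordinal ni)) //= lerDl sumr_ge0 // => *; exact: dev_ge0.
Qed.

(** Four errors, one for each leg of the path in [gap_step], in that order; the outer 4 comes from
    the square of a sum of four terms. The factor J^2 on the first leg is Cauchy-Schwarz over at
    most J steps. *)
Definition gap_bound : R := 4 * (J%:R ^+ 2 * (eta + J%:R * (4 * d)) +
  (2 * eta + J%:R * (4 * d)) + eta + 2 * eta).

(** The path is g_m(z), g_{m+D}(z e^D), g_{m+D+1}(z e^D y), g_{m+D+1}(z x), g_{m+D}(z). Its legs are
    D multiplications by e, one by y, the Lipschitz comparison of e^D y with x, and one division by
    x. The index has risen by D while the point has returned to z. *)
Let gap_step k D e x y m : sp e -> (e <= S)%N -> (D <= J)%N ->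
  sp x -> sp y ->
  (forall i, (i < n)%N -> dev (k + i) e <= eta) ->
  (forall i, (i < n)%N -> dev (k + i) x <= 2 * eta) ->
  (forall i, (i < n)%N -> dev (k + i) y <= 2 * eta) ->
  nm (gpr x - gmul (gpow (gpr e) D) (gpr y)) <=
    w * (nm (gpr x) + nm (gmul (gpow (gpr e) D) (gpr y))) :> R ->
  (k <= m)%N -> (m + D < k + n)%N ->
  W (fun z => (g m z - g (m + D) z) ^+ 2) <= gap_bound.
Proof.
move=> se eS DJ sx sy de dx dy hxy km mD.
have dk p i (b : R) : (forall i, (i < n)%N -> dev (k + i) p <= b) ->
    (k <= i)%N -> (i < k + n)%N -> dev i p <= b.
  by move=> h ki ik; rewrite -(subnKC ki); apply: h; rewrite ltn_subLR.
have e0 := gpr_neq0 se; have x0 := gpr_neq0 sx; have y0 := gpr_neq0 sy.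
have DJr : D%:R <= J%:R :> R by rewrite ler_nat.
have dev_pow p i q (b : R) : sp p -> dev i p <= b -> (q <= J)%N ->
    W (fun z => (g i.+1 (gmul (gmul z (gpow (gpr e) q)) (gpr p)) -
      g i (gmul z (gpow (gpr e) q))) ^+ 2) <= b + J%:R * (4 * d).
  move=> spp db' qJ.
  have := diff_inv_pow inv q se eS (tame_mul (g_tame i.+1) (gpr_neq0 spp)) (fun z => g1 _ _) (g_tame i) (g1 i).
  have : q%:R * (4 * d) <= J%:R * (4 * d) by rewrite ler_wpM2r ?ler_nat // mulr_ge0.
  by move: db'; rewrite /dev; lra.
pose A i z := g (m + i) (gmul z (gpow (gpr e) i)) - g (m + i.+1) (gmul z (gpow (gpr e) i.+1)).
have hA z : \sum_(i < D) A i z = g m z - g (m + D) (gmul z (gpow (gpr e) D)).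
  transitivity (- \sum_(i < D) (g (m + i.+1) (gmul z (gpow (gpr e) i.+1)) -
     g (m + i) (gmul z (gpow (gpr e) i)))).
    by rewrite -sumrN; apply: eq_bigr => i _; rewrite opprB.
  rewrite -(big_mkord xpredT (fun i => g (m + i.+1) (gmul z (gpow (gpr e) i.+1)) -
     g (m + i) (gmul z (gpow (gpr e) i)))).
  rewrite (telescope_sumr (fun i => g (m + i) (gmul z (gpow (gpr e) i)))) // opprB.
  by rewrite addn0 gpow0 gmulC gmul1.
have b1 : W (fun z => (g m z - g (m + D) (gmul z (gpow (gpr e) D))) ^+ 2) <=
    J%:R ^+ 2 * (eta + J%:R * (4 * d)).
  apply: (@le_trans _ _ (W (fun z => D%:R * \sum_(i < D) A i z ^+ 2))).
    by apply: wav_le => // z _; rewrite -hA; exact: (sum_sqr_le D (fun i => A i z)).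
  rewrite wavZ wav_sum expr2 -mulrA.
  apply: ler_pM => //.
    by apply: sumr_ge0 => i _; apply: wav_ge0 => // z _; apply: sqr_ge0.
  have c0' : 0 <= eta + J%:R * (4 * d) by rewrite addr_ge0 ?mulr_ge0 // ltW.
  apply: le_trans (_ : \sum_(i < D) (eta + J%:R * (4 * d)) <= _); last first.
    by rewrite sumr_const card_ord -[_ *+ D]mulr_natl ler_wpM2r.
  apply: ler_sum => i _.
  have iJ : (i <= J)%N by apply: leq_trans DJ; apply: ltnW.
  have hd : dev (m + i) e <= eta.
    by apply: (dk _ _ _ de); [apply: leq_trans (leq_addr _ _)|apply: leq_ltn_trans mD; rewrite leq_add2l ltnW].
  apply: le_trans (dev_pow _ _ _ _ se hd iJ).
  rewrite le_eqVlt; apply/orP; left; apply/eqP; apply: wav_ext => z _.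
  by rewrite /A gpowS gmulA addnS -sqrrN opprB.
have kmD : (k <= m + D)%N by apply: leq_trans (leq_addr _ _).
have b2 := dev_pow _ _ _ _ sy (dk _ _ _ dy kmD mD) DJ.
have b4 := dk _ _ _ dx kmD mD.
have b3 z : (g (m + D).+1 (gmul (gmul z (gpow (gpr e) D)) (gpr y)) -
    g (m + D).+1 (gmul z (gpr x))) ^+ 2 <= eta.
  have [->|z0] := eqVneq z 0.
    have g0 u : gmul 0 u = 0 by case: u => a b; rewrite /gmul /=; congr pair; ring.
    by rewrite !g0 subrr expr2 mul0r ltW.
  rewrite -gmulA; set Y := gmul _ (gpr y) in hxy *.
  have nx : 0 < nm (gpr x) :> R by rewrite nm_gt0.
  have nz : 0 < nm z :> R by rewrite nm_gt0.
  (* As w <= 1/2, the proximity of x and Y forces |Y| <= 3 |x|, hence |x - Y| <= 4 w |x|, which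
     explains the hypothesis [w_small]. *)
  have nY : nm Y <= 3 * nm (gpr x) :> R.
    have := nm_triangle R (Y - gpr x) (gpr x); rewrite subrK nmB.
    have := nm_ge0 R Y; move: w_half w01 hxy => ? /andP[? ?] ? ? ?; nra.
  have := g_tame (m + D).+1 (gmul z (gpr x)) (gmul z Y).
  rewrite -gmulBr !nm_mul => ht.
  set a := g _ (gmul z (gpr x)) in ht *; set b := g _ (gmul z Y) in ht *.
  have ab : `|a - b| <= eta.
    apply: le_trans w_small; rewrite -(ler_pM2r (mulr_gt0 nz nx)).
    apply: le_trans ht _.
    have -> : l0 * (nm z * nm (gpr x - Y)) = nm z * l0 * nm (gpr x - Y) :> R by ring.
    have -> : 4 * w * l0 * (nm z * nm (gpr x)) = nm z * l0 * (w * (4 * nm (gpr x))) :> R by ring.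
    apply: ler_wpM2l; first by rewrite mulr_ge0 // ltW.
    apply: le_trans hxy _; rewrite ler_wpM2l //; first by case/andP: w01 => /ltW.
    lra.
  rewrite -sqrrN opprB -real_normK ?num_real //.
  by move: (normr_ge0 (a - b)) eta1 ab eta_gt0 => ? ? ? ?; nra.
apply: (@le_trans _ _ (W (fun z => 4 * ((g m z - g (m + D) (gmul z (gpow (gpr e) D))) ^+ 2
    + (g (m + D).+1 (gmul (gmul z (gpow (gpr e) D)) (gpr y)) - g (m + D) (gmul z (gpow (gpr e) D))) ^+ 2
    + eta + (g (m + D).+1 (gmul z (gpr x)) - g (m + D) z) ^+ 2)))).
  apply: wav_le => // z _; have := b3 z.
  move: (g m z) (g (m + D)%N z) (g (m + D) (gmul z (gpow (gpr e) D))) => a1 a2 a3.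
  move: (g _ (gmul z (gpr x))) (g (m + D).+1 _) => a4 a5 h.
  apply: (@le_trans _ _ (4 * ((a1 - a3) ^+ 2 + (a5 - a3) ^+ 2 + (a5 - a4) ^+ 2 + (a4 - a2) ^+ 2))); last by lra.
  have -> : a1 - a2 = (a1 - a3) - (a5 - a3) + (a5 - a4) + (a4 - a2) by ring.
  move: (a1 - a3) (a5 - a3) (a5 - a4) (a4 - a2) => p q u v.
  have := sqr_ge0 (p + q); have := sqr_ge0 (p - u); have := sqr_ge0 (p - v).
  have := sqr_ge0 (q + u); have := sqr_ge0 (q + v); have := sqr_ge0 (u - v); nra.
rewrite wavZ !wavD wav_cst // /gap_bound ler_pM2l //.
rewrite !lerD //.
Qed.

Let gap_bound_ge0 : 0 <= gap_bound.
Proof. have e0 := ltW eta_gt0; have d0 := d_ge0; have J0 : 0 <= J%:R :> R by [].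
have h : 0 <= J%:R * (4 * d) by rewrite !mulr_ge0.
by rewrite /gap_bound mulr_ge0 // !addr_ge0 // ?mulr_ge0 // addr_ge0. Qed.

(** The difference D = j - i is at most J, so it divides r, and q = r / D steps of length D stay
    within the window of length r + 1. A second Cauchy-Schwarz costs q^2 <= r^2. *)
Let far_gap : exists2 k, (0 < k <= K * n)%N &
  W (fun z => (g k z - g (k + r) z) ^+ 2) <= r%:R ^+ 2 * gap_bound.
Proof.
have [k kK [/exists_e [e ePa de] /exists_E [s [E [sb Es massE dE]]]]] := good_window.
exists k => //.
have /andP[se eSa] := Pa_sp ePa.
have [i [j [x [y [/andP[ij jJ] xE yE hxy]]]]] := scale_pigeonhole C0_gt0 w01
  (ssb_scale sb) Es massE se eSa J_ge db_small db_ge0.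
set D := (j - i)%N in hxy.
have D0 : (0 < D)%N by rewrite subn_gt0.
have DJ : (D <= J)%N by apply: leq_trans jJ; apply: leq_subr.
have Esp p : p \in E -> sp p.
  by move=> /Es ps; have [_ /(_ p ps)/andP[]] := ssb_scale sb.
have /dvdnP[q rq] : (D %| r)%N by apply: r_dvd; rewrite D0.
have step t : (t < q)%N -> W (fun z => (g (k + t * D) z - g (k + t.+1 * D) z) ^+ 2) <= gap_bound.
  move=> tq.
  have h : (t.+1 * D <= r)%N by rewrite rq leq_mul2r tq orbT.
  have -> : (k + t.+1 * D = k + t * D + D)%N by rewrite mulSn (addnC D) addnA.
  apply: (gap_step se (leq_trans eSa SaS) DJ (Esp _ xE) (Esp _ yE) de _ _ hxy).
  - by move=> i'; apply: dE.
  - by move=> i'; apply: dE.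
  - exact: leq_addr.
  - by rewrite -addnA ltn_add2l nE ltnS addnC -mulSn.
pose A t z := g (k + t * D) z - g (k + t.+1 * D) z.
have hA z : g k z - g (k + r) z = \sum_(t < q) A t z.
  transitivity (- \sum_(t < q) (g (k + t.+1 * D) z - g (k + t * D) z)).
    rewrite -(big_mkord xpredT (fun t => g (k + t.+1 * D) z - g (k + t * D) z)).
    by rewrite (telescope_sumr (fun t => g (k + t * D) z)) // opprB mul0n addn0 -rq.
  by rewrite -sumrN; apply: eq_bigr => t _; rewrite opprB.
apply: (@le_trans _ _ (W (fun z => q%:R * \sum_(t < q) A t z ^+ 2))).
  by apply: wav_le => // z _; rewrite hA; exact: (sum_sqr_le q (fun t => A t z)).
rewrite wavZ wav_sum; apply: (@le_trans _ _ (q%:R * (q%:R * gap_bound))).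
  rewrite ler_wpM2l //; apply: le_trans (_ : \sum_(t < q) gap_bound <= _).
    by apply: ler_sum => t _; apply: step.
  by rewrite sumr_const card_ord -[_ *+ q]mulr_natl.
rewrite mulrA -expr2 ler_wpM2r // lerXn2r ?nnegrE // ler_nat rq.
by rewrite leq_pmulr.
Qed.

(** The difference g_j - g_{j+r} is itself nearly the mean over [Pa] of the same difference at index
    j + 1, so Jensen's inequality bounds its mean square by the next one. Smallness thus travels
    from the unknown index of the good window down to 1. *)
Let back_step j : W (fun z => (g j z - g (j + r) z) ^+ 2) <=
  W (fun z => (g j.+1 z - g (j.+1 + r) z) ^+ 2) + (4 * d + 8 * dl).
Proof.
pose D j z := g j z - g (j + r) z.
have D2 i z : `|D i z| <= 2.
  by have := ler_normB (g i z) (g (i + r) z); rewrite /D; move: (g1 i z) (g1 (i + r) z); lra.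
have U1 : U Pa (fun=> 1) = 1 by apply: pwt_sum1.
have U0 p : p \in Pa -> 0 <= pwt R Pa p by rewrite pwt_ge0.
have key z : D j z ^+ 2 <= U Pa (fun p => D j.+1 (gmul z (gpr p)) ^+ 2) + 8 * dl.
  apply: (@le_trans _ _ (U Pa (fun p => D j.+1 (gmul z (gpr p))) ^+ 2 + 8 * dl)); last first.
    by rewrite lerD2r wav_jensen.
  have : `|D j z - U Pa (fun p => D j.+1 (gmul z (gpr p)))| <= 2 * dl.
    rewrite /D wavB addSn; have := TKa j z; have := TKa (j + r) z.
    move: (U Pa _) (U Pa _) => a b ha hb.
    have -> : g j z - g (j + r) z - (a - b) = (g j z - a) - (g (j + r) z - b) by ring.
    by apply: le_trans (ler_normB _ _) _; lra.
  have : `|U Pa (fun p => D j.+1 (gmul z (gpr p)))| <= 2.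
    by apply: le_trans (wav_norm _ _) _ => //; apply: wav_le_cst.
  move: (U Pa _) (D2 j z) => a; move: (D j z) => b /ler_normlP[? ?] /ler_normlP[? ?] /ler_normlP[? ?].
  have /andP[? ?] := dl01.
  have -> : b ^+ 2 = a ^+ 2 + (b - a) * (b + a) by ring.
  by nra.
apply: (@le_trans _ _ (W (fun z => U Pa (fun p => D j.+1 (gmul z (gpr p)) ^+ 2) + 8 * dl))).
  by apply: wav_le => // z _; apply: key.
rewrite wavD wav_cst // addrA lerD2r wav_exchange; apply: wav_le_cst => // p pPa.
have /andP[spp pSa] := Pa_sp pPa.
have := diff_inv_pow inv 1 spp (leq_trans pSa SaS) (g_tame j.+1) (g1 j.+1) (g_tame (j.+1 + r)) (g1 (j.+1 + r)).
rewrite mul1r; apply: le_trans; rewrite le_eqVlt; apply/orP; left; apply/eqP.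
by apply: wav_ext => z _; rewrite gpowS gpow0 gmul1.
Qed.

Lemma square_mean_le : W (fun z => (g 1 z - g (1 + r) z) ^+ 2) <=
  r%:R ^+ 2 * gap_bound + (K * n)%:R * (4 * d + 8 * dl).
Proof.
have [k /andP[k0 kK] hk] := far_gap.
have e0 : 0 <= 4 * d + 8 * dl by have /andP[? _] := dl01; rewrite addr_ge0 ?mulr_ge0.
have back i : W (fun z => (g 1 z - g (1 + r) z) ^+ 2) <=
    W (fun z => (g (1 + i) z - g (1 + i + r) z) ^+ 2) + i%:R * (4 * d + 8 * dl).
  elim: i => [|i IH]; first by rewrite addn0 mul0r addr0.
  apply: le_trans IH _; rewrite -[i.+1%:R]natr1 [(_ + 1) * _]mulrDl mul1r.
  by rewrite [X in _ <= _ + X]addrC addrA lerD2r addnS; exact: back_step.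
apply: le_trans (back k.-1) _; rewrite add1n prednK // lerD // ler_wpM2r // ler_nat.
exact: leq_trans (leq_pred _) kK.
Qed.

End square_mean.

(** * Choice of the parameters and return to the point 1 *)

Section rigidity.
Variables (R : realType) (c0 C0 : R).
Hypothesis c0_gt0 : 0 < c0.
Hypothesis C0_gt0 : 0 < C0.
Hypothesis scaleP : forall l d S, 0 < l -> 0 < d -> exists s, is_scale c0 C0 l d S s.

Definition turan_kubilius (C1 : R) (g : nat -> gint -> R) :=
  forall P : seq nat, uniq P -> {in P, forall p, sp p} -> 0 < inv_mass R P ->
  forall k z, `|g k z - wav P (pwt R P) (fun p => g k.+1 (gmul z (gpr p)))| <=
    C1 / Num.sqrt (inv_mass R P).

Let turan_kubilius_le C1 g dl m ss l d S : 0 < C1 -> 0 < dl -> (0 < m)%N ->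
  (C1 / dl) ^+ 2 <= m%:R * c0 -> turan_kubilius C1 g ->
  size ss = m -> uniq (flatten ss) -> {in ss, forall s, is_scale c0 C0 l d S s} ->
  0 < inv_mass R (flatten ss) /\
  forall k z, `|g k z - wav (flatten ss) (pwt R (flatten ss))
    (fun p => g k.+1 (gmul z (gpr p)))| <= dl.
Proof.
move=> C10 dl0 m0 hm tk szs us hs.
have hM := inv_mass_flatten_ge hs; rewrite szs in hM.
have M0 : 0 < inv_mass R (flatten ss).
  by apply: lt_le_trans hM; rewrite mulr_gt0 // ltr0n.
split => // k z; apply: le_trans (tk _ us _ M0 k z) _.
  by move=> p /(flatten_scale hs) /andP[].
rewrite ler_pdivrMr ?sqrtr_gt0 // mulrC -ler_pdivrMr //.
rewrite -(ler_pXn2r (n := 2)) ?nnegrE ?sqrtr_ge0 ?divr_ge0 ?(ltW C10) ?(ltW dl0) //.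
by rewrite sqr_sqrtr ?(ltW M0) //; apply: le_trans hm hM.
Qed.

Let leq_flatten_max (s : seq nat) p : p \in s -> (p <= \max_(q <- s) q)%N.
Proof. by move=> ps; rewrite (leq_bigmax_seq (P := xpredT) (F := id)). Qed.

(** Three unions of scales are built in turn: [Pa] provides e; [Pb], almost invariant under the
    primes of [Pa], provides x and y; [Pt], almost invariant under all earlier primes, provides the
    measures for the mean squares. By Turan-Kubilius over [Pt], g_0(1) - g_r(1) is nearly a mean of
    g_1 - g_{1+r} over the primes of [Pt], and domination bounds this by means over [kap]. *)
Let approx (J : nat) (l0 C1 eps : R) (g : nat -> gint -> R) :
  4 * C0 <= J%:R -> 0 < l0 -> 0 < C1 -> 0 < eps <= 1 ->
  (forall k z, `|g k z| <= 1) -> (forall k, tame l0 (g k)) ->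
  turan_kubilius C1 g ->
  `|g 0%N (1, 0) - g J`! (1, 0)| <= (4 + 2 * C0) * eps.
Proof.
move=> hJ l00 C10 /andP[e0 e1] g1 gt tk.
set r := J`!; set n := r.+1.
have r0 : 0 < r%:R :> R by rewrite ltr0n fact_gt0.
have r1 : 1 <= r%:R :> R by rewrite ler1n fact_gt0.
have n1 : 1 <= n%:R :> R by rewrite ler1n.
have J0 : 0 <= J%:R :> R by [].
pose G : R := 4 * (J%:R ^+ 2 * (1 + 4 * J%:R) + 5 + 4 * J%:R).
have G20 : 20 <= G.
  have : 0 <= J%:R ^+ 2 * (1 + 4 * J%:R) :> R by rewrite mulr_ge0 ?sqr_ge0 // addr_ge0 // mulr_ge0.
  by rewrite /G; lra.
have ee : 0 < eps ^+ 2 by rewrite exprn_gt0.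
have ee1 : eps ^+ 2 <= 1 by rewrite exprn_ile1 // ltW.
have rr1 : 1 <= r%:R ^+ 2 :> R by rewrite exprn_ege1.
(* Chosen so that r^2 times [gap_bound], at most r^2 G eta, is at most eps^2 / 2. *)
pose eta := eps ^+ 2 / (2 * r%:R ^+ 2 * G).
have den : 1 <= 2 * r%:R ^+ 2 * G by nra.
have den0 : 0 < 2 * r%:R ^+ 2 * G by lra.
have eta0 : 0 < eta by rewrite divr_gt0.
have eta1 : eta <= 1 by rewrite ler_pdivrMr // mul1r; lra.
have l2 : 0 < 4 * l0 + 2 by lra.
pose w := eta / (4 * l0 + 2).
have w0 : 0 < w by rewrite divr_gt0.
have wl : 4 * w * l0 <= eta.
  have -> : 4 * w * l0 = eta * (4 * l0 / (4 * l0 + 2)) by rewrite /w; field; rewrite gt_eqF.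
  by rewrite ler_piMr ?(ltW eta0) // ler_pdivrMr // mul1r; lra.
have wh : w <= 2^-1.
  by rewrite ler_pdivrMr //; lra.
have [K hK] : exists K : nat, 4 / eta <= K%:R.
  by exists (Num.truncn (4 / eta)).+1; rewrite ltW // truncnS_gt.
have K1 : 1 <= K%:R :> R.
  by apply: le_trans hK; rewrite ler_pdivlMr // mul1r; lra.
have hK' : 4 <= K%:R * eta by rewrite -ler_pdivrMr.
have Kn0 : 1 <= K%:R * n%:R ^+ 2 :> R by rewrite mulr_ege1 // exprn_ege1.
have den2 : 0 < 24 * (K%:R * n%:R ^+ 2) :> R by lra.
(* Small enough both for the n errors within a window and for the at most K n steps back, which
   together cost at most eps^2 / 2. *)
pose dl := eps ^+ 2 * eta / (24 * (K%:R * n%:R ^+ 2)).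
have dl0 : 0 < dl by rewrite divr_gt0 // mulr_gt0.
have eeta : eps ^+ 2 * eta <= eta by rewrite ler_piMl // ltW.
have eeta0 : 0 < eps ^+ 2 * eta by rewrite mulr_gt0.
have dle : 24 * (K%:R * n%:R ^+ 2) * dl = eps ^+ 2 * eta.
  by rewrite mulrC divfK // gt_eqF.
have dl_eta : dl <= eta by nra.
have dl_eps : dl <= eps.
  have : eps ^+ 2 * eta <= eps * 1 by rewrite expr2 -mulrA ler_wpM2l ?(ltW e0) // mulr_ile1 // ltW.
  by nra.
have hn2 : n%:R <= K%:R * n%:R ^+ 2 :> R.
  by rewrite expr2 mulrA ler_peMl // mulr_ege1.
have hn3 : K%:R * n%:R <= K%:R * n%:R ^+ 2 :> R.
  by rewrite ler_wpM2l ?ler_eXnr //; lra.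
have err1 : 4 * (n%:R * (dl + 2 * dl)) <= eta.
  have : n%:R * dl <= K%:R * n%:R ^+ 2 * dl by rewrite ler_wpM2r // ltW.
  by lra.
have err2 : (K * n)%:R * (4 * dl + 8 * dl) <= eps ^+ 2 / 2.
  have : K%:R * n%:R * dl <= K%:R * n%:R ^+ 2 * dl by rewrite ler_wpM2r // ltW.
  have : eps ^+ 2 * eta <= eps ^+ 2 by rewrite ler_piMr // ltW.
  by rewrite natrM; lra.
have gapb : r%:R ^+ 2 * gap_bound dl eta J <= eps ^+ 2 / 2.
  have : gap_bound dl eta J <= G * eta.
    have Jd : J%:R * (4 * dl) <= 4 * J%:R * eta.
      by rewrite mulrCA -mulrA !ler_wpM2l.
    have -> : G * eta = 4 * (J%:R ^+ 2 * (eta + 4 * J%:R * eta) + (2 * eta + 4 * J%:R * eta) + eta + 2 * eta).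
      by rewrite /G; ring.
    rewrite /gap_bound ler_pM2l // lerD2r lerD2r lerD ?lerD2l //.
    by rewrite ler_wpM2l ?sqr_ge0 // lerD2l.
  move=> h; apply: (@le_trans _ _ (r%:R ^+ 2 * (G * eta))).
    by rewrite ler_wpM2l // sqr_ge0.
  rewrite /eta le_eqVlt; apply/orP; left; apply/eqP; field.
  by rewrite !gt_eqF //; lra.
have JC : 0 < 1 + J%:R * C0 by rewrite ltr_pwDl // mulr_ge0 // ltW.
pose db := (4 * (1 + J%:R * C0))^-1.
have db0 : 0 < db by rewrite invr_gt0 mulr_gt0.
have dbs : db * (1 + J%:R * C0) <= 4^-1.
  by rewrite /db invfM -mulrA mulVf ?mulr1 // gt_eqF.
have [m [m0 hm]] : exists m : nat, (0 < m)%N /\ (C1 / dl) ^+ 2 <= m%:R * c0.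
  exists (Num.truncn ((C1 / dl) ^+ 2 / c0)).+1; split => //.
  by rewrite -ler_pdivrMr // ltW // truncnS_gt.
have [ssa [sza ua ha]] := multiscale scaleP 0 m ltr01 ltr01.
have [Ma tka] := turan_kubilius_le C10 dl0 m0 hm tk sza ua ha.
set Pa := flatten ssa in Ma tka.
set Sa := (\max_(p <- Pa) p)%N.
have w4 : 0 < 4 / w by rewrite divr_gt0.
have [ssb [szb ub hb]] := multiscale scaleP Sa m w4 db0.
have [Mb tkb] := turan_kubilius_le C10 dl0 m0 hm tk szb ub hb.
set Sb := maxn Sa (\max_(p <- flatten ssb) p)%N.
have l02 : 0 < 2 * l0 by rewrite mulr_gt0.
have [sst [szt ut ht]] := multiscale scaleP Sb m l02 dl0.
have [Mt tkt] := turan_kubilius_le C10 dl0 m0 hm tk szt ut ht.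
pose D z := g 1%N z - g (1 + r)%N z.
have D2 z : `|D z| <= 2.
  by have := ler_normB (g 1%N z) (g (1 + r)%N z); rewrite /D; move: (g1 1%N z) (g1 (1 + r)%N z); lra.
set Pt := flatten sst in Mt tkt.
have hUt : wav Pt (pwt R Pt) (fun p => `|D (gpr p)|) <= 2 * C0 * eps + 2 * dl.
  apply: wav_flatten_le; first by rewrite -size_eq0 szt -lt0n.
    by move=> s /ht[_ _ + _]; apply: lt_le_trans.
  move=> s sst'; have [_ _ _ [zs [kap [k0 k1 dom inv]]]] := ht _ sst'.
  have Dt : tame (2 * l0) (fun z => `|D z| / 2).
    move=> z z'; rewrite -mulrBl normrM (ger0_norm (x := 2^-1)) ?invr_ge0 //.
    have h1 := gt 1%N z z'; have h2 := gt (1 + r)%N z z'.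
    have h3 : `| `|D z| - `|D z'| | <= `|g 1%N z - g 1%N z'| + `|g (1 + r)%N z - g (1 + r)%N z'|.
      apply: le_trans (ler_dist_dist _ _) _.
      have -> : D z - D z' = (g 1%N z - g 1%N z') - (g (1 + r)%N z - g (1 + r)%N z') by rewrite /D; ring.
      exact: ler_normB.
    have := nm_ge0 R z; have := nm_ge0 R (z - z'); nra.
  have D01 z : 0 <= `|D z| / 2 <= 1.
    by rewrite divr_ge0 //= ler_pdivrMr // mul1r.
  have := dom _ Dt D01.
  have -> : wav s (pwt R s) ((fun z => `|D z| / 2) \o gpr) = 2^-1 * wav s (pwt R s) (fun p => `|D (gpr p)|).
    by rewrite -wavZ; apply: wav_ext => p _ /=; rewrite mulrC.
  have -> : wav zs kap (fun z => `|D z| / 2) = 2^-1 * wav zs kap (fun z => `|D z|).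
    by rewrite -wavZ; apply: wav_ext => p _ /=; rewrite mulrC.
  suff : wav zs kap (fun z => `|D z|) <= 2 * eps by move: C0_gt0 => ? ? ?; nra.
  have sq : wav zs kap (fun z => D z ^+ 2) <= eps ^+ 2.
    apply: (@le_trans _ _ (r%:R ^+ 2 * gap_bound dl eta J + (K * n)%:R * (4 * dl + 8 * dl))); last by lra.
    apply: (@square_mean_le _ c0 C0 l0 dl dl eta w db Sb J Sa zs kap g Pa ssb K r n) => //.
    - by move=> d /dvdn_fact.
    - by rewrite w0 (le_trans wh) // invf_le1 // ler1n.
    - by rewrite ltW.
    - by rewrite ltW //= (le_trans dl_eta).
    - move=> p pPa; have /andP[-> _] := flatten_scale ha pPa.
      exact: leq_flatten_max.
    - exact: leq_maxl.
    - by move=> p /leq_flatten_max h; rewrite leq_max h orbT.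
    - by rewrite ltW.
  have k0' z : z \in zs -> 0 <= kap z by [].
  (* From mean square to mean: |D| <= eps + D^2 / eps, so a mean square of eps^2 gives a mean of at
     most 2 eps. *)
  apply: (@le_trans _ _ (wav zs kap (fun z => eps + eps^-1 * D z ^+ 2))).
    apply: wav_le => // z _; have [h|h] := leP `|D z| eps.
      by apply: le_trans h _; rewrite lerDl mulr_ge0 ?sqr_ge0 // invr_ge0 ltW.
    apply: (@le_trans _ _ (eps^-1 * D z ^+ 2)); last by rewrite lerDr ltW.
    rewrite mulrC ler_pdivlMr // -(real_normK (num_real (D z))) expr2.
    by rewrite ler_wpM2l // ltW.
  rewrite wavD wav_cst // wavZ mulr2n mulrDl mul1r lerD2l mulrC ler_pdivrMr //.
have U0 p : p \in Pt -> 0 <= pwt R Pt p by rewrite pwt_ge0.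
have := tkt 0%N (1, 0); have := tkt r (1, 0).
rewrite -[r.+1]add1n.
have -> : wav Pt (pwt R Pt) (fun p => g (1 + r)%N (gmul (1, 0) (gpr p))) =
    wav Pt (pwt R Pt) (fun p => g (1 + r)%N (gpr p)) by apply: wav_ext => p _; rewrite gmul1.
have -> : wav Pt (pwt R Pt) (fun p => g 1%N (gmul (1, 0) (gpr p))) =
    wav Pt (pwt R Pt) (fun p => g 1%N (gpr p)) by apply: wav_ext => p _; rewrite gmul1.
have := wav_norm U0 (fun p => D (gpr p)); rewrite wavB.
set a := wav _ _ (fun p => g 1%N (gpr p)); set b := wav _ _ (fun p => g (1 + r)%N (gpr p)).
move=> h1 h2 h3.
have -> : g 0%N (1, 0) - g r (1, 0) = (g 0%N (1, 0) - a) - (g r (1, 0) - b) + (a - b) by ring.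
have := ler_normD ((g 0%N (1, 0) - a) - (g r (1, 0) - b)) (a - b).
have := ler_normB (g 0%N (1, 0) - a) (g r (1, 0) - b).
by lra.
Qed.

(** J is a function of [C0] only, so one r serves for all g, all Lipschitz constants and all
    accuracies; since the accuracy is arbitrary the two values are equal, not merely close. *)
Theorem shift_rigidity : exists2 r, (0 < r)%N & forall (l0 C1 : R) g,
  0 < l0 -> 0 < C1 -> (forall k z, `|g k z| <= 1) -> (forall k, tame l0 (g k)) ->
  turan_kubilius C1 g -> g 0%N (1, 0) = g r (1, 0).
Proof.
pose J := (Num.truncn (4 * C0)).+1.
exists J`!; first exact: fact_gt0.
move=> l0 C1 g l00 C10 g1 gt tk.
apply/eqP; rewrite -subr_eq0 -normr_le0 leNgt; apply/negP => h.
set A := `|_| in h.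
have c4 : 0 < 4 + 2 * C0 by move: C0_gt0; lra.
pose eps := Num.min 1 (A / (2 * (4 + 2 * C0))).
have e0 : 0 < eps by rewrite lt_min ltr01 divr_gt0 // mulr_gt0.
have e1 : eps <= 1 by rewrite ge_min lexx.
have e2 : eps <= A / (2 * (4 + 2 * C0)) by rewrite ge_min lexx orbT.
have hJ : 4 * C0 <= J%:R by rewrite ltW // truncnS_gt.
have := approx hJ l00 C10 (eps := eps) _ g1 gt tk; rewrite e0 e1 => /(_ isT).
rewrite -/A leNgt => /negP; apply.
apply: (@le_lt_trans _ _ ((4 + 2 * C0) * (A / (2 * (4 + 2 * C0))))).
  by rewrite ler_pM2l.
have -> : (4 + 2 * C0) * (A / (2 * (4 + 2 * C0))) = A / 2.
  by field; rewrite gt_eqF.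
by rewrite ltr_pdivrMr //; lra.
Qed.

End rigidity.

(** * Chebyshev and Mertens estimates *)

Section mertens.
Variable R : realType.
Implicit Types (n m p k q : nat) (f : nat -> R).

Definition lnn n : R := ln n%:R.

Lemma lnnM m n : (0 < m)%N -> (0 < n)%N -> lnn (m * n) = lnn m + lnn n.
Proof. by move=> m0 n0; rewrite /lnn natrM lnM // posrE ltr0n. Qed.

Lemma lnn_ge0 n : 0 <= lnn n.
Proof.
by case: n => [|n]; [rewrite /lnn ln0|rewrite ln_ge0 // ler1n].
Qed.

Lemma ler_lnn m n : (0 < m)%N -> (m <= n)%N -> lnn m <= lnn n.
Proof.
move=> m0 mn; rewrite ler_ln ?posrE ?ltr0n ?ler_nat //; exact: leq_trans mn.
Qed.

Lemma ln_sub1 (x : R) : 0 < x -> ln x <= x - 1.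
Proof. by move=> x0; have := @le_ln1Dx R (x - 1); rewrite addrCA subrr addr0; apply; lra. Qed.

Lemma lnnX m k : (0 < m)%N -> lnn (m ^ k) = k%:R * lnn m.
Proof. by move=> m0; rewrite /lnn natrX lnXn ?ltr0n // mulr_natl. Qed.

Lemma lnn2_le : lnn 2 <= 1.
Proof. by apply: le_trans (ln_sub1 _) _ => //; lra. Qed.

Lemma lnn2_ge : 2^-1 <= lnn 2.
Proof.
have := @ln_sub1 2^-1; rewrite lnV ?posrE // invr_gt0 => /(_ ltac:(by [])).
by rewrite -/(lnn 2); lra.
Qed.

Lemma lnn_prod (T : eqType) (s : seq T) (P : pred T) (F : T -> nat) :
  (forall i, i \in s -> P i -> (0 < F i)%N) ->
  lnn (\prod_(i <- s | P i) F i)%N = \sum_(i <- s | P i) lnn (F i).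
Proof.
elim: s => [|i s IH] F0; first by rewrite !big_nil /lnn ln1.
have F0' j : j \in s -> P j -> (0 < F j)%N by move=> js; apply: F0; rewrite inE js orbT.
rewrite !big_cons; case: ifP => Pi; last exact: IH.
rewrite lnnM ?IH // ?F0 ?mem_head //.
by rewrite big_seq_cond prodn_cond_gt0 // => j /andP[/F0' h /h].
Qed.

Lemma lnn_logn n N : (0 < n <= N)%N ->
  lnn n = \sum_(1 <= p < N.+1 | prime p) (logn p n)%:R * lnn p.
Proof.
move=> /andP[n0 nN]; rewrite -{1}(partnT n0) (widen_partn _ nN).
rewrite big_ltn_cond //= mul1n (bigID prime) /= [X in (_ * X)%N]big1 ?muln1; last first.
  by move=> p /negPf np; rewrite lognE np.
rewrite lnn_prod; last by move=> p _ pp; rewrite expn_gt0 prime_gt0.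
by apply: eq_bigr => p pp; rewrite lnnX // prime_gt0.
Qed.

Lemma logn_sum n m p : prime p -> (0 < m <= n)%N ->
  logn p m = (\sum_(1 <= k < n.+1) (p ^ k %| m))%N.
Proof.
move=> pp /andP[m0 mn].
have h : (logn p m <= n)%N by apply: leq_trans mn; apply/ltnW/ltn_logl.
under eq_bigr do rewrite pfactor_dvdn //.
rewrite (@big_cat_nat _ _ _ (logn p m).+1) //= [X in (_ + X)%N]big1_seq ?addn0.
  rewrite big_nat (eq_bigr (fun=> 1%N)); last by move=> k /andP[_]; rewrite ltnS => ->.
  by rewrite -big_nat sum_nat_const_nat subn1 muln1.
by move=> k; rewrite mem_index_iota => /andP[_ /andP[+ _]]; rewrite ltnNge => /negPf->.
Qed.

Lemma sum_multiples n q f : (0 < q)%N ->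
  \sum_(1 <= m < n.+1) (q %| m)%:R * f m = \sum_(1 <= j < (n %/ q).+1) f (q * j)%N.
Proof.
move=> q0; elim: n => [|n IH]; first by rewrite div0n !big_geq.
rewrite big_nat_recr //= IH divnS //; case dv : (q %| n.+1)%N => /=; last by rewrite mul0r addr0.
rewrite add1n [RHS]big_nat_recr //= mul1r; congr (_ + f _).
by rewrite -[LHS](divnK dv) divnS // dv add1n mulnC.
Qed.

(** The summed form of f ln = (f Lambda) * f, a Dirichlet convolution valid for completely
    multiplicative f. Terms with p^k > n have an empty inner sum. *)
Lemma sum_cmult_ln n f : (forall a b, f (a * b)%N = f a * f b) ->
  \sum_(1 <= m < n.+1) f m * lnn m =
  \sum_(1 <= p < n.+1 | prime p) \sum_(1 <= k < n.+1)
    lnn p * (f (p ^ k)%N * \sum_(1 <= j < (n %/ p ^ k).+1) f j).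
Proof.
move=> fM.
transitivity (\sum_(1 <= m < n.+1) \sum_(1 <= p < n.+1 | prime p) \sum_(1 <= k < n.+1)
    lnn p * ((p ^ k %| m)%:R * f m)).
  rewrite big_nat [RHS]big_nat; apply: eq_bigr => m /andP[m1 mn].
  have hm : (0 < m <= n)%N by rewrite m1 -ltnS.
  rewrite (lnn_logn hm) mulr_sumr; apply: eq_bigr => p pp.
  rewrite -mulr_sumr -mulr_suml -natr_sum -logn_sum //; ring.
rewrite exchange_big; apply: eq_bigr => p pp.
rewrite exchange_big; apply: eq_bigr => k _ /=.
rewrite -mulr_sumr sum_multiples ?expn_gt0 ?prime_gt0 //.
by congr (_ * _); rewrite mulr_sumr; apply: eq_bigr => j _; rewrite fM.
Qed.

(** Chebyshev's psi function. *)
Definition chebyshev n : R :=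
  \sum_(1 <= p < n.+1 | prime p) \sum_(1 <= k < n.+1 | (p ^ k <= n)%N) lnn p.

(** Legendre's formula, with a free upper range N so that the factorials of m and of 2m can be
    compared term by term. *)
Lemma lnn_fact n N : (n <= N)%N -> lnn n`! =
  \sum_(1 <= p < N.+1 | prime p) \sum_(1 <= k < N.+1) (n %/ p ^ k)%:R * lnn p.
Proof.
move=> nN.
rewrite fact_prod lnn_prod; last by move=> i; rewrite mem_index_iota => /andP[].
transitivity (\sum_(1 <= m < n.+1) \sum_(1 <= p < N.+1 | prime p) \sum_(1 <= k < N.+1)
    lnn p * ((p ^ k %| m)%:R * 1)).
  rewrite big_nat [RHS]big_nat; apply: eq_bigr => m /andP[m1 mn].
  have hm : (0 < m <= N)%N by rewrite m1 (leq_trans _ nN).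
  rewrite (lnn_logn hm); apply: eq_bigr => p pp.
  by rewrite -mulr_sumr -mulr_suml -natr_sum -logn_sum // mulr1 mulrC.
rewrite exchange_big; apply: eq_bigr => p pp.
rewrite exchange_big; apply: eq_bigr => k _ /=.
rewrite -mulr_sumr (sum_multiples _ (fun=> 1)) ?expn_gt0 ?prime_gt0 //.
by rewrite sumr_const_nat subn1 mulrC.
Qed.

Lemma lnn_bin m : (0 < m)%N -> lnn 'C(2 * m, m) <= (2 * m)%:R.
Proof.
move=> m0; have h : ('C(2 * m, m) <= 2 ^ (2 * m))%N.
  rewrite -[2%N]/(1 + 1)%N expnDn.
  have mm : (m < (2 * m).+1)%N by lia.
  by rewrite (bigD1 (Ordinal mm)) //= !exp1n !muln1 leq_addr.
have b0 : (0 < 'C(2 * m, m))%N by rewrite bin_gt0 mul2n -addnn leq_addr.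
apply: le_trans (ler_lnn b0 h) _; rewrite lnnX //.
by rewrite -[leRHS]mulr1 ler_wpM2l // lnn2_le.
Qed.

(** The coefficient of ln p in the logarithm of the central binomial coefficient is a sum of
    floor(2m/q) - 2 floor(m/q) over q = p^k, which is never negative and is positive for m < q <=
    2m. *)
Lemma chebyshev_double m : (0 < m)%N -> chebyshev (2 * m) - chebyshev m <= (2 * m)%:R.
Proof.
move=> m0; apply: le_trans (lnn_bin m0).
set N := (2 * m)%N; have mN : (m <= N)%N by rewrite leq_pmull.
have -> : lnn 'C(N, m) = lnn N`! - (lnn m`! + lnn m`!).
  rewrite -(bin_fact mN) (_ : (N - m = m)%N); last by rewrite /N; lia.
  by rewrite !lnnM ?muln_gt0 ?fact_gt0 // ?addrK // bin_gt0.
have -> : chebyshev m = \sum_(1 <= p < N.+1 | prime p) \sum_(1 <= k < N.+1)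
    (p ^ k <= m)%:R * lnn p.
  rewrite /chebyshev [RHS](@big_cat_nat _ _ _ m.+1) //=.
  rewrite [X in _ = _ + X]big1_seq ?addr0; last first.
    move=> p /andP[pp]; rewrite mem_index_iota => /andP[mp _].
    rewrite big_nat big1 // => k /andP[k1 _]; case: leqP => [h|]; rewrite ?mul0r //.
    suff : (p <= m)%N by rewrite leqNgt mp.
    by apply: leq_trans h; rewrite -{1}(expn1 p) leq_pexp2l // prime_gt0.
  apply: eq_bigr => p pp; rewrite [RHS](@big_cat_nat _ _ _ m.+1) //=.
  rewrite [X in _ = _ + X]big1_seq ?addr0; last first.
    move=> k; rewrite mem_index_iota => /andP[_ /andP[mk _]].
    case: leqP => [h|]; rewrite ?mul0r //.
    suff : (k < k)%N by rewrite ltnn.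
    by apply: leq_ltn_trans (leq_ltn_trans h mk); apply/ltnW/ltn_expl/prime_gt1.
  rewrite big_mkcond /=; apply: eq_bigr => k _; case: ifP; rewrite ?mul0r ?mul1r //.
rewrite (lnn_fact (leqnn N)) (lnn_fact mN) /chebyshev -big_split -!sumrB.
apply: ler_sum => p pp; rewrite -big_split -sumrB big_mkcond -sumrB /=.
apply: ler_sum => k _; rewrite -mulrDl -mulrBl -natrD.
have l0 := lnn_ge0 p; set q := (p ^ k)%N.
have q0 : (0 < q)%N by rewrite expn_gt0 prime_gt0.
have h2 : (m %/ q + m %/ q <= N %/ q)%N.
  by rewrite addnn -mul2n leq_divRL // -mulnA leq_mul2l /= leq_trunc_div.
rewrite -natrB //; case: (leqP q N) => hN; last first.
  rewrite sub0r (@le_trans _ _ 0) ?mulr_ge0 // oppr_le0 mulr_ge0 //.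
case: (leqP q m) => hm; first by rewrite mul1r subrr mulr_ge0.
rewrite mul0r subr0 (divn_small hm) subn0 ler_peMl // ler1n divn_gt0 //.
Qed.

Lemma chebyshev_mono m n : (m <= n)%N -> chebyshev m <= chebyshev n.
Proof.
move=> mn; rewrite /chebyshev [leRHS](@big_cat_nat _ _ _ m.+1) //=.
rewrite -[leLHS]addr0 lerD //; last first.
  by apply: sumr_ge0 => p _; apply: sumr_ge0 => k _; apply: lnn_ge0.
apply: ler_sum => p pp; rewrite [leRHS](@big_cat_nat _ _ _ m.+1) //=.
rewrite -[leLHS]addr0 lerD //; last by apply: sumr_ge0 => k _; apply: lnn_ge0.
rewrite big_mkcond [leRHS]big_mkcond; apply: ler_sum => k _.
case: ifP => h; last by case: ifP => _ //; apply: lnn_ge0.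
by rewrite (leq_trans h mn).
Qed.

Lemma chebyshev_le n : chebyshev n <= 6 * n%:R.
Proof.
have [m] := ubnP n; elim: m n => // m IH n nm.
have [n1|n1] := leqP n 1.
  apply: (@le_trans _ _ 0); last by rewrite mulr_ge0.
  rewrite /chebyshev big1_seq // => p /andP[pp]; rewrite mem_index_iota => /andP[_ pn].
  by have := leq_trans (prime_gt1 pp) (leq_trans (ltnSE pn) n1).
(* With 2h <= n + 1 the induction gives 6h + 2h <= 4n + 4, which is at most 6n since n >= 2. *)
pose h := uphalf n.
have nh : (n <= 2 * h)%N by rewrite /h; lia.
have hn : (h < n)%N by rewrite /h; lia.
have h0 : (0 < h)%N by rewrite /h; lia.
have h3 : (2 * h <= n.+1)%N by rewrite /h; lia.
have := chebyshev_double h0; have := IH h (leq_trans hn nm); have := chebyshev_mono nh.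
have : (4 * (2 * h) <= 4 * n.+1)%N by rewrite leq_mul2l.
rewrite -!(ler_nat R) !natrM -!natr1.
have : 2 <= n%:R :> R by rewrite ler_nat.
lra.
Qed.

Lemma lnn_fact_ge n : n%:R * lnn n - n%:R <= lnn n`!.
Proof.
elim: n => [|n IH]; first by rewrite mul0r subr0 lnn_ge0.
rewrite factS lnnM ?fact_gt0 // -natr1.
have [->|n0] := posnP n; first by rewrite fact0 /lnn ln1; lra.
suff : n%:R * (lnn n.+1 - lnn n) <= 1 by lra.
have nR : 0 < n%:R :> R by rewrite ltr0n.
rewrite mulrC -ler_pdivlMr // div1r /lnn -ln_div ?posrE ?ltr0n //.
apply: le_trans (ln_sub1 _) _; first by rewrite divr_gt0 ?ltr0n.
by rewrite -natr1 mulrDl divff ?gt_eqF // mul1r addrC addKr.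
Qed.

Lemma lnn_fact_le n : lnn n`! <= n%:R * lnn n.
Proof.
rewrite fact_prod lnn_prod; last by move=> i; rewrite mem_index_iota => /andP[].
apply: (@le_trans _ _ (\sum_(1 <= i < n.+1) lnn n)).
  rewrite big_nat [leRHS]big_nat; apply: ler_sum => i /andP[i1 i2].
  by rewrite ler_lnn.
by rewrite sumr_const_nat subn1 /= -[leLHS]mulr_natl.
Qed.

Lemma sum_lnn_sqr n : \sum_(1 <= m < n.+1) lnn m / m%:R ^+ 2 <= 2.
Proof.
have [->|n0] := posnP n; first by rewrite big_geq.
(* A bound that telescopes, modelled on the antiderivative -(ln x + 1)/x of ln x / x^2. *)
apply: (@le_trans _ _ (2 - (lnn n + 2) / n%:R)); last first.
  by rewrite gerBl divr_ge0 // addr_ge0 // lnn_ge0.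
elim: n n0 => // n IH _.
have [->|n0] := posnP n.
  by rewrite big_nat1 /lnn ln1 mul0r add0r divr1 subrr.
rewrite big_nat_recr //=; apply: le_trans (lerD (IH n0) (lexx _)) _.
set a := lnn n; set b := lnn n.+1.
have nR : 0 < n%:R :> R by rewrite ltr0n.
have n1 : 1 <= n%:R :> R by rewrite ler1n.
have ba : (b - a) * n%:R <= 1.
  rewrite -ler_pdivlMr // div1r /a /b /lnn -ln_div ?posrE ?ltr0n //.
  apply: le_trans (ln_sub1 _) _; first by rewrite divr_gt0 ?ltr0n.
  by rewrite -natr1 mulrDl divff ?gt_eqF // mul1r addrC addKr.
have b0 : 0 <= b by apply: lnn_ge0.
rewrite -[n.+1%:R]natr1; set x : R := n%:R in nR n1 ba *.
have x1 : 0 < x + 1 by lra.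
have -> : 2 - (a + 2) / x + b / (x + 1) ^+ 2 =
  2 - (b + 2) / (x + 1) - ((a + 2) * (x + 1) ^+ 2 - (b + 2) * (x * (x + 1)) - b * x) / (x * (x + 1) ^+ 2).
  by field; rewrite !gt_eqF.
rewrite gerBl divr_ge0 //; last by rewrite mulr_ge0 ?sqr_ge0 // ltW.
by nra.
Qed.

(** Multiply by n and use n/p <= floor(n/p) + 1: the integer parts are bounded by ln n! <= n ln n,
    the ones by Chebyshev's estimate. *)
Lemma mertens_upper n : \sum_(1 <= p < n.+1 | prime p) lnn p / p%:R <= lnn n + 6.
Proof.
have [->|n0] := posnP n; first by rewrite big_geq // addr_ge0 // lnn_ge0.
have nR : 0 < n%:R :> R by rewrite ltr0n.
rewrite -(ler_pM2l nR).
have h1 : \sum_(1 <= p < n.+1 | prime p) (n %/ p)%:R * lnn p <= n%:R * lnn n.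
  apply: le_trans (lnn_fact_le n); rewrite (lnn_fact (leqnn n)).
  rewrite big_mkcond [leRHS]big_mkcond big_nat [leRHS]big_nat.
  apply: ler_sum => p /andP[p1 pn]; case: ifP => // pp.
  rewrite (@big_cat_nat _ _ _ 2) //= big_nat1 expn1 lerDl.
  by apply: sumr_ge0 => k _; rewrite mulr_ge0 // lnn_ge0.
have h2 : \sum_(1 <= p < n.+1 | prime p) lnn p <= 6 * n%:R.
  apply: le_trans (chebyshev_le n); rewrite /chebyshev.
  rewrite big_mkcond [leRHS]big_mkcond big_nat [leRHS]big_nat.
  apply: ler_sum => p /andP[p1 pn]; case: ifP => // pp.
  rewrite (@big_cat_nat _ _ _ 2) //= big_mkcond big_nat1 expn1 -ltnS pn lerDl.
  by apply: sumr_ge0 => k _; apply: lnn_ge0.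
apply: (@le_trans _ _ (\sum_(1 <= p < n.+1 | prime p) ((n %/ p)%:R * lnn p + lnn p))); last first.
  by rewrite big_split /= mulrDr lerD // [leRHS]mulrC.
rewrite mulr_sumr; apply: ler_sum => p pp.
rewrite mulrCA mulrC -{3}[lnn p]mul1r -mulrDl ler_wpM2r ?lnn_ge0 //.
rewrite ler_pdivrMr ?ltr0n ?prime_gt0 // natr1 -natrM ler_nat ltnW //.
by rewrite -ltn_divLR ?prime_gt0.
Qed.

End mertens.

(** * Primes congruent to 1 modulo 4 *)

Section split_primes.
Variable R : realType.
Implicit Types (n m p k q : nat) (f : nat -> R).
Notation lnn := (lnn R).

(** The nonprincipal Dirichlet character modulo 4. *)
Definition chi4 m : R :=
  if (m %% 4 == 1)%N then 1 else if (m %% 4 == 3)%N then -1 else 0.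

Lemma chi4M a b : chi4 (a * b) = chi4 a * chi4 b.
Proof.
rewrite /chi4 -modnMm; have := ltn_pmod a (isT : 0 < 4)%N; have := ltn_pmod b (isT : 0 < 4)%N.
case: (a %% 4)%N => [|[|[|[|//]]]]; case: (b %% 4)%N => [|[|[|[|//]]]] _ _ /=;
  by rewrite ?mulr0 ?mul0r ?mulr1 ?mul1r ?mulrNN ?mulr1.
Qed.

Lemma chi4_norm m : `|chi4 m| <= 1.
Proof.
rewrite /chi4; case: eqP => _; first by rewrite normr1.
by case: eqP => _; rewrite ?normrN ?normr1 ?normr0.
Qed.

(** The nonzero terms alternate in sign and decrease, so the first one decides the sign and bounds
    the sum; it is positive exactly when a is 0 or 1 modulo 4. *)
Lemma chi4_alternating f a b : (forall m, (a <= m)%N -> 0 <= f m.+1 <= f m) ->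
  if (a %% 4 < 2)%N then 0 <= \sum_(a <= m < b) chi4 m * f m <= f a
  else - f a <= \sum_(a <= m < b) chi4 m * f m <= 0.
Proof.
have [n] := ubnP (b - a); elim: n a => // n IH a nb fa.
have f0 : 0 <= f a by have /andP[h1 h2] := fa a (leqnn a); apply: le_trans h2.
have [ba|ab] := leqP b a.
  by rewrite big_geq //; case: ifP; rewrite ?lexx ?f0 // oppr_le0 f0.
rewrite big_ltn //.
have /andP[fa0 fa1] := fa a (leqnn a).
have lt : (b - a.+1 < n)%N by lia.
have := IH a.+1 lt (fun m h => fa m (ltnW h)).
have -> : (a.+1 %% 4 = (a %% 4).+1 %% 4)%N by rewrite -[in LHS]addn1 -modnDml addn1.
set S := \sum_(a.+1 <= m < b) _.
rewrite /chi4; have := ltn_pmod a (isT : 0 < 4)%N.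
by case: (a %% 4)%N => [|[|[|[|//]]]] _ /= /andP[h1 h2]; apply/andP; split; lra.
Qed.

Lemma chi4_alternating_norm f a b : (forall m, (a <= m)%N -> 0 <= f m.+1 <= f m) ->
  `|\sum_(a <= m < b) chi4 m * f m| <= f a.
Proof.
move=> fa; have f0 : 0 <= f a by have /andP[h1 h2] := fa a (leqnn a); apply: le_trans h2.
by have := chi4_alternating b fa; rewrite ler_norml; case: ifP => _ /andP[? ?]; apply/andP; split; lra.
Qed.

Let sum3 f : \sum_(1 <= i < 4) f i = f 1%N + (f 2%N + f 3%N).
Proof. by do 3 rewrite big_ltn //; rewrite big_geq // addr0. Qed.

Lemma inv_decr m : (0 < m)%N -> 0 <= (m.+1%:R^-1 : R) <= m%:R^-1.
Proof.
by move=> m0; rewrite invr_ge0 ler0n lef_pV2 ?posrE ?ltr0n // ler_nat leqnSn.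
Qed.

Definition chi4_sum n : R := \sum_(1 <= m < n.+1) chi4 m / m%:R.

(** An explicit form of L(1, chi) being nonzero: the terms up to 3 give 1 - 1/3, and the later ones,
    which begin with 1/5, contribute a nonnegative amount. *)
Lemma chi4_sum_ge n : (0 < n)%N -> 2 / 3 <= chi4_sum n.
Proof.
case: n => [//|[|[|n]]] _; rewrite /chi4_sum.
- by rewrite big_nat1 /chi4 /= divr1; lra.
- by rewrite big_nat_recr // big_nat1 /chi4 /= divr1; lra.
rewrite (@big_cat_nat _ _ _ 4) //=.
have := @chi4_alternating (fun m => m%:R^-1) 4 n.+4 (fun m h => inv_decr (leq_trans _ h)).
move=> /(_ ltac:(by [])) /andP[+ _].
rewrite sum3 /chi4 /= divr1; lra.
Qed.

Lemma chi4_sum_tail n q : (0 < q)%N -> (0 < n)%N ->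
  `|chi4_sum (n %/ q) - chi4_sum n| <= q%:R / n%:R.
Proof.
move=> q0 n0; rewrite distrC /chi4_sum (@big_cat_nat _ _ _ (n %/ q).+1 1 n.+1) //=; last first.
  by rewrite ltnS leq_div.
rewrite addrAC subrr add0r.
apply: le_trans (chi4_alternating_norm _ _) _.
  by move=> m /(leq_trans _) h; apply: inv_decr; apply: h.
rewrite -div1r ler_pdivrMr ?ltr0n // mulrAC ler_pdivlMr ?ltr0n // mul1r -natrM ler_nat.
by rewrite mulnC ltnW // -ltn_divLR.
Qed.

Lemma lnn4_ge : 1 <= lnn 4.
Proof. by rewrite (@lnnX R 2 2) //; have := lnn2_ge R; lra. Qed.

Lemma lnn_div_decr m : (4 <= m)%N -> 0 <= lnn m.+1 / m.+1%:R <= lnn m / m%:R.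
Proof.
move=> m4; have m0 : (0 < m)%N by apply: leq_trans m4.
have mR : 0 < m%:R :> R by rewrite ltr0n.
have mR1 : 0 < m.+1%:R :> R by rewrite ltr0n.
rewrite divr_ge0 ?lnn_ge0 //= ler_pdivrMr // mulrAC ler_pdivlMr //.
have l1 : 1 <= lnn m by apply: le_trans lnn4_ge (ler_lnn _ _ _).
have : m%:R * (lnn m.+1 - lnn m) <= 1.
  rewrite mulrC -ler_pdivlMr // div1r /lnn -ln_div ?posrE ?ltr0n //.
  apply: le_trans (ln_sub1 _) _; first by rewrite divr_gt0 ?ltr0n.
  by rewrite -[m.+1%:R]natr1 mulrDl divff ?gt_eqF // mul1r addrC addKr.
by rewrite -[m.+1%:R]natr1; lra.
Qed.

Lemma chi4_ln_sum n : `|\sum_(1 <= m < n.+1) chi4 m * (lnn m / m%:R)| <= 3.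
Proof.
have l3 : lnn 3 <= 2 by apply: le_trans (ln_sub1 _) _; lra.
have l4 : lnn 4 <= 3 by apply: le_trans (ln_sub1 _) _; lra.
have l30 := lnn_ge0 R 3.
have [n3|n3] := leqP 3 n; last first.
  rewrite big_nat big1 ?normr0 // => m /andP[m1 mn].
  have : (m < 3)%N by apply: leq_trans mn n3.
  case: m m1 {mn} => [|[|[|]]] // _ _; rewrite /chi4 /= ?mul0r //.
  by rewrite /lnn ln1 mul0r mulr0.
rewrite (@big_cat_nat _ _ _ 4) //=.
have := @chi4_alternating (fun m => lnn m / m%:R) 4 n.+1 lnn_div_decr.
move=> /= /andP[]; rewrite sum3 {4 5 6}/chi4 /= /lnn ln1.
rewrite -/(lnn 2) -/(lnn 3) -/(lnn 4) => h1 h2; rewrite ler_norml; apply/andP; split; lra.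
Qed.

(** The sum of Lambda(q) c(q) over q <= n, with Lambda the von Mangoldt function. *)
Definition prime_power_sum (c : nat -> R) n : R :=
  \sum_(1 <= p < n.+1 | prime p) \sum_(1 <= k < n.+1 | (p ^ k <= n)%N) lnn p * c (p ^ k)%N.

Lemma prime_power_sum_inv n : (0 < n)%N ->
  lnn n - 1 <= prime_power_sum (fun q => q%:R^-1) n.
Proof.
move=> n0; have nR : 0 < n%:R :> R by rewrite ltr0n.
rewrite -(ler_pM2l nR) mulrBr mulr1; apply: le_trans (lnn_fact_ge _ n) _.
rewrite (lnn_fact R (leqnn n)) mulr_sumr; apply: ler_sum => p pp.
rewrite mulr_sumr [leRHS]big_mkcond; apply: ler_sum => k _.
have q0 : (0 < p ^ k)%N by rewrite expn_gt0 prime_gt0.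
case: leqP => h; last by rewrite divn_small // mul0r.
rewrite mulrCA mulrC ler_wpM2l ?lnn_ge0 // ler_pdivlMr ?ltr0n //.
by rewrite -natrM ler_nat leq_trunc_div.
Qed.

(** Mertens' argument. The bounded sum of chi(m) ln m / m equals the sum of Lambda(q) chi(q) / q
    times S(n/q), where S is [chi4_sum]. Replacing S(n/q) by S(n) costs at most q/n per term, in
    total psi(n)/n <= 6. So S(n) X is at most 3 + 6 in absolute value, and S(n) >= 2/3 gives
    27/2. *)
Lemma prime_power_sum_chi n : (0 < n)%N ->
  `|prime_power_sum (fun q => chi4 q / q%:R) n| <= 27 / 2.
Proof.
move=> n0; have nR : 0 < n%:R :> R by rewrite ltr0n.
pose f m : R := chi4 m / m%:R.
have fM a b : f (a * b)%N = f a * f b.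
  by rewrite /f chi4M natrM invfM mulrACA.
have S0 := chi4_sum_ge n0.
set X := prime_power_sum _ n.
suff : `|chi4_sum n * X| <= 9.
  by rewrite normrM (ger0_norm (x := chi4_sum n)); [have := normr_ge0 X; nra|lra].
have T3 := chi4_ln_sum n.
have TE : \sum_(1 <= m < n.+1) chi4 m * (lnn m / m%:R) =
    prime_power_sum (fun q => f q * chi4_sum (n %/ q)) n.
  transitivity (\sum_(1 <= m < n.+1) f m * lnn m).
    by apply: eq_bigr => m _; rewrite /f mulrCA mulrA [lnn m * _]mulrC mulrAC.
  rewrite (sum_cmult_ln n fM); apply: eq_bigr => p pp.
  rewrite [RHS]big_mkcond; apply: eq_bigr => k _; case: leqP => h //.
  by rewrite divn_small // big_geq // !mulr0.
have D6 : `|prime_power_sum (fun q => f q * chi4_sum (n %/ q)) n - chi4_sum n * X| <= 6.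
  have -> : prime_power_sum (fun q => f q * chi4_sum (n %/ q)) n - chi4_sum n * X =
      prime_power_sum (fun q => f q * (chi4_sum (n %/ q) - chi4_sum n)) n.
    rewrite /X mulr_sumr -sumrB; apply: eq_bigr => p _.
    by rewrite mulr_sumr -sumrB; apply: eq_bigr => k _; rewrite /f; ring.
  apply: (@le_trans _ _ (n%:R^-1 * chebyshev R n)); last first.
    by rewrite mulrC ler_pdivrMr //; apply: chebyshev_le.
  rewrite /chebyshev mulr_sumr; apply: le_trans (ler_norm_sum _ _ _) _.
  apply: ler_sum => p pp; rewrite mulr_sumr.
  apply: le_trans (ler_norm_sum _ _ _) _; apply: ler_sum => k pk.
  have q0 : (0 < p ^ k)%N by rewrite expn_gt0 prime_gt0.
  rewrite !normrM ger0_norm ?lnn_ge0 // mulrC ler_wpM2r ?lnn_ge0 //.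
  rewrite normfV normr_nat.
  have h1 := chi4_sum_tail q0 n0; have h2 := chi4_norm (p ^ k).
  have q0' : 0 < (p ^ k)%:R :> R by rewrite ltr0n.
  apply: (@le_trans _ _ (1 / (p ^ k)%:R * ((p ^ k)%:R / n%:R))).
    by rewrite ler_pM // ?divr_ge0 // ler_pM2r // invr_gt0.
  by rewrite mulrA mul1r mulVf ?mul1r // gt_eqF.
rewrite TE in T3; move: T3 D6; set a := prime_power_sum _ n; set b := chi4_sum n * X.
by move=> /ler_normlP[? ?] /ler_normlP[? ?]; rewrite ler_norml; apply/andP; split; lra.
Qed.

Definition split_ln_sum n : R := \sum_(1 <= p < n.+1 | sp p) 2 * (lnn p / p%:R).

Lemma geometric_tail p n : prime p -> \sum_(2 <= k < n.+1) (p ^ k)%:R^-1 <= 2 / p%:R ^+ 2 :> R.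
Proof.
move=> pp; have pR : 2 <= p%:R :> R by rewrite ler_nat prime_gt1.
have p0 : 0 < p%:R :> R by lra.
have [n1|n1] := leqP n 1; first by rewrite big_geq // divr_ge0 ?sqr_ge0.
suff h m : \sum_(2 <= k < m.+2) (p ^ k)%:R^-1 <= 2 / p%:R ^+ 2 - 2 / p%:R ^+ m.+2 :> R.
  case: n n1 => [//|n] _; apply: le_trans (h n) _.
  by rewrite gerBl divr_ge0 // exprn_ge0 // ltW.
elim: m => [|m IH]; first by rewrite big_geq // subrr.
rewrite big_nat_recr //=; apply: le_trans (lerD IH (lexx _)) _.
rewrite natrX [p%:R ^+ m.+3]exprS.
have e0 : 0 < p%:R ^+ m.+2 :> R by rewrite exprn_gt0.
set e := p%:R ^+ m.+2 in e0 *.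
suff : 2 / (p%:R * e) <= e^-1 by lra.
by rewrite invfM mulrA ler_piMl ?invr_ge0 ?(ltW e0) // ler_pdivrMr // mul1r.
Qed.

(** The sum of Lambda(q)(1 + chi(q))/q counts split primes with weight 2. The losses are 1 and 27/2
    from the two sums, 1 from the prime 2 and 8 from higher prime powers, 47/2 in all. *)
Lemma split_ln_sum_ge n : (0 < n)%N -> lnn n - 24 <= split_ln_sum n.
Proof.
move=> n0.
have h1 := prime_power_sum_inv n0; have /ler_normlP[h2 _] := prime_power_sum_chi n0.
have h3 : prime_power_sum (fun q => q%:R^-1) n + prime_power_sum (fun q => chi4 q / q%:R) n =
    prime_power_sum (fun q => (1 + chi4 q) / q%:R) n.
  rewrite -big_split; apply: eq_bigr => p _ /=; rewrite -big_split; apply: eq_bigr => k _ /=.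
  by rewrite -mulrDr mulrDl mul1r.
have h4 : prime_power_sum (fun q => (1 + chi4 q) / q%:R) n <=
    split_ln_sum n + \sum_(1 <= p < n.+1) (p == 2%N)%:R * 1 + \sum_(1 <= p < n.+1) 4 * (lnn p / p%:R ^+ 2).
  rewrite /split_ln_sum [in leRHS]big_mkcond -!big_split /prime_power_sum big_mkcond /=.
  rewrite big_nat [leRHS]big_nat; apply: ler_sum => p /andP[p1 pn].
  have l0 := lnn_ge0 R p.
  have t0 : 0 <= 4 * (lnn p / p%:R ^+ 2) by rewrite mulr_ge0 // divr_ge0 // sqr_ge0.
  case: ifP => pp; last first.
    by rewrite !addr_ge0 //; case: ifP => _ //; rewrite mulr_ge0 // divr_ge0.
  have q0 k : (0 < p ^ k)%N by rewrite expn_gt0 prime_gt0.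
  rewrite (@big_cat_nat _ _ _ 2) //= big_mkcond big_nat1 expn1 -ltnS pn.
  apply: lerD.
    rewrite /sp pp /chi4 /=; case: (p =P 2%N) => [->|p2] /=.
      by have := lnn2_le R; lra.
    have : odd p by case: (even_prime pp).
    rewrite mul0r addr0; have := ltn_pmod p (isT : 0 < 4)%N.
    have -> : odd p = odd (p %% 4) by rewrite {1}(divn_eq p 4) oddD oddM andbF.
    by case: (p %% 4)%N => [|[|[|[|//]]]] //= _ _; lra.
  apply: (@le_trans _ _ (\sum_(2 <= k < n.+1) (2 * lnn p) * (p ^ k)%:R^-1)).
    rewrite big_mkcond; apply: ler_sum => k _; case: ifP => _; last by rewrite mulr_ge0 ?mulr_ge0.
    have /ler_normlP[_ c1] := chi4_norm (p ^ k).
    rewrite mulrA ler_wpM2r ?invr_ge0 // mulrC ler_wpM2r //; lra.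
  rewrite -mulr_sumr; have := geometric_tail n pp.
  set s := \sum_(_ <= _ < _) _; nra.
have h5 : \sum_(1 <= p < n.+1) (p == 2%N)%:R * 1 <= 1 :> R.
  under eq_bigr do rewrite mulr1.
  rewrite -natr_sum (ler_nat _ _ 1) -big_mkcond sum1_count /=.
  by rewrite (eq_count (a2 := pred1 2%N)) // count_uniq_mem ?iota_uniq // leq_b1.
have h6 : \sum_(1 <= p < n.+1) 4 * (lnn p / p%:R ^+ 2) <= 8.
  by rewrite -mulr_sumr; have := sum_lnn_sqr R n; lra.
lra.
Qed.

(** The available upper bound at y counts all primes, so it is twice too large; the exponent 4
    leaves 4 ln y - 24 - 2 (ln y + 6) >= ln y, and in this range 2 ln p / p is at most 8 ln y /
    p. *)
Lemma split_mass y : (0 < y)%N -> 36 <= lnn y ->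
  8^-1 <= \sum_(y.+1 <= p < (y ^ 4).+1 | sp p) p%:R^-1 :> R.
Proof.
move=> y0 hy.
have y40 : (0 < y ^ 4)%N by rewrite expn_gt0 y0.
have yy4 : (y <= y ^ 4)%N by rewrite -{1}(expn1 y) leq_pexp2l.
have h1 := split_ln_sum_ge y40; rewrite lnnX // in h1.
have h2 : split_ln_sum y <= 2 * (lnn y + 6).
  apply: (@le_trans _ _ (2 * \sum_(1 <= p < y.+1 | prime p) lnn p / p%:R)); last first.
    by rewrite ler_pM2l //; apply: mertens_upper.
  rewrite mulr_sumr /split_ln_sum big_mkcond [leRHS]big_mkcond; apply: ler_sum => p _.
  have l0 : 0 <= 2 * (lnn p / p%:R) by rewrite mulr_ge0 // divr_ge0 // lnn_ge0.
  by rewrite /sp; case: (prime p) => //=; case: ifP.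
have h3 : split_ln_sum (y ^ 4) - split_ln_sum y <=
    8 * lnn y * \sum_(y.+1 <= p < (y ^ 4).+1 | sp p) p%:R^-1.
  rewrite /split_ln_sum (@big_cat_nat _ _ _ y.+1 1 (y ^ 4).+1) //= addrAC subrr add0r.
  rewrite mulr_sumr big_nat_cond [leRHS]big_nat_cond; apply: ler_sum => p /andP[/andP[py py4] spp].
  rewrite mulrA ler_wpM2r ?invr_ge0 //.
  have p0 : (0 < p)%N by apply: leq_trans py.
  have := ler_lnn R p0 (ltnSE py4); rewrite lnnX //; lra.
set s := \sum_(_ <= _ < _ | _) _ in h3 *.
have l8 : 0 < 8 * lnn y by lra.
by rewrite -(ler_pM2l l8); apply: le_trans h3; lra.
Qed.

End split_primes.

(** * Sieve weights *)

Section sieve_density.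
Variable R : realType.
Implicit Types (n m p k q : nat) (f : nat -> R).
Notation lnn := (lnn R).

(** After Abel summation the partial sums of [d] appear with the nonnegative coefficients w m - w (m
    + 1) and a last w, so a one-sided bound on them suffices. *)
Lemma abel_lower (w d : nat -> R) (C : R) y :
  (forall m, (2 <= m)%N -> 0 <= w m.+1 <= w m) -> 0 <= C ->
  (forall m, (2 <= m <= y)%N -> - C <= \sum_(2 <= i < m.+1) d i) ->
  - (C * w 2%N) <= \sum_(2 <= i < y.+1) d i * w i.
Proof.
move=> hw C0; have w2 : 0 <= w 2%N by have /andP[h1 h2] := hw 2%N isT; apply: le_trans h2.
elim: y => [|y IH] hd; first by rewrite big_geq // oppr_le0 mulr_ge0.
have [y1|y1] := leqP y.+1 1; first by rewrite big_geq // oppr_le0 mulr_ge0.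
suff h m : (2 <= m <= y.+1)%N ->
    w m * (\sum_(2 <= i < m.+1) d i + C) - C * w 2%N <= \sum_(2 <= i < m.+1) d i * w i.
  apply: le_trans (h y.+1 _); last by rewrite y1 leqnn.
  rewrite lerDr mulr_ge0 //.
    by have /andP[h1 h2] := hw _ y1; apply: le_trans h2.
  by have := hd y.+1; rewrite y1 leqnn => /(_ isT); lra.
elim: m => // m IHm /andP[m2 my].
have [->|m2'] := eqVneq m 1%N; first by rewrite !big_nat1; lra.
have {}m2' : (2 <= m)%N by lia.
have := IHm; rewrite m2' (ltnW my) => /(_ isT) {}IHm.
rewrite [\sum_(2 <= i < m.+2) d i]big_nat_recr //= [\sum_(2 <= i < m.+2) _]big_nat_recr //=.
have := hd m; rewrite m2' (ltnW my) => /(_ isT).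
have /andP[h1 h2] := hw m m2'.
set D := \sum_(2 <= i < m.+1) d i in IHm *; move: IHm.
set S := \sum_(2 <= i < m.+1) d i * w i.
by nra.
Qed.

Lemma lnn_gt0 n : (2 <= n)%N -> 0 < lnn n.
Proof.
by move=> n2; apply: lt_le_trans (ler_lnn _ _ n2) => //; have := lnn2_ge R; lra.
Qed.

Lemma split_inv_sum_ge y : (2 <= y)%N ->
  ln (lnn y.+1) - 48 <= \sum_(2 <= p < y.+1 | sp p) 2 / p%:R.
Proof.
move=> y2.
(* The excess of the split prime weights over the increments of ln, whose partial sums are at least
   -24. Summed against 1 / ln m it loses at most 24 / ln 2 <= 48, and the increments of ln leave a
   sum comparable to that of ln ln. *)
pose d m : R := (sp m)%:R * (2 * (lnn m / m%:R)) - (lnn m - lnn m.-1).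
have hd m : (2 <= m <= y)%N -> - 24 <= \sum_(2 <= i < m.+1) d i.
  move=> /andP[m2 _].
  have := split_ln_sum_ge R (ltnW m2); rewrite /split_ln_sum big_ltn_cond ?ltnS ?(ltnW m2) //=.
  rewrite sumrB.
  have -> : \sum_(2 <= i < m.+1) (lnn i - lnn i.-1) = lnn m.
    rewrite -[2%N]add1n big_addn subn1 /=.
    under eq_bigr do rewrite addn1 /=.
    by rewrite telescope_sumr ?(ltnW m2) // /lnn ln1 subr0.
  have -> : \sum_(2 <= i < m.+1) (sp i)%:R * (2 * (lnn i / i%:R)) =
     \sum_(2 <= i < m.+1 | sp i) 2 * (lnn i / i%:R).
    by rewrite [RHS]big_mkcond; apply: eq_bigr => i _; case: (sp i); rewrite ?mul1r ?mul0r.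
  by lra.
have hw m : (2 <= m)%N -> 0 <= (lnn m.+1)^-1 <= (lnn m)^-1.
  move=> m2; rewrite invr_ge0 lnn_ge0 lef_pV2 ?posrE ?lnn_gt0 //; last exact: leqW.
  by rewrite ler_lnn // ltnW.
have := abel_lower hw (ltac:(by []) : 0 <= 24 :> R) hd.
have iv2 : (lnn 2)^-1 <= 2.
  rewrite -[leRHS]invrK lef_pV2 ?posrE ?lnn_gt0 // ?invr_gt0 //; exact: lnn2_ge.
have -> : \sum_(2 <= i < y.+1) d i * (lnn i)^-1 =
    \sum_(2 <= p < y.+1 | sp p) 2 / p%:R - \sum_(2 <= i < y.+1) (lnn i - lnn i.-1) / lnn i.
  rewrite [in RHS]big_mkcond -sumrB big_nat [RHS]big_nat; apply: eq_bigr => i /andP[i2 _].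
  rewrite /d mulrBl; congr (_ - _); case: (sp i); rewrite ?mul0r // mul1r.
  by rewrite mulrA mulrAC mulfK // gt_eqF // lnn_gt0.
suff : ln (lnn y.+1) - ln (lnn 2) <= \sum_(2 <= i < y.+1) (lnn i - lnn i.-1) / lnn i.
  have : ln (lnn 2) <= 0 by apply: ln_le0; apply: lnn2_le.
  by lra.
rewrite -(telescope_sumr (fun i => ln (lnn i))); last exact: ltnW.
rewrite big_nat [leRHS]big_nat; apply: ler_sum => i /andP[i2 _].
have l0 := lnn_gt0 i2; have l1 := lnn_gt0 (leqW i2).
rewrite -ln_div ?posrE //; apply: le_trans (ln_sub1 _) _; first by rewrite divr_gt0.
rewrite -[X in _ - X](divff (lt0r_neq0 l0)) -mulrBl ler_wpM2r ?invr_ge0 ?(ltW l0) //.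
have i1 : (0 < i.-1)%N by lia.
rewrite /lnn -!ln_div ?posrE ?ltr0n ?(ltnW i2) //.
rewrite ler_ln ?posrE ?divr_gt0 ?ltr0n ?(ltnW i2) //.
rewrite ler_pdivrMr ?ltr0n ?(ltnW i2) // mulrAC ler_pdivlMr ?ltr0n //.
by rewrite -!natrM ler_nat; case: i i2 {l0 l1} i1 => // i _ _ /=; nia.
Qed.

(* The density of the Gaussian integers z such that p divides |z|^2. *)
Definition sieve_g p : R := if sp p then (2 * p%:R - 1) / p%:R ^+ 2 else 0.
(** The odds attached to the density, as in Selberg's sieve. *)
Definition sieve_h p : R := sieve_g p / (1 - sieve_g p).

Lemma sp_ge5 p : sp p -> (5 <= p)%N.
Proof.
move=> /andP[pp /eqP p4]; have := prime_gt1 pp.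
by case: p p4 {pp} => [|[|[|[|[|p]]]]].
Qed.

Lemma sieve_g_bounds p : 0 <= sieve_g p <= 2^-1 /\ sieve_g p <= 2 / p%:R.
Proof.
rewrite /sieve_g; case: ifP => spp; last first.
  by split; [apply/andP; split; lra|rewrite divr_ge0].
have p5 : 5 <= p%:R :> R by rewrite ler_nat sp_ge5.
have p0 : 0 < p%:R :> R by lra.
set x : R := p%:R in p5 p0 *.
have x2 : 0 < x ^+ 2 by rewrite exprn_gt0.
split; last by rewrite expr2 invfM mulrA ler_pM2r ?invr_gt0 // ler_pdivrMr //; lra.
apply/andP; split; first by rewrite divr_ge0 ?ltW //; lra.
by rewrite ler_pdivrMr //; nra.
Qed.

Lemma sieve_h_bounds p : 0 <= sieve_h p <= 1.
Proof.
have [/andP[g0 g1] _] := sieve_g_bounds p.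
have g2 : 0 < 1 - sieve_g p by lra.
by rewrite /sieve_h divr_ge0 ?(ltW g2) //= ler_pdivrMr // mul1r; lra.
Qed.

Lemma sieve_1h p : 1 + sieve_h p = (1 - sieve_g p)^-1.
Proof.
have [/andP[g0 g1] _] := sieve_g_bounds p.
by rewrite /sieve_h; field; rewrite gt_eqF //; lra.
Qed.

Lemma sieve_hg p : sieve_h p / (1 + sieve_h p) = sieve_g p.
Proof.
have [/andP[g0 g1] _] := sieve_g_bounds p.
by rewrite sieve_1h /sieve_h; field; rewrite gt_eqF //; lra.
Qed.

(** Here 1 - g = (1 - 1/p)^2, the chance of avoiding both Gaussian primes above p, and 1 - 1/p <=
    exp(-1/p). *)
Lemma sieve_1h_ge p : sp p -> expR (2 / p%:R) <= 1 + sieve_h p.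
Proof.
move=> spp; have p5 : 5 <= p%:R :> R by rewrite ler_nat sp_ge5.
have p0 : 0 < p%:R :> R by lra.
rewrite sieve_1h /sieve_g spp.
have -> : 1 - (2 * p%:R - 1) / p%:R ^+ 2 = (1 - p%:R^-1) ^+ 2 :> R.
  by field; rewrite gt_eqF.
have ip : p%:R^-1 <= 5^-1 :> R by rewrite lef_pV2 ?posrE.
have h1 : 1 - p%:R^-1 <= expR (- p%:R^-1) :> R by apply: expR_ge1Dx.
have e2 : expR (2 / p%:R) = (expR (- p%:R^-1) ^+ 2)^-1 :> R.
  by rewrite -expRM_natl -expRN; congr expR; ring.
rewrite e2 lef_pV2 ?posrE ?exprn_gt0 ?expR_gt0 //; last by lra.
by rewrite lerXn2r ?nnegrE ?expR_ge0 //; lra.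
Qed.

Variables (y Rb : nat).
Hypothesis y2 : (2 <= y)%N.
Notation I := 'I_y.+1.
Implicit Types D E : {set I}.

(** Squarefree moduli are encoded by their sets of prime factors, so that a product over primes
    expands directly into a sum over moduli. *)
Definition dprod D : nat := (\prod_(i in D) (i : nat))%N.
Definition dset : pred {set I} :=
  [pred D : {set I} | [forall (i : I | i \in D), sp i] && (dprod D <= Rb)%N].
Definition dwt D : R := \prod_(i in D) sieve_h i.
Definition sieve_V : R := \sum_(D | dset D) dwt D.

Lemma dwt_ge0 D : 0 <= dwt D.
Proof. by apply: prodr_ge0 => i _; case/andP: (sieve_h_bounds i). Qed.

Let full : R := \prod_(i : I) (1 + sieve_h i).

Let full_ge : lnn y * expR (- 48) <= full.
Proof.
apply: (@le_trans _ _ (expR (\sum_(2 <= p < y.+1 | sp p) 2 / p%:R))).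
  apply: (@le_trans _ _ (expR (ln (lnn y.+1) - 48))); last by rewrite ler_expR split_inv_sum_ge.
  rewrite expRD lnK ?posrE ?lnn_gt0 ?(leqW y2) // ler_wpM2r ?expR_ge0 //.
  by rewrite ler_lnn // ltnW.
rewrite /full -(big_mkord xpredT (fun i => 1 + sieve_h i)).
rewrite (@big_cat_nat _ _ _ 2 0) //=; last exact: leqW.
rewrite (_ : \prod_(0 <= i < 2) _ = 1) ?mul1r; last first.
  by rewrite big_nat_recr // big_nat1 /= /sieve_h /sieve_g /sp /= !mul0r !addr0 mul1r.
rewrite expR_sum big_mkcond [leLHS]big_seq [leRHS]big_seq.
apply: ler_prod => i _; case: ifP => spi.
  by rewrite expR_ge0 sieve_1h_ge.
by rewrite ler01 lerDl; case/andP: (sieve_h_bounds i).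
Qed.

Let full_gt0 : 0 < full.
Proof.
apply: prodr_gt0 => i _; rewrite ltr_pwDl //.
by case/andP: (sieve_h_bounds i).
Qed.

Let fullE : full = \sum_(D : {set I}) dwt D.
Proof.
rewrite /full; under eq_bigr do rewrite addrC.
rewrite bigA_distr; apply: eq_bigr => D _.
by rewrite /dwt [RHS]big_mkcond.
Qed.

(** With probabilities [dwt D / full], the primes belong to D independently, each with probability
    h/(1 + h) = g. *)
Let full_mem (j : I) : \sum_(D : {set I} | j \in D) dwt D = sieve_g j * full.
Proof.
have h0 : 0 < 1 + sieve_h j.
  by rewrite ltr_pwDl //; case/andP: (sieve_h_bounds j).
pose b (i : I) : R := (i != j)%:R.
transitivity (\prod_(i : I) (sieve_h i + b i)).
  rewrite bigA_distr big_mkcond; apply: eq_bigr => D _; case: ifP => jD.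
    rewrite /dwt big_mkcond; apply: eq_bigr => i _; case: ifP => // iD.
    by rewrite /b (_ : i != j) //; apply: contraFN iD => /eqP->.
  by rewrite (bigD1 j) //= jD /b eqxx mul0r.
rewrite /full (bigD1 j) //= [in RHS](bigD1 j) //= mulrA -sieve_hg divfK ?gt_eqF //.
rewrite /b eqxx addr0; congr (_ * _); apply: eq_bigr => i ij.
by rewrite /b ij addrC.
Qed.

Hypothesis R_big : 4 * (lnn y + 6) <= lnn Rb.

(** For these probabilities the expectation of ln [dprod D] is at most 2 (ln y + 6), half of ln Rb
    by [R_big]. By Markov's inequality the truncation at [Rb] discards at most half of the full
    product. *)
Lemma sieve_V_ge : lnn y * expR (- 48) / 2 <= sieve_V.
Proof.
suff h : full / 2 <= sieve_V.
  by apply: le_trans h; rewrite ler_wpM2r // invr_ge0.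
pose P := [pred D : {set I} | [forall (i : I | i \in D), sp i]].
have dwt_nP D : ~~ P D -> dwt D = 0.
  move=> /forall_inPn[i iD nsp]; rewrite /dwt (bigD1 i) //=.
  by rewrite /sieve_h /sieve_g (negPf nsp) mul0r mul0r.
have lnd D : P D -> lnn (dprod D) = \sum_(i in D) lnn i.
  move=> /forall_inP hD; rewrite /dprod lnn_prod // => i _ iD.
  by have := sp_ge5 (hD _ iD); lia.
have l0 : 0 < lnn Rb by move: R_big; have := lnn_ge0 R y; lra.
have big D : P D -> ~~ dset D -> dwt D <= (lnn Rb)^-1 * (dwt D * lnn (dprod D)).
  move=> PD; have -> : dset D = P D && (dprod D <= Rb)%N by [].
  rewrite PD /= -ltnNge => hR.
  rewrite mulrC -mulrA ler_peMr ?dwt_ge0 // ler_pdivlMr // mul1r.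
  have Rb0 : (0 < Rb)%N by rewrite lt0n; apply/eqP => e; move: l0; rewrite e /lnn ln0 // ltxx.
  by rewrite ler_lnn // ltnW.
have Sall : \sum_(D | P D) dwt D * lnn (dprod D) <= full * (2 * (lnn y + 6)).
  apply: (@le_trans _ _ (\sum_(D : {set I}) \sum_(i in D) dwt D * lnn i)).
    rewrite big_mkcond; apply: ler_sum => D _; case: ifP => PD.
      by rewrite lnd // mulr_sumr.
    by apply: sumr_ge0 => i _; rewrite mulr_ge0 ?dwt_ge0 ?lnn_ge0.
  rewrite (exchange_big_dep xpredT) //=.
  apply: (@le_trans _ _ (\sum_(i : I) full * (sieve_g i * lnn i))).
    by apply: ler_sum => i _; rewrite -mulr_suml full_mem le_eqVlt; apply/orP; left; apply/eqP; ring.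
  rewrite -mulr_sumr ler_pM2l //.
  apply: (@le_trans _ _ (2 * \sum_(1 <= p < y.+1 | prime p) lnn p / p%:R)); last first.
    by rewrite ler_pM2l //; apply: mertens_upper.
  rewrite -(big_mkord xpredT (fun i => sieve_g i * lnn i)) big_ltn // /lnn ln0 // mulr0 add0r.
  rewrite mulr_sumr [leRHS]big_mkcond; apply: ler_sum => p _.
  have lp := lnn_ge0 R p.
  have [/andP[g0 _] g2] := sieve_g_bounds p; case: ifP => pp.
    by rewrite [_ / p%:R]mulrC mulrA ler_wpM2r.
  by rewrite /sieve_g /sp pp mul0r.
have : full <= sieve_V + (lnn Rb)^-1 * (full * (2 * (lnn y + 6))).
  apply: (@le_trans _ _ (sieve_V + (lnn Rb)^-1 * \sum_(D | P D) dwt D * lnn (dprod D))); last first.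
    by rewrite lerD2l ler_wpM2l // invr_ge0 ltW.
  rewrite fullE (bigID dset) /= lerD2l mulr_sumr.
  rewrite big_mkcond [leRHS]big_mkcond; apply: ler_sum => D _.
  case: (boolP (dset D)) => [DR|DR] /=.
    case: ifP => // _; rewrite mulr_ge0 ?invr_ge0 ?(ltW l0) // mulr_ge0 ?dwt_ge0 ?lnn_ge0 //.
  case: ifP => PD; first exact: big.
  by rewrite dwt_nP //= PD.
have : (lnn Rb)^-1 * (full * (2 * (lnn y + 6))) <= full / 2.
  rewrite mulrC ler_pdivrMr //.
  by move: R_big full_gt0 => ? ?; nra.
lra.
Qed.

Lemma card_dset : (#|dset| <= Rb.+1)%N.
Proof.
have inj : {in dset &, injective dprod}.
  have mem D (i : I) : D \in dset -> (i \in D) = sp i && (i %| dprod D)%N.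
    rewrite inE => /andP[/forall_inP hD _].
    apply/idP/idP => [iD|/andP[spi]]; first by rewrite hD //= /dprod (bigD1 i) //= dvdn_mulr.
    have pi : prime i by case/andP: spi.
    rewrite /dprod; have : {in D, forall j : I, sp j} by move=> j; apply: hD.
    elim/big_rec: _ => [_|j x jD IH hD']; first by rewrite dvdn1 => /eqP h; move: pi; rewrite h.
    rewrite Euclid_dvdM // => /orP[|/IH]; last exact.
    have /andP[pj _] := hD' _ jD.
    by rewrite dvdn_prime2 // => /eqP/val_inj->.
  by move=> D E hD hE e; apply/setP => i; rewrite !mem // e.
have inj' : {in dset &, injective (fun D => inord (dprod D) : 'I_Rb.+1)}.
  move=> D E hD hE /(congr1 val) /=.
  by rewrite !inordK; first exact: inj; move: hD hE; rewrite !inE => /andP[_ h1] /andP[_ h2].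
by rewrite -(card_in_imset inj') -[leqRHS](card_ord Rb.+1) max_card.
Qed.

End sieve_density.

(** * Sums of periodic functions over Gaussian integers *)

Lemma sum_supp (R : realType) (T : eqType) (s t : seq T) (f : T -> R) :
  uniq s -> uniq t -> (forall x, x \in s -> x \notin t -> f x = 0) ->
  (forall x, x \in t -> x \notin s -> f x = 0) ->
  \sum_(x <- s) f x = \sum_(x <- t) f x.
Proof.
move=> us ut hs ht.
have restr (u v : seq T) : (forall x, x \in u -> x \notin v -> f x = 0) ->
    \sum_(x <- u) f x = \sum_(x <- [seq x <- u | x \in v]) f x.
  move=> h; rewrite big_filter (bigID (mem v)) /= [X in _ + X]big1_seq ?addr0 //.
  by move=> x /andP[xv xu]; apply: h.
rewrite (restr s t hs) (restr t s ht); apply: perm_big.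
apply: uniq_perm; rewrite ?filter_uniq // => x.
by rewrite !mem_filter andbC.
Qed.

Section periodic.
Variable R : realType.
Implicit Types (f h : gint -> R) (q B : nat).

Definition zbox B : seq gint :=
  [seq (i%:Z - B%:Z, j%:Z - B%:Z) | i <- iota 0 (2 * B), j <- iota 0 (2 * B)].

Lemma zbox_uniq B : uniq (zbox B).
Proof.
apply: allpairs_uniq; rewrite ?iota_uniq // => -[i j] [i' j'] _ _ /= [].
by move=> /(addIr _)[->] /(addIr _)[->].
Qed.

Lemma mem_zbox B (z : gint) :
  (z \in zbox B) = (- B%:Z <= z.1 < B%:Z) && (- B%:Z <= z.2 < B%:Z).
Proof.
apply/allpairsP/idP => [[[i j]]/=|].
  by rewrite !mem_iota => -[hi hj ->] /=; lia.
case: z => a b /= h; exists (`|(a + B%:Z)%R|%N, `|(b + B%:Z)%R|%N) => /=.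
by rewrite !mem_iota; split; [lia|lia|congr pair; lia].
Qed.

Definition zsum B f : R := \sum_(z <- zbox B) f z.

Lemma zsumE B f : zsum B f =
  \sum_(0 <= i < 2 * B) \sum_(0 <= j < 2 * B) f (i%:Z - B%:Z, j%:Z - B%:Z).
Proof. by rewrite /zsum /zbox big_allpairs_dep /index_iota !subn0. Qed.

Definition variation B f : R :=
  zsum B (fun z => `|f (z.1 + 1, z.2) - f z| + `|f (z.1, z.2 + 1) - f z|).

Definition periodic q h := forall (z : gint) (a b : int),
  h (z.1 + q%:Z * a, z.2 + q%:Z * b) = h z.

Definition pmean q h : R :=
  (q%:R ^+ 2)^-1 * \sum_(0 <= i < q) \sum_(0 <= j < q) h (i%:Z, j%:Z).

Lemma period_sum (q n : nat) (h : nat -> R) : (0 < q)%N ->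
  (forall i, h (i + q)%N = h i) -> (forall i, `|h i| <= 1) ->
  \sum_(0 <= i < q) h i = 0 -> `|\sum_(0 <= i < n) h i| <= q%:R.
Proof.
move=> q0 hq h1 hs; have [m] := ubnP n; elim: m n => // m IH n nm.
have [nq|qn] := leqP n q.
  apply: le_trans (ler_norm_sum _ _ _) _.
  apply: le_trans (ler_sum _ (fun i _ => h1 i)) _.
  by rewrite sumr_const_nat subn0 -[leLHS]mulr_natl mulr1 ler_nat.
rewrite (@big_cat_nat _ _ _ q) //= ?hs ?add0r; last exact: ltnW.
rewrite -{1}[q]add0n big_addn; under eq_bigr do rewrite hq.
by apply: IH; lia.
Qed.

Lemma abel_period (q n : nat) (k h : nat -> R) : (0 < q)%N ->
  (forall i, h (i + q)%N = h i) -> (forall i, `|h i| <= 1) -> k n = 0 ->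
  `|\sum_(0 <= i < n) k i * h i - q%:R^-1 * (\sum_(0 <= i < q) h i) * \sum_(0 <= i < n) k i| <=
  2 * q%:R * \sum_(0 <= i < n) `|k i.+1 - k i|.
Proof.
move=> q0 hq h1 kn.
have qR : 0 < q%:R :> R by rewrite ltr0n.
set b := q%:R^-1 * _.
have b1 : `|b| <= 1.
  rewrite normrM normfV normr_nat mulrC ler_pdivrMr // mul1r.
  apply: le_trans (ler_norm_sum _ _ _) _.
  apply: le_trans (ler_sum _ (fun i _ => h1 i)) _.
  by rewrite sumr_const_nat subn0 -[leLHS]mulr_natl mulr1.
(* Halved, since h - b is only bounded by 2 while [period_sum] asks for the bound 1. *)
pose H i : R := \sum_(0 <= j < i) (h j - b) / 2.
have H1 i : `|H i| <= q%:R.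
  apply: period_sum => // [j|j|]; first by rewrite hq.
    rewrite normrM (ger0_norm (x := 2^-1)) ?invr_ge0 // ler_pdivrMr // mul1r.
    by apply: le_trans (ler_normB _ _) _; have := h1 j; lra.
  rewrite -mulr_suml sumrB sumr_const_nat subn0 -[_ *+ q]mulr_natl /b mulVKf ?gt_eqF //.
  by rewrite subrr mul0r.
have abel m : \sum_(0 <= i < m) k i * (h i - b) =
    2 * (k m * H m) - \sum_(0 <= i < m) 2 * (H i.+1 * (k i.+1 - k i)).
  elim: m => [|m IHm]; first by rewrite !big_geq // /H big_geq // mulr0 mulr0 subrr.
  rewrite big_nat_recr //= IHm [in RHS]big_nat_recr //=.
  have -> : H m.+1 = H m + (h m - b) / 2 by rewrite /H big_nat_recr.
  by field.
have -> : \sum_(0 <= i < n) k i * h i - b * \sum_(0 <= i < n) k i =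
    \sum_(0 <= i < n) k i * (h i - b).
  by rewrite mulr_sumr -sumrB; apply: eq_bigr => i _; ring.
rewrite abel kn mul0r mulr0 sub0r normrN -mulr_sumr normrM ger0_norm // -mulrA.
rewrite ler_wpM2l // mulr_sumr; apply: le_trans (ler_norm_sum _ _ _) _.
by apply: ler_sum => i _; rewrite normrM ler_wpM2r.
Qed.

Lemma shift_period_sum q B (h : int -> R) : (forall a, h (a + q%:Z) = h a) ->
  \sum_(0 <= i < q) h (i%:Z - B%:Z) = \sum_(0 <= i < q) h i%:Z.
Proof.
move=> hq; elim: B => [|B IH]; first by apply: eq_bigr => i _; rewrite subr0.
rewrite -IH {IH}; case: q hq => [|q] hq; first by rewrite !big_geq.
rewrite big_nat_recl //= [RHS]big_nat_recr //= addrC; congr (_ + _).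
  by rewrite -hq; congr h; lia.
by apply: eq_bigr => i _; congr h; lia.
Qed.

(** Abel summation in each variable in turn, against the bounded sums of h minus its mean. The lines
    where a coordinate equals B lie just outside the half-open box; the vanishing of f there removes
    the boundary terms. *)
Lemma zsum_periodic B q f h : (0 < q)%N -> periodic q h -> (forall z, `|h z| <= 1) ->
  (forall z : gint, (z.1 == B%:Z) || (z.2 == B%:Z) -> f z = 0) ->
  `|zsum B (fun z => f z * h z) - pmean q h * zsum B f| <= 2 * q%:R * variation B f.
Proof.
move=> q0 hq h1 fB.
have qR : 0 < q%:R :> R by rewrite ltr0n.
pose n := (2 * B)%N.
have nB : n%:Z - B%:Z = B%:Z by rewrite /n; lia.
pose F i j := f (i%:Z - B%:Z, j%:Z - B%:Z).
pose H i j := h (i%:Z - B%:Z, j%:Z - B%:Z).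
have Hq1 i j : H (i + q)%N j = H i j.
  rewrite /H -(hq (i%:Z - B%:Z, j%:Z - B%:Z) 1 0) /=; congr (h (_, _)); lia.
have Hq2 i j : H i (j + q)%N = H i j.
  rewrite /H -(hq (i%:Z - B%:Z, j%:Z - B%:Z) 0 1) /=; congr (h (_, _)); lia.
pose Hb i := q%:R^-1 * \sum_(0 <= j < q) H i j.
have Hb1 i : `|Hb i| <= 1.
  rewrite normrM normfV normr_nat mulrC ler_pdivrMr // mul1r.
  apply: le_trans (ler_norm_sum _ _ _) _.
  apply: le_trans (ler_sum _ (fun j _ => h1 _)) _.
  by rewrite sumr_const_nat subn0 -[leLHS]mulr_natl mulr1.
have Hbq i : Hb (i + q)%N = Hb i.
  by rewrite /Hb; congr (_ * _); apply: eq_bigr => j _.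
have mE : pmean q h = q%:R^-1 * \sum_(0 <= i < q) Hb i.
  rewrite /pmean /Hb -mulr_sumr mulrA -invfM -expr2; congr (_ * _).
  rewrite -(shift_period_sum B (h := fun a => \sum_(0 <= j < q) h (a, j%:Z))).
    apply: eq_bigr => i _.
    rewrite -(shift_period_sum B (h := fun b => h (i%:Z - B%:Z, b))) // => a.
    by rewrite -(hq (i%:Z - B%:Z, a) 0 1) /=; congr (h (_, _)); lia.
  move=> a; apply: eq_bigr => j _.
  by rewrite -(hq (a, j%:Z) 1 0) /=; congr (h (_, _)); lia.
pose K i := \sum_(0 <= j < n) F i j.
have s1 : `|\sum_(0 <= i < n) \sum_(0 <= j < n) F i j * H i j - \sum_(0 <= i < n) K i * Hb i| <=
    2 * q%:R * \sum_(0 <= i < n) \sum_(0 <= j < n) `|F i j.+1 - F i j|.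
  rewrite -sumrB mulr_sumr; apply: le_trans (ler_norm_sum _ _ _) _.
  apply: ler_sum => i _; rewrite [K i * _]mulrC.
  apply: abel_period => // [j|]; first exact: h1.
  by rewrite /F nB fB // eqxx orbT.
have s2 : `|\sum_(0 <= i < n) K i * Hb i - pmean q h * \sum_(0 <= i < n) K i| <=
    2 * q%:R * \sum_(0 <= i < n) \sum_(0 <= j < n) `|F i.+1 j - F i j|.
  rewrite mE; apply: (@le_trans _ _ (2 * q%:R * \sum_(0 <= i < n) `|K i.+1 - K i|)).
    apply: abel_period => //.
    by rewrite /K big1 // => j _; rewrite /F nB fB // eqxx.
  rewrite ler_wpM2l ?mulr_ge0 //; apply: ler_sum => i _.
  by rewrite /K -sumrB; apply: ler_norm_sum.
have vE : variation B f = \sum_(0 <= i < n) \sum_(0 <= j < n) `|F i.+1 j - F i j| +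
    \sum_(0 <= i < n) \sum_(0 <= j < n) `|F i j.+1 - F i j|.
  rewrite /variation zsumE -big_split; apply: eq_bigr => i _ /=.
  rewrite -big_split; apply: eq_bigr => j _ /=; rewrite /F.
  by congr (`|f (_, _) - _| + `|f (_, _) - _|); lia.
rewrite !zsumE vE mulrDr.
have := ler_normD (\sum_(0 <= i < n) \sum_(0 <= j < n) F i j * H i j - \sum_(0 <= i < n) K i * Hb i)
  (\sum_(0 <= i < n) K i * Hb i - pmean q h * \sum_(0 <= i < n) K i).
rewrite addrA subrK => h'; apply: le_trans h' _.
by rewrite addrC lerD.
Qed.

Lemma crt_sum (p q : nat) (f g : nat -> R) : (0 < p)%N -> (0 < q)%N -> coprime p q ->
  (forall i, f (i %% p)%N = f i) -> (forall i, g (i %% q)%N = g i) ->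
  \sum_(0 <= i < p * q) f i * g i =
  (\sum_(0 <= i < p) f i) * \sum_(0 <= j < q) g j.
Proof.
move=> p0 q0 cpq hf hg.
rewrite !big_mkord mulr_suml.
under [RHS]eq_bigr do rewrite mulr_sumr.
rewrite pair_big /=.
pose e (m : 'I_(p * q)) : 'I_p * 'I_q := (Ordinal (ltn_pmod m p0), Ordinal (ltn_pmod m q0)).
have e_inj : injective e.
  move=> m m' [h1 h2]; apply: val_inj.
  have := chinese_remainder cpq m m'; rewrite h1 h2 !eqxx /= !modn_small //.
  by move=> /eqP.
have e_bij : bijective e by apply: inj_card_bij; rewrite ?card_prod ?card_ord.
rewrite (reindex e) /=; last exact: onW_bij.
by apply: eq_bigr => m _; rewrite hf hg.
Qed.

Lemma periodic_modn q h (a b : nat) : periodic q h ->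
  h ((a %% q)%N%:Z, b%:Z) = h (a%:Z, b%:Z) /\ h (a%:Z, (b %% q)%N%:Z) = h (a%:Z, b%:Z).
Proof.
move=> hq; split.
  rewrite -(hq ((a %% q)%N%:Z, b%:Z) (a %/ q)%N%:Z 0) /=; congr (h (_, _)); last lia.
  by rewrite [in RHS](divn_eq a q); lia.
rewrite -(hq (a%:Z, (b %% q)%N%:Z) 0 (b %/ q)%N%:Z) /=; congr (h (_, _)); first lia.
by rewrite [in RHS](divn_eq b q); lia.
Qed.

Lemma pmean_mul (p q : nat) f g : (0 < p)%N -> (0 < q)%N -> coprime p q ->
  periodic p f -> periodic q g ->
  pmean (p * q) (fun z => f z * g z) = pmean p f * pmean q g.
Proof.
move=> p0 q0 cpq hf hg; rewrite /pmean mulrACA -invfM -exprMn -natrM; congr (_ * _).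
rewrite exchange_big /= [X in _ = X * _]exchange_big [X in _ = _ * X]exchange_big /=.
rewrite -(crt_sum (f := fun j => \sum_(0 <= i < p) f (i%:Z, j%:Z))
    (g := fun j => \sum_(0 <= i < q) g (i%:Z, j%:Z))) //.
- apply: eq_bigr => j _.
  rewrite (crt_sum (f := fun i => f (i%:Z, j%:Z)) (g := fun i => g (i%:Z, j%:Z))) //.
    by move=> i; have [] := periodic_modn i j hf.
  by move=> i; have [] := periodic_modn i j hg.
- by move=> j; apply: eq_bigr => i _; have [] := periodic_modn i j hf.
- by move=> j; apply: eq_bigr => i _; have [] := periodic_modn i j hg.
Qed.

Lemma periodic_mull (p q : nat) f : periodic p f -> periodic (p * q) f.
Proof. by move=> hf z a b; rewrite !PoszM -!mulrA hf. Qed.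

Lemma periodic_mulf q f g : periodic q f -> periodic q g -> periodic q (fun z => f z * g z).
Proof. by move=> hf hg z a b; rewrite hf hg. Qed.

Lemma pmean_cst q (c : R) : (0 < q)%N -> pmean q (fun=> c) = c.
Proof.
move=> q0; rewrite /pmean !sumr_const_nat !subn0 -mulrnA -[c *+ _]mulr_natl natrM -expr2.
by rewrite mulrA mulVf ?mul1r // expf_eq0 /= pnatr_eq0 -lt0n.
Qed.

Lemma pmean_prod (T : eqType) (s : seq T) (v : T -> nat) (F : T -> gint -> R) :
  uniq (map v s) -> (forall i, i \in s -> prime (v i)) ->
  (forall i, i \in s -> periodic (v i) (F i)) ->
  let q := (\prod_(i <- s) v i)%N in
  periodic q (fun z => \prod_(i <- s) F i z) /\
  pmean q (fun z => \prod_(i <- s) F i z) = \prod_(i <- s) pmean (v i) (F i).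
Proof.
elim: s => [|i s IH] /= us ps Fs.
  rewrite !big_nil; split; first by move=> z a b; rewrite !big_nil.
  rewrite (_ : (fun z => _) = fun=> 1) ?pmean_cst //.
  by apply/funext => z; rewrite big_nil.
move/andP: us => [vi us].
have ps' j : j \in s -> prime (v j) by move=> js; apply: ps; rewrite inE js orbT.
have Fs' j : j \in s -> periodic (v j) (F j) by move=> js; apply: Fs; rewrite inE js orbT.
have [h1 h2] := IH us ps' Fs'.
have pi : prime (v i) by apply: ps; rewrite mem_head.
have Fi : periodic (v i) (F i) by apply: Fs; rewrite mem_head.
have -> : (fun z => \prod_(j <- i :: s) F j z) = (fun z => F i z * \prod_(j <- s) F j z).
  by apply/funext => z; rewrite big_cons.
rewrite !big_cons.
set q := (\prod_(j <- s) v j)%N in h1 h2 *.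
have q0 : (0 < q)%N by rewrite /q big_seq prodn_cond_gt0 // => j /ps'/prime_gt0.
split.
  by apply: periodic_mulf; [exact: periodic_mull|rewrite mulnC; exact: periodic_mull].
rewrite -h2 pmean_mul //; first exact: prime_gt0.
rewrite prime_coprime // /q big_seq; elim/big_rec: _ => [|j x js IHx].
  by rewrite dvdn1; apply/eqP => e; move: pi; rewrite e.
rewrite Euclid_dvdM // negb_or IHx andbT dvdn_prime2 // ?ps' //.
by apply: contraNneq vi => ->; apply: map_f.
Qed.

End periodic.

(** * The sieve *)

Section divisibility_events.
Variable R : realType.

Lemma Euclid_dvdz (p : nat) (a b : int) : prime p ->
  (p%:Z %| a * b)%Z = (p%:Z %| a)%Z || (p%:Z %| b)%Z.
Proof. by move=> pp; rewrite !dvdzE abszM /= Euclid_dvdM. Qed.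

Lemma dvdzDm (p : nat) (a b c : int) : (p%:Z %| c)%Z -> a = b + c ->
  (p%:Z %| a)%Z = (p%:Z %| b)%Z.
Proof. by move=> pc ->; apply: rpredDr. Qed.

(** If x^2 = -1 modulo p, the form z1^2 + z2^2 factors modulo p as (z1 - x z2)(z1 + x z2). *)
Lemma split_gN p : sp p -> exists x : nat, ~~ (p %| x)%N /\ forall z : gint,
  (p %| gN z)%N = (p%:Z %| z.1 - x%:Z * z.2)%Z || (p%:Z %| z.1 + x%:Z * z.2)%Z.
Proof.
move=> spp; have [x px] := exists_sqrtN1 spp.
have pp : prime p by case/andP: spp.
exists x; split.
  apply/negP => h; have : (p %| 1)%N by move: px; rewrite -mulnn dvdn_addr // dvdn_mulr.
  by rewrite dvdn1 => /eqP e; move: pp; rewrite e.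
move=> z; rewrite -Euclid_dvdz //.
transitivity (p%:Z %| (gN z)%:Z)%Z; first by rewrite dvdzE.
apply: (dvdzDm (c := z.2 ^+ 2 * (x ^ 2 + 1)%N%:Z)); first by rewrite dvdz_mull // dvdzE.
by rewrite gNE PoszD -mulnn PoszM; ring.
Qed.

Lemma count_residue (p : nat) (c : int) : (0 < p)%N ->
  \sum_(0 <= i < p) ((p%:Z %| i%:Z - c)%Z)%:R = 1 :> R.
Proof.
move=> p0; have pz : p%:Z != 0 by rewrite eqz_nat -lt0n.
pose i0 := `|(c %% p%:Z)%Z|%N.
have hi0 : i0%:Z = (c %% p%:Z)%Z by rewrite gez0_abs // modz_ge0.
have i0p : (i0 < p)%N by rewrite -ltz_nat hi0 ltz_pmod // ltz_nat.
rewrite big_mkord (bigD1 (Ordinal i0p)) //= big1 ?addr0.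
  by rewrite -eqz_mod_dvd hi0 modz_mod eqxx.
move=> [i ip] /= ne; rewrite -eqz_mod_dvd modz_small; last by rewrite /= ltz_nat.
by rewrite -hi0 eqz_nat; case: eqP => // e; case/eqP: ne; apply: val_inj.
Qed.

(** Divisibility of z by u in decidable form: |u|^2 divides both coordinates of the product of z
    with the conjugate of u. *)
Definition gdvd (u z : gint) : bool :=
  ((gN u)%:Z %| u.1 * z.1 + u.2 * z.2)%Z && ((gN u)%:Z %| u.1 * z.2 - u.2 * z.1)%Z.

Lemma gdvdP u z : u != 0 -> reflect (exists w, z = gmul u w) (gdvd u z).
Proof.
move=> u0; have n0 : (gN u)%:Z != 0 by rewrite eqz_nat gN_eq0.
apply: (iffP andP) => [[/dvdzP[a ha] /dvdzP[b hb]]|[w ->]].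
  exists (a, b); case: z u u0 n0 ha hb => [z1 z2] [u1 u2] u0 n0; rewrite gNE /= in n0 * => ha hb.
  rewrite /gmul /=; congr pair; apply: (mulIf n0).
    by rewrite mulrBl -!mulrA -ha -hb; ring.
  by rewrite mulrDl -!mulrA -ha -hb; ring.
rewrite gNE /gmul /=; split; apply/dvdzP; [exists w.1|exists w.2]; ring.
Qed.

Lemma gpr_coprime p : sp p -> ~~ (p%:Z %| (gpr p).1)%Z.
Proof.
move=> spp; have pp : prime p by case/andP: spp.
have := gprN spp; rewrite /gN; set a := `|_|%N; set b := `|(gpr p).2|%N => e.
rewrite dvdzE /= -/a; apply/negP => pa.
have [a0|a0] := posnP a.
  move: e; rewrite a0 exp0n // add0n => e.
  have : (b %| p)%N by rewrite -e expnS dvdn_mulr.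
  case/primeP: pp => p1 h /h /orP[] /eqP hb; move: e p1; rewrite hb; nia.
have := dvdn_leq a0 pa; have := prime_gt1 pp; nia.
Qed.

(** With u = (a, b), a times the second coordinate is p z2 minus b times the first, and p does not
    divide a. The single linear congruence left is what gives density 1/p. *)
Lemma gdvd_gpr p z : sp p ->
  gdvd (gpr p) z = (p%:Z %| (gpr p).1 * z.1 + (gpr p).2 * z.2)%Z.
Proof.
move=> spp; rewrite /gdvd (gprN spp).
have pp : prime p by case/andP: spp.
apply/andP/idP => [[]//|h]; split => //.
have := gNE (gpr p); rewrite (gprN spp); move: h (gpr_coprime spp).
case: (gpr p) => a b /= h pa e.
suff : (p%:Z %| a * (a * z.2 - b * z.1))%Z by rewrite Euclid_dvdz // (negPf pa).
have -> : a * (a * z.2 - b * z.1) = p%:Z * z.2 - b * (a * z.1 + b * z.2) by rewrite e; ring.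
by apply: rpredB; [exact: dvdz_mulr (dvdzz _)|exact: dvdz_mull].
Qed.

Lemma periodic_dvdz (p : nat) (F : gint -> int) : (forall z a b, exists c,
    F (z.1 + p%:Z * a, z.2 + p%:Z * b) = F z + p%:Z * c) ->
  forall z a b, (p%:Z %| F (z.1 + p%:Z * a, z.2 + p%:Z * b)%R)%Z = (p%:Z %| F z)%Z.
Proof. by move=> h z a b; have [c ->] := h z a b; apply: rpredDr; apply: dvdz_mulr. Qed.

Lemma periodic_gdvd p : sp p -> periodic p (fun z => (gdvd (gpr p) z)%:R : R).
Proof.
move=> spp z a b; rewrite !gdvd_gpr //.
rewrite (@periodic_dvdz p (fun z => (gpr p).1 * z.1 + (gpr p).2 * z.2)) // => {}z {}a {}b.
by exists ((gpr p).1 * a + (gpr p).2 * b) => /=; ring.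
Qed.

Lemma pmean_gdvd p : sp p -> pmean p (fun z => (gdvd (gpr p) z)%:R : R) = p%:R^-1.
Proof.
move=> spp; have pp : prime p by case/andP: spp.
have p0 := prime_gt0 pp.
have [a' [k ha]] : exists a' k : int, a' * (gpr p).1 = 1 + k * p%:Z.
  have cop : coprimez (gpr p).1 p%:Z.
    by rewrite coprimezE coprime_sym prime_coprime // -dvdzE; apply: gpr_coprime.
  case: (Bezoutz (gpr p).1 p%:Z) => u [v]; rewrite (eqP cop) => e.
  by exists u, (- v); rewrite mulNr -e; ring.
rewrite /pmean exchange_big /=.
under eq_bigr => j _.
  rewrite (eq_bigr (fun i => ((p%:Z %| i%:Z - (- (a' * (gpr p).2 * j%:Z)))%Z)%:R)); last first.
    move=> i _; rewrite gdvd_gpr //=; congr (nat_of_bool _)%:R.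
    have pa' : ~~ (p%:Z %| a')%Z.
      apply/negP => h; have : (p%:Z %| a' * (gpr p).1 - k * p%:Z)%Z.
        by apply: rpredB; [exact: dvdz_mulr|exact: dvdz_mull (dvdzz _)].
      by rewrite ha addrK dvdzE /= dvdn1 => /eqP e; move: pp; rewrite e.
    transitivity (p%:Z %| a' * ((gpr p).1 * i%:Z + (gpr p).2 * j%:Z))%Z.
      by rewrite Euclid_dvdz // (negPf pa').
    apply: (dvdzDm (c := k * p%:Z * i%:Z)); first by rewrite -mulrA dvdz_mull // dvdz_mulr.
    by rewrite mulrDr mulrA ha; ring.
  rewrite count_residue //; over.
rewrite sumr_const_nat subn0 expr2 invfM -mulrA mulVf ?mulr1 //.
by rewrite pnatr_eq0 -lt0n.
Qed.

Lemma periodic_dvd_gN p : sp p -> periodic p (fun z => ((p %| gN z)%N)%:R : R).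
Proof.
move=> spp z a b; have [x [_ hx]] := split_gN spp; rewrite !hx.
rewrite (@periodic_dvdz p (fun z => z.1 - x%:Z * z.2)).
  rewrite (@periodic_dvdz p (fun z => z.1 + x%:Z * z.2)) // => {}z {}a {}b.
  by exists (a + x%:Z * b) => /=; ring.
by move=> {}z {}a {}b; exists (a - x%:Z * b) => /=; ring.
Qed.

(** For each nonzero j there are two solutions, i = x j and i = -x j, distinct because p is odd and
    does not divide x; for j = 0 they merge. This makes 2p - 1 solutions modulo p. *)
Lemma pmean_dvd_gN p : sp p ->
  pmean p (fun z => ((p %| gN z)%N)%:R : R) = sieve_g R p.
Proof.
move=> spp; have pp : prime p by case/andP: spp.
have p0 := prime_gt0 pp; have p5 := sp_ge5 spp.
have [x [px hx]] := split_gN spp.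
rewrite /sieve_g spp /pmean mulrC exchange_big /=; congr (_ / _).
transitivity (\sum_(0 <= j < p) (2 - ((j == 0)%N)%:R) : R).
  rewrite big_nat [RHS]big_nat; apply: eq_bigr => j /andP[_ jp].
  transitivity (\sum_(0 <= i < p) (((p%:Z %| i%:Z - x%:Z * j%:Z)%Z)%:R + ((p%:Z %| i%:Z - (- (x%:Z * j%:Z)))%Z)%:R
      - ((p%:Z %| i%:Z - 0)%Z)%:R * ((j == 0)%N)%:R : R)).
    apply: eq_bigr => i _; rewrite hx /= opprK subr0.
    have [->|j0] := eqVneq j 0%N.
      by rewrite (mulr0 x%:Z) subr0 ?addr0 orbb mulr1 addrK.
    rewrite mulr0 subr0; case h1 : (p%:Z %| i%:Z - x%:Z * j%:Z)%Z => /=; last by rewrite add0r.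
    case h2 : (p%:Z %| i%:Z + x%:Z * j%:Z)%Z => /=; last by rewrite addr0.
    have : (p%:Z %| 2%:Z * (x%:Z * j%:Z))%Z.
      have -> : 2%:Z * (x%:Z * j%:Z) = (i%:Z + x%:Z * j%:Z) - (i%:Z - x%:Z * j%:Z) by ring.
      by rewrite rpredB.
    rewrite !Euclid_dvdz // !dvdzE /= (negPf px) /= => /orP[] /dvdn_leq; last by rewrite lt0n j0 leqNgt jp => /(_ isT).
    by move=> /(_ isT); lia.
  rewrite sumrB big_split /= !count_residue // -mulr_suml count_residue //; ring.
rewrite sumrB sumr_const_nat subn0 (big_ltn p0) eqxx big_nat big1 ?addr0.
  by rewrite -[_ *+ p]mulr_natl mulrC.
by move=> j /andP[j1 _]; case: eqP => // e; move: j1; rewrite e.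
Qed.

End divisibility_events.

(** * Selberg's upper bound sieve for norms *)

Section sieve.
Variables (R : realType) (y Rb : nat).
Notation I := 'I_y.+1.
Notation V := (sieve_V R y Rb).

(** The two values are those that give mean 0: -1 with density g and h with density 1 - g, where h
    (1 - g) = g. *)
Definition xi (p : nat) (z : gint) : R :=
  if sp p then (if (p %| gN z)%N then -1 else sieve_h R p) else 0.

Lemma xiE p z : sp p ->
  xi p z = sieve_h R p + (- (1 + sieve_h R p)) * ((p %| gN z)%N)%:R.
Proof. by move=> spp; rewrite /xi spp; case: (p %| gN z)%N => /=; ring. Qed.

Lemma xi_norm p z : `|xi p z| <= 1.
Proof.
rewrite /xi; case: ifP => _; last by rewrite normr0.
case: ifP => _; first by rewrite normrN normr1.
by have /andP[h0 h1] := sieve_h_bounds R p; rewrite ger0_norm.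
Qed.

Lemma periodic_xi p : sp p -> periodic p (xi p).
Proof.
by move=> spp z a b; rewrite !xiE // (periodic_dvd_gN R spp).
Qed.

Lemma pmeanD q (f g : gint -> R) : pmean q (fun z => f z + g z) = pmean q f + pmean q g.
Proof.
rewrite /pmean -mulrDr -big_split /=; congr (_ * _); apply: eq_bigr => i _.
by rewrite -big_split.
Qed.

Lemma pmeanZ q c (f : gint -> R) : pmean q (fun z => c * f z) = c * pmean q f.
Proof.
rewrite /pmean mulrCA; congr (_ * _); rewrite mulr_sumr; apply: eq_bigr => i _.
by rewrite mulr_sumr.
Qed.

Lemma pmean_xi p : sp p -> pmean p (xi p) = 0.
Proof.
move=> spp; have p0 : (0 < p)%N by case/andP: spp => /prime_gt0.
have -> : xi p = fun z => sieve_h R p + (- (1 + sieve_h R p)) * ((p %| gN z)%N)%:R.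
  by apply/funext => z; apply: xiE.
rewrite pmeanD pmean_cst // pmeanZ pmean_dvd_gN // -sieve_hg.
have [/andP[h0 h1] _] := sieve_g_bounds R p; have /andP[h2 _] := sieve_h_bounds R p.
by field; rewrite gt_eqF //; lra.
Qed.

Lemma pmean_xi_sqr p : sp p -> pmean p (fun z => xi p z * xi p z) = sieve_h R p.
Proof.
move=> spp; have p0 : (0 < p)%N by case/andP: spp => /prime_gt0.
have -> : (fun z => xi p z * xi p z) = fun z => sieve_h R p ^+ 2 + (1 - sieve_h R p ^+ 2) * ((p %| gN z)%N)%:R.
  by apply/funext => z; rewrite /xi spp; case: (p %| gN z)%N => /=; ring.
rewrite pmeanD pmean_cst // pmeanZ pmean_dvd_gN // -sieve_hg.
have [/andP[h0 h1] _] := sieve_g_bounds R p; have /andP[h2 _] := sieve_h_bounds R p.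
by field; rewrite gt_eqF //; lra.
Qed.

(* Every [xi p] has mean 0 and mean square [sieve_h p], so the products over distinct
   [D] are orthogonal and [sieve_sum] has mean square V; at the primes beyond [y]
   it equals V. *)
Definition sieve_sum (z : gint) : R :=
  \sum_(D : {set I} | dset Rb D) \prod_(i in D) xi i z.

Lemma sieve_sum_gpr p : sp p -> (y < p)%N -> sieve_sum (gpr p) = V.
Proof.
move=> spp yp; apply: eq_bigr => D /andP[/forall_inP hD _].
apply: eq_bigr => i iD; rewrite /xi hD // gprN //.
have /andP[pi _] := hD i iD; have /andP[pp _] := spp.
rewrite dvdn_prime2 //; case: eqP => // e.
by have := ltn_ord i; rewrite e ltnS leqNgt yp.
Qed.

Let pair_fun (D E : {set I}) (i : I) (z : gint) : R :=
  (if i \in D then xi i z else 1) * (if i \in E then xi i z else 1).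

Let prod_pair (D E : {set I}) z : (\prod_(i in D) xi i z) * (\prod_(i in E) xi i z) =
  \prod_(i <- [seq i <- enum I | (i \in D) || (i \in E)]) pair_fun D E i z.
Proof.
rewrite big_filter big_enum_cond /= [LHS](_ : _ = \prod_(i : I) pair_fun D E i z).
  rewrite [RHS]big_mkcond; apply: eq_bigr => i _; case: ifP => //.
  by rewrite /pair_fun; case: (i \in D) => //=; case: (i \in E) => //= _; rewrite mulr1.
by rewrite big_mkcond [X in _ * X]big_mkcond -big_split.
Qed.

(** For distinct D and E some prime lies in exactly one of them, and its factor has mean 0. The
    product is periodic with period the product of the primes of the union, at most Rb^2, which
    determines the error. *)
Let pair_mean (D E : {set I}) B (f : gint -> R) : dset Rb D -> dset Rb E ->
  (forall z : gint, (z.1 == B%:Z) || (z.2 == B%:Z) -> f z = 0) ->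
  `|zsum B (fun z => f z * ((\prod_(i in D) xi i z) * (\prod_(i in E) xi i z))) -
    (if D == E then dwt R D else 0) * zsum B f| <= 2 * (Rb ^ 2)%N%:R * variation B f.
Proof.
move=> /andP[/forall_inP hD DR] /andP[/forall_inP hE ER] fB.
set s := [seq i <- enum I | (i \in D) || (i \in E)].
have sp_s (i : I) : i \in s -> sp i.
  by rewrite mem_filter => /andP[/orP[/hD|/hE]].
have us : uniq (map (@nat_of_ord _) s).
  by rewrite (map_inj_uniq (@ord_inj _)) /s filter_uniq // enum_uniq.
have [||per mean] := @pmean_prod R _ s (@nat_of_ord _) (pair_fun D E) us.
- by move=> i /sp_s/andP[].
- move=> i /sp_s spi z a b; rewrite /pair_fun; case: ifP => _; case: ifP => _ //.
  + by rewrite !(periodic_xi spi).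
  + by rewrite !(periodic_xi spi).
  + by rewrite !(periodic_xi spi).
set q := (\prod_(i <- s) _)%N in per mean.
have q0 : (0 < q)%N.
  by rewrite /q big_seq prodn_cond_gt0 // => i /sp_s/andP[/prime_gt0].
have qR : (q <= Rb ^ 2)%N.
  apply: (@leq_trans (dprod D * dprod E)); last by rewrite -mulnn leq_mul.
  rewrite /q /s big_filter big_enum_cond /= [X in (X <= _)%N]big_mkcond /= /dprod [X in (_ <= X * _)%N]big_mkcond [X in (_ <= _ * X)%N]big_mkcond -big_split /=.
  apply: leq_prod => i _; case iD : (i \in D) => /=; case iE : (i \in E) => //=; last by rewrite mul1n.
    by rewrite leq_pmulr //; have /andP[/prime_gt0] := hE i iE.
  by rewrite muln1.
have pn z : `|\prod_(i <- s) pair_fun D E i z| <= 1.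
  rewrite normr_prod; apply: prodr_ile1 => i _; rewrite normr_ge0 /pair_fun normrM.
  by apply: mulr_ile1; rewrite ?normr_ge0 //; case: ifP => _; rewrite ?xi_norm ?normr1.
have := zsum_periodic q0 per pn fB; rewrite mean.
have -> : \prod_(i <- s) pmean i (pair_fun D E i) = if D == E then dwt R D else 0.
  case: eqP => [e|ne].
    rewrite /s -e big_filter big_enum_cond /=; under eq_bigl do rewrite orbb.
    apply: eq_bigr => i iD; rewrite -pmean_xi_sqr ?hD //; congr pmean.
    by apply/funext => z; rewrite /pair_fun iD.
  have [i hi] : exists i, (i \in D) != (i \in E).
    apply: contrapT => /forallNP H; apply: ne; apply/setP => i.
    by have := H i; case: (i \in D); case: (i \in E).
  have is_ : i \in s.
    by rewrite mem_filter mem_enum andbT; move: hi; case: (i \in D); case: (i \in E).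
  rewrite (big_rem i) //= (_ : pmean _ _ = 0) ?mul0r //.
  rewrite -(pmean_xi (sp_s _ is_)); congr pmean; apply/funext => z; rewrite /pair_fun.
  by move: hi; case: (i \in D); case: (i \in E) => //= _; rewrite ?mulr1 ?mul1r.
have -> : (fun z => f z * ((\prod_(i in D) xi i z) * (\prod_(i in E) xi i z))) =
    fun z => f z * \prod_(i <- s) pair_fun D E i z by apply/funext => z; rewrite prod_pair.
move=> h; apply: le_trans h _; rewrite ler_wpM2r //; last by rewrite ler_pM2l // ler_nat.
by apply: sumr_ge0 => z _; rewrite addr_ge0.
Qed.

Lemma sieve_upper B (f : gint -> R) :
  (forall z : gint, (z.1 == B%:Z) || (z.2 == B%:Z) -> f z = 0) ->
  zsum B (fun z => f z * sieve_sum z ^+ 2) <=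
  V * zsum B f + (Rb.+1 ^ 2)%N%:R * (2 * (Rb ^ 2)%N%:R * variation B f).
Proof.
move=> fB; set err := 2 * _ * _.
have err0 : 0 <= err.
  by rewrite !mulr_ge0 //; apply: sumr_ge0 => z _; rewrite addr_ge0.
have -> : zsum B (fun z => f z * sieve_sum z ^+ 2) =
    \sum_(D : {set I} | dset Rb D) \sum_(E : {set I} | dset Rb E)
      zsum B (fun z => f z * ((\prod_(i in D) xi i z) * (\prod_(i in E) xi i z))).
  under [RHS]eq_bigr do rewrite exchange_big /=; rewrite exchange_big /=.
  apply: eq_bigr => z _; rewrite /sieve_sum expr2 mulr_suml mulr_sumr.
  by apply: eq_bigr => D _; rewrite mulr_sumr mulr_sumr.
apply: (@le_trans _ _ (\sum_(D : {set I} | dset Rb D) \sum_(E : {set I} | dset Rb E)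
    ((if D == E then dwt R D else 0) * zsum B f + err))).
  apply: ler_sum => D hD; apply: ler_sum => E hE.
  by have /ler_normlP[_] := pair_mean hD hE fB; rewrite -/err; lra.
apply: (@le_trans _ _ (\sum_(D : {set I} | dset Rb D) (dwt R D * zsum B f + (Rb.+1)%:R * err))).
  apply: ler_sum => D hD; rewrite big_split /= lerD //.
    by rewrite -mulr_suml (bigD1 D) //= eqxx big1 ?addr0 // => E /andP[_ /negPf]; rewrite eq_sym => ->.
  by rewrite sumr_const -[_ *+ _]mulr_natl ler_wpM2r // ler_nat; exact: card_dset.
rewrite big_split /= -mulr_suml lerD // sumr_const -[_ *+ _]mulr_natl.
rewrite -mulnn natrM -[leRHS]mulrA; apply: ler_wpM2r; first by rewrite mulr_ge0 ?ler0n.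
by rewrite ler_nat; exact: card_dset.
Qed.

(** By positivity: f times the square of [sieve_sum] is nonnegative everywhere and equals V^2 f at
    the primes counted, whereas its total is about V times that of f. *)
Lemma sieve_primes B (f : gint -> R) (s : seq nat) :
  (forall z, 0 <= f z) -> 0 < V ->
  (forall z : gint, (z.1 == B%:Z) || (z.2 == B%:Z) -> f z = 0) ->
  uniq s -> {in s, forall p, [&& sp p, (y < p)%N & gpr p \in zbox B]} ->
  \sum_(p <- s) f (gpr p) <=
  zsum B f / V + (Rb.+1 ^ 2)%N%:R * (2 * (Rb ^ 2)%N%:R * variation B f) / V ^+ 2.
Proof.
move=> f0 V0 fB us hs.
have gpr_inj : {in s &, injective gpr}.
  by move=> p q /hs/and3P[h1 _ _] /hs/and3P[h2 _ _] /(congr1 gN); rewrite !gprN.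
have h : V ^+ 2 * \sum_(p <- s) f (gpr p) <= zsum B (fun z => f z * sieve_sum z ^+ 2).
  rewrite mulr_sumr.
  have -> : \sum_(p <- s) V ^+ 2 * f (gpr p) = \sum_(z <- map gpr s) f z * sieve_sum z ^+ 2.
    rewrite big_map big_seq [RHS]big_seq; apply: eq_bigr => p /hs/and3P[h1 h2 _].
    by rewrite sieve_sum_gpr // mulrC.
  rewrite /zsum [leRHS](bigID (mem (map gpr s))) /=.
  have -> : \sum_(z <- map gpr s) f z * sieve_sum z ^+ 2 = \sum_(z <- zbox B | z \in map gpr s) f z * sieve_sum z ^+ 2.
    rewrite -[RHS]big_filter; apply: perm_big; apply: uniq_perm.
    - by rewrite map_inj_in_uniq.
    - by rewrite filter_uniq // zbox_uniq.
    - move=> z; rewrite mem_filter; case zs : (z \in map gpr s) => //=.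
      by move/mapP: zs => [p /hs/and3P[_ _ hz] ->].
  by rewrite lerDl sumr_ge0 // => z _; rewrite mulr_ge0 // sqr_ge0.
have V2 : 0 < V ^+ 2 by rewrite exprn_gt0.
rewrite -(ler_pM2l V2); apply: le_trans h _; apply: le_trans (sieve_upper fB) _.
rewrite le_eqVlt; apply/orP; left; apply/eqP; field.
by rewrite gt_eqF.
Qed.

End sieve.

(** * Existence of scales *)

Section radial_weights.
Variable R : realType.
Implicit Types (f g : gint -> R) (a b l : R) (z w : gint) (N : nat).

Lemma inv_sqr_le (x y : R) : 0 < x -> x <= y -> y^-2 <= x^-2.
Proof.
move=> x0 xy; have y0 : 0 < y by exact: lt_le_trans xy.
rewrite lef_pV2 ?posrE ?exprn_gt0 //.
by apply: lerXn2r => //; rewrite nnegrE ltW.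
Qed.

Lemma zsum_frame N f :
  zsum N.+1 f = zsum N f + \sum_(z <- zbox N.+1 | z \notin zbox N) f z.
Proof.
rewrite /zsum (bigID (mem (zbox N))) /=; congr (_ + _).
rewrite -[LHS]big_filter; apply: perm_big; apply: uniq_perm.
- by rewrite filter_uniq // zbox_uniq.
- exact: zbox_uniq.
- move=> z; rewrite mem_filter; case zN : (z \in zbox N) => //=.
  by move: zN; rewrite !mem_zbox; lia.
Qed.

Lemma zsum_cst N (c : R) : zsum N (fun=> c) = 4 * N%:R ^+ 2 * c.
Proof.
rewrite zsumE !sumr_const_nat subn0 -mulrnA -[_ *+ _]mulr_natl !natrM; ring.
Qed.

Lemma zsumZ N (c : R) f : zsum N (fun z => c * f z) = c * zsum N f.
Proof. by rewrite /zsum mulr_sumr. Qed.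

Lemma zsumB N f g : zsum N (fun z => f z - g z) = zsum N f - zsum N g.
Proof. by rewrite /zsum sumrB. Qed.

Lemma zsumD N f g : zsum N (fun z => f z + g z) = zsum N f + zsum N g.
Proof. by rewrite /zsum big_split. Qed.

Lemma frame_size N : \sum_(z <- zbox N.+1 | z \notin zbox N) 1 = 8 * N%:R + 4 :> R.
Proof. by have := zsum_frame N (fun=> 1); rewrite !zsum_cst -[N.+1%:R]natr1; lra. Qed.

Lemma frame_nm N z : z \in zbox N.+1 -> z \notin zbox N ->
  N%:R <= nm z :> R /\ nm z <= 2 * N.+1%:R :> R.
Proof.
rewrite !mem_zbox => h1 h2; have : (N ^ 2 <= gN z <= (2 * N.+1) ^ 2)%N.
  by rewrite /gN; case: z h1 h2 => c d /=; rewrite -!mulnn; nia.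
move=> /andP[g1 g2]; split; rewrite -(ler_pXn2r (n := 2)) ?nnegrE ?mulr_ge0 ?ler0n ?nm_ge0 //.
  by rewrite nm_sqr -natrX ler_nat.
by rewrite nm_sqr -natrM -natrX ler_nat.
Qed.

Lemma ln_succ_bounds N : (0 < N)%N ->
  (2 * N%:R)^-1 <= lnn R N.+1 - lnn R N /\ lnn R N.+1 - lnn R N <= N%:R^-1.
Proof.
move=> N0; have n1 : 1 <= N%:R :> R by rewrite ler1n.
have -> : lnn R N.+1 - lnn R N = ln (N.+1%:R / N%:R).
  by rewrite /lnn ln_div ?posrE ?ltr0n.
have NV : 0 < N%:R^-1 :> R by rewrite invr_gt0; lra.
split; last first.
  apply: le_trans (ln_sub1 _) _; first by rewrite divr_gt0 ?ltr0n.
  by rewrite -[N.+1%:R]natr1 mulrDl mulfV ?gt_eqF; lra.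
have := @ln_sub1 R (N%:R / N.+1%:R); rewrite divr_gt0 ?ltr0n // => /(_ isT).
rewrite -[X in ln X]invf_div lnV ?posrE ?divr_gt0 ?ltr0n // => h.
apply: (@le_trans _ _ (1 - N%:R / N.+1%:R)); last by rewrite -lerN2 opprB.
rewrite -[N.+1%:R]natr1 -[leRHS]opprK lerNr.
have -> : - (1 - N%:R / (N%:R + 1)) = - (N%:R + 1)^-1 :> R by field; lra.
by rewrite lerN2 lef_pV2 ?posrE; lra.
Qed.

(** The box is peeled into square frames. The frame next to N + 1 has 8(N+1) + 4 points of modulus
    at least N + 1, hence contributes at most 12c/(N+1), that is at most 24c times the increment of
    ln. *)
Lemma zsum_le_frames N f c : (0 < N)%N -> 0 <= c ->
  (forall z, f z <= c / Num.max 1 (nm z) ^+ 2) ->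
  zsum N f <= c * (16 + 24 * lnn R N).
Proof.
move=> N0 c0 fc; elim: N N0 => // -[|N] IH _.
  rewrite /lnn ln1 mulr0 addr0.
  apply: (@le_trans _ _ (zsum 1 (fun=> c))); last by rewrite zsum_cst; lra.
  apply: ler_sum => z _; apply: le_trans (fc z) _.
  by rewrite ler_pdivrMr ?exprn_gt0 ?lt_max ?ltr01 // ler_peMr // exprn_ege1 // le_max lexx.
rewrite zsum_frame; have {}IH := IH isT.
have n1 : 1 <= N.+1%:R :> R by rewrite ler1n.
have : \sum_(z <- zbox N.+2 | z \notin zbox N.+1) f z <= (8 * N.+1%:R + 4) * (c / N.+1%:R ^+ 2).
  rewrite -frame_size mulr_suml big_seq_cond [leRHS]big_seq_cond; apply: ler_sum => z /andP[z1 z2].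
  rewrite mul1r; apply: le_trans (fc z) _; have [h _] := frame_nm z1 z2.
  rewrite ler_wpM2l // lef_pV2 ?posrE ?exprn_gt0 ?lt_max ?ltr01 ?ltr0n //.
  by rewrite ler_pXn2r ?nnegrE ?le_max ?ler01 // h orbT.
have [h _] := ln_succ_bounds (ltn0Sn N).
have : (8 * N.+1%:R + 4) * (c / N.+1%:R ^+ 2) <= c * (24 * (2 * N.+1%:R)^-1).
  rewrite mulrCA ler_wpM2l // ler_pdivrMr ?exprn_gt0 ?ltr0n //.
  have -> : 24 * (2 * N.+1%:R)^-1 * N.+1%:R ^+ 2 = 12 * N.+1%:R :> R by field; lra.
  by lra.
have : c * (24 * (2 * N.+1%:R)^-1) <= c * (24 * (lnn R N.+2 - lnn R N.+1)).
  by rewrite ler_wpM2l // ler_pM2l.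
have -> : c * (16 + 24 * lnn R N.+2) =
  c * (16 + 24 * lnn R N.+1) + c * (24 * (lnn R N.+2 - lnn R N.+1)) by ring.
move=> k1 k2 k3; apply: lerD IH _.
exact: le_trans k3 (le_trans k2 k1).
Qed.

Lemma zsum_mono M N f : (M <= N)%N -> (forall z, 0 <= f z) -> zsum M f <= zsum N f.
Proof.
move=> /subnK <- f0; elim: (N - M)%N => // k IH; apply: le_trans IH _.
by rewrite addSn zsum_frame lerDl sumr_ge0.
Qed.

Lemma zsum_supp M N f : (forall z, z \notin zbox M -> f z = 0) ->
  (forall z, z \notin zbox N -> f z = 0) -> zsum M f = zsum N f.
Proof. by move=> hM hN; apply: sum_supp => [||z _ /hN|z _ /hM] //; apply: zbox_uniq. Qed.

(* |z|^-2, truncated at the radii [a] and [b].  Multiplication by [u] rescales both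
   radii, so that it changes the weight only near its two ends. *)
Definition kw a b z : R := Num.max 0 ((Num.max a (nm z))^-2 - b^-2).

Lemma kw_ge0 a b z : 0 <= kw a b z.
Proof. by rewrite le_max lexx. Qed.

Lemma kw_eq0 a b z : 0 < b -> b <= nm z -> kw a b z = 0.
Proof.
move=> b0 bz; rewrite /kw; apply/max_idPl; rewrite subr_le0.
by apply: inv_sqr_le => //; rewrite le_max bz orbT.
Qed.

Lemma zboxPn N z : z \notin zbox N -> N%:R <= nm z :> R.
Proof.
rewrite mem_zbox => h; have : (N ^ 2 <= gN z)%N.
  by rewrite /gN; case: z h => c d /=; rewrite -!mulnn; nia.
move=> g1; rewrite -(ler_pXn2r (n := 2)) ?nnegrE ?ler0n ?nm_ge0 //.
by rewrite nm_sqr -natrX ler_nat.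
Qed.

Lemma zbox_edge N z : (z.1 == N%:Z) || (z.2 == N%:Z) -> N%:R <= nm z :> R.
Proof. by move=> h; apply: zboxPn; rewrite mem_zbox; lia. Qed.

Lemma kw_le a b z : 0 < a -> kw a b z <= (Num.max a (nm z))^-2.
Proof.
move=> a0; rewrite ge_max invr_ge0 exprn_ge0 ?le_max ?(ltW a0) //=.
by rewrite lerBlDr lerDl invr_ge0 exprn_even_ge0.
Qed.

Lemma max0_lip (x y c : R) :
  `|Num.max 0 (x - c) - Num.max 0 (y - c)| <= `|x - y|.
Proof.
have h1 := ler_norm (x - y); have h2 := ler_norm (y - x).
rewrite distrC in h2; rewrite maxC [Num.max 0 (y - c)]maxC !maxEle.
have [?|?] := leP (x - c) 0; have [?|?] := leP (y - c) 0;
  rewrite ler_norml; apply/andP; split; lra.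
Qed.

Lemma kw_lip a b z w : 2 <= a -> nm (z - w) <= 1 :> R ->
  `|kw a b w - kw a b z| <= 10 / Num.max a (nm z) ^+ 3.
Proof.
move=> a2 zw; set x := Num.max a (nm z); set x' := Num.max a (nm w).
have ax : a <= x by rewrite le_max lexx.
have ax' : a <= x' by rewrite le_max lexx.
have h1 : nm w <= nm z + 1 :> R.
  have := nm_triangle R z (w - z); rewrite addrC subrK [nm (w - z)]nmB; move: zw; lra.
have h2 : nm z <= nm w + 1 :> R.
  have := nm_triangle R w (z - w); rewrite addrC subrK; move: zw; lra.
have xx' : x <= x' + 1.
  rewrite ge_max; apply/andP; split; first by move: ax'; lra.
  have : nm w <= x' by rewrite le_max lexx orbT.
  by move: h2; lra.
have x'x : x' <= x + 1.
  rewrite ge_max; apply/andP; split; first by move: ax; lra.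
  have : nm z <= x by rewrite le_max lexx orbT.
  by move: h1; lra.
apply: (@le_trans _ _ `|x'^-2 - x^-2|).
  exact: max0_lip.
have x0 : 0 < x by lra.
have x'0 : 0 < x' by lra.
have -> : x'^-2 - x^-2 = (x - x') * (x + x') / (x ^+ 2 * x' ^+ 2) by field; lra.
rewrite normrM normfV [`|_ ^+ 2 * _|]gtr0_norm ?mulr_gt0 ?exprn_gt0 //.
rewrite ler_pdivrMr ?mulr_gt0 ?exprn_gt0 // mulrAC ler_pdivlMr ?exprn_gt0 //.
apply: (@le_trans _ _ ((x + x') * x ^+ 3)).
  apply: ler_wpM2r; first by rewrite exprn_ge0 // ltW.
  rewrite normrM [`|x + x'|]gtr0_norm ?addr_gt0 //.
  by rewrite ler_piMl //; [lra|rewrite ler_norml; apply/andP; split; lra].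
have -> : 10 * (x ^+ 2 * x' ^+ 2) = x ^+ 2 * (10 * x' ^+ 2) by ring.
have -> : (x + x') * x ^+ 3 = x ^+ 2 * ((x + x') * x) by ring.
rewrite ler_pM2l ?exprn_gt0 //; nra.
Qed.

Lemma kw_scale a b z u : 0 < a -> 0 < b -> u != 0 ->
  kw a b z = nm u ^+ 2 * kw (a * nm u) (b * nm u) (gmul z u).
Proof.
move=> a0 b0 u0; have n0 : 0 < nm u :> R by rewrite nm_gt0.
rewrite /kw nm_mul -maxr_pMl; last exact: ltW.
rewrite maxr_pMr; last by rewrite exprn_ge0 // ltW.
rewrite mulr0 mulrBr.
set x := Num.max a _.
have x0 : 0 < x by rewrite lt_max a0.
by congr (Num.max 0 _); field; lra.
Qed.

(** Raising the inner radius acts only within |z| < a s and by at most a^-2; raising the outer one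
    changes the subtracted constant by at most b^-2. Each disc has about s^2 over its weight many
    points, so the total change is bounded independently of a and b. *)
Lemma kw_change a b s z : 0 < a -> a <= b -> 1 <= s ->
  `|kw (a * s) (b * s) z - kw a b z| <=
  ((nm z < a * s)%R)%:R * a^-2 + ((nm z < b * s)%R)%:R * b^-2.
Proof.
move=> a0 ab s1; have b0 : 0 < b by exact: lt_le_trans ab.
have bs : b <= b * s by rewrite ler_peMr // ltW.
have as_ : a <= a * s by rewrite ler_peMr // ltW.
have [h|h] := ltP (nm z) (b * s); last first.
  have -> : kw (a * s) (b * s) z = 0 by rewrite kw_eq0 //; lra.
  have -> : kw a b z = 0 by rewrite kw_eq0 //; lra.
  by rewrite subrr normr0 addr_ge0 // mulr_ge0 ?ler0n // invr_ge0 exprn_ge0 // ltW.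
set x := Num.max (a * s) (nm z); set x' := Num.max a (nm z).
have h1 : 0 <= x'^-2 - x^-2 <= ((nm z < a * s)%R)%:R * a^-2.
  have [h1|h1] := ltP (nm z) (a * s); last first.
    have -> : x = x' by rewrite /x /x' !(elimT max_idPr) //; lra.
    by rewrite subrr mul0r lexx.
  have x'0 : 0 < x' by rewrite lt_max a0.
  have xx' : x' <= x by rewrite ge_max !le_max as_ lexx orbT.
  have ax' : a <= x' by rewrite le_max lexx.
  have x0 : 0 < x by lra.
  have i1 : x^-2 <= x'^-2 by rewrite inv_sqr_le.
  have i2 : x'^-2 <= a^-2 by rewrite inv_sqr_le.
  have i3 : 0 <= x^-2 by rewrite invr_ge0 exprn_ge0 // ltW.
  by rewrite mul1r; apply/andP; split; move: i1 i2 i3; lra.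
have h2 : 0 <= b^-2 - (b * s)^-2 <= b^-2.
  have i1 : (b * s)^-2 <= b^-2.
    exact: inv_sqr_le.
  have i3 : 0 <= (b * s)^-2 by rewrite invr_ge0 exprn_ge0 //; lra.
  by apply/andP; split; move: i1 i3; lra.
rewrite /kw -/x -/x' mul1r.
move: (x^-2) (x'^-2) ((b * s)^-2) (b^-2) (((nm z < a * s)%R)%:R * a^-2) h1 h2 => p1 p2 p3 p4 p5 /andP[? ?] /andP[? ?].
rewrite ![Num.max 0 _]maxC !maxEle.
have [?|?] := leP (p1 - p3) 0; have [?|?] := leP (p2 - p4) 0;
  rewrite ler_norml; apply/andP; split; lra.
Qed.

(** A unit step changes |z|^-2 by about |z|^-3 and [psi] by l / |z|; since the weight is flat below
    radius a, both are O(1/a) times |z|^-2. The sum over the box is then a logarithm over a, which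
    is small for large a. *)
Lemma kw_variation a b l N psi : (0 < N)%N -> 2 <= a -> 0 <= l -> tame l psi ->
  (forall z, `|psi z| <= 1) ->
  variation N (fun z => kw a b z * psi z) <= (24 + 2 * l) / a * (16 + 24 * lnn R N).
Proof.
move=> N0 a2 l0 tp p1; apply: zsum_le_frames => //.
  by rewrite divr_ge0 //; lra.
have step z w : nm (z - w) <= 1 :> R ->
    `|kw a b w * psi w - kw a b z * psi z| <= (12 + l) / a / Num.max 1 (nm z) ^+ 2.
  move=> zw; set m := Num.max 1 _; have m1 : 1 <= m by rewrite le_max lexx.
  set x := Num.max a (nm z).
  have ax : a <= x by rewrite le_max lexx.
  have mx : m <= x by rewrite ge_max !le_max lexx orbT andbT; apply/orP; left; lra.
  have x0 : 0 < x by lra.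
  have k1 : `|kw a b w - kw a b z| <= 10 / a / m ^+ 2.
    apply: le_trans (kw_lip _ a2 zw) _; rewrite -/x -mulrA ler_pM2l // -invfM.
    rewrite lef_pV2 ?posrE ?exprn_gt0 //; last by rewrite mulr_gt0 ?exprn_gt0 //; lra.
    by rewrite [x ^+ 3]exprS; apply: ler_pM; [lra|exact: sqr_ge0|lra|apply: lerXn2r; rewrite ?nnegrE; lra].
  have k2 : kw a b z <= x^-2 by apply: kw_le; lra.
  have k3 : kw a b z * `|psi w - psi z| <= (2 + l) / a / m ^+ 2.
    apply: (@le_trans _ _ (x^-2 * `|psi w - psi z|)); first by rewrite ler_wpM2r.
    rewrite mulrC ler_pdivrMr ?exprn_gt0 //.
    have -> : (2 + l) / a / m ^+ 2 * x ^+ 2 = (2 + l) * (x / a) * (x / m) / m by field; lra.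
    rewrite ler_pdivlMr; last lra.
    have dm : `|psi w - psi z| * m <= 2 + l.
      have [zm|zm] := leP (nm z : R) 1.
        have -> : m = 1 by apply/max_idPl.
        by rewrite mulr1; apply: le_trans (ler_normB _ _) _; have := p1 w; have := p1 z; lra.
      have -> : m = nm z by apply/max_idPr/ltW.
      rewrite distrC; apply: le_trans (tp z w) _.
      by apply: (@le_trans _ _ l); [rewrite ler_piMr|lra].
    apply: le_trans dm _; rewrite -mulrA ler_peMr //; first lra.
    by rewrite -[1]mulr1 ler_pM ?ler01 // ler_pdivlMr ?mul1r //; lra.
  have -> : kw a b w * psi w - kw a b z * psi z =
    (kw a b w - kw a b z) * psi w + kw a b z * (psi w - psi z) by ring.
  apply: le_trans (ler_normD _ _) _; rewrite !normrM [`|kw a b z|]ger0_norm ?kw_ge0 //.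
  have -> : (12 + l) / a / m ^+ 2 = 10 / a / m ^+ 2 + (2 + l) / a / m ^+ 2 by field; lra.
  by apply: lerD => //; apply: le_trans k1; rewrite ler_piMr.
have e1 z : nm (z - (z.1 + 1, z.2)) = 1 :> R.
  by rewrite /nm (_ : gN _ = 1%N) ?sqrtr1 //; case: z => c d; rewrite /gN -!mulnn /=; lia.
have e2 z : nm (z - (z.1, z.2 + 1)) = 1 :> R.
  by rewrite /nm (_ : gN _ = 1%N) ?sqrtr1 //; case: z => c d; rewrite /gN -!mulnn /=; lia.
move=> z; have := step z (z.1 + 1, z.2); rewrite e1 => /(_ (lexx _)) s1.
have := step z (z.1, z.2 + 1); rewrite e2 => /(_ (lexx _)) s2.
apply: le_trans (lerD s1 s2) _.
by rewrite -!mulrDl; apply: ler_wpM2r; rewrite ?invr_ge0 ?exprn_ge0 ?le_max ?ler01 //;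
  apply: ler_wpM2r; rewrite ?invr_ge0; lra.
Qed.

Lemma kw_mass_le a b N : (0 < N)%N -> 1 <= a ->
  zsum N (kw a b) <= 16 + 24 * lnn R N.
Proof.
move=> N0 a1; rewrite -[leRHS]mul1r; apply: zsum_le_frames => // z.
apply: le_trans (kw_le _ _ _) _; first by lra.
rewrite mul1r; apply: inv_sqr_le; first by rewrite lt_max ltr01.
by rewrite ge_max !le_max lexx orbT andbT a1.
Qed.

(** On the frame next to m + 1 <= M the modulus is at most 2(m+1) and b >= 4(m+1), so the weight is
    at least (1/4 - 1/16)/(m+1)^2 and the frame contributes at least 3/(4(m+1)). *)
Lemma kw_mass_ge (A n M : nat) b : (0 < A)%N -> (A <= n <= M)%N -> 4 * M%:R <= b ->
  3 / 4 * (lnn R n.+1 - lnn R A.+1) <= zsum n (kw A%:R b).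
Proof.
move=> A0 /andP[/subnK <-]; elim: (n - A)%N => [|k IH] nM bM.
  by rewrite add0n subrr mulr0 sumr_ge0 // => z _; apply: kw_ge0.
rewrite addSn in nM *; have {}IH := IH (ltnW nM) bM.
rewrite zsum_frame; set m := (k + A)%N in IH nM *.
have m1 : 1 <= m.+1%:R :> R by rewrite ler1n.
have mM : m.+1%:R <= M%:R :> R by rewrite ler_nat.
have Am : A%:R <= m.+1%:R :> R by rewrite ler_nat /m; lia.
have [_ h] := ln_succ_bounds (ltn0Sn m).
have : (8 * m%:R + 4) * (3 / (16 * m.+1%:R ^+ 2)) <=
    \sum_(z <- zbox m.+1 | z \notin zbox m) kw A%:R b z.
  rewrite -frame_size mulr_suml big_seq_cond [leRHS]big_seq_cond; apply: ler_sum => z /andP[z1 z2].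
  rewrite mul1r /kw; have [_ hz] := frame_nm z1 z2.
  rewrite le_max; apply/orP; right.
  set x := Num.max _ _.
  have x0 : 0 < x by rewrite lt_max ltr0n A0.
  have xm : x <= 2 * m.+1%:R by rewrite ge_max hz andbT; move: Am m1; lra.
  have i1 : (2 * m.+1%:R)^-2 <= x^-2.
    exact: inv_sqr_le.
  have i2 : b^-2 <= (4 * m.+1%:R)^-2.
    have b4 : 4 * m.+1%:R <= b by move: mM bM; lra.
    by apply: inv_sqr_le; rewrite ?mulr_gt0 ?ltr0n.
  have -> : 3 / (16 * m.+1%:R ^+ 2) = (2 * m.+1%:R)^-2 - (4 * m.+1%:R)^-2 :> R by field; lra.
  exact: lerB.
have : 3 / 4 * m.+1%:R^-1 <= (8 * m%:R + 4) * (3 / (16 * m.+1%:R ^+ 2)) :> R.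
  have -> : 8 * m%:R + 4 = 8 * m.+1%:R - 4 :> R by rewrite -[m.+1%:R]natr1; ring.
  rewrite mulrA ler_pdivlMr ?mulr_gt0 ?exprn_gt0 ?ltr0n //.
  have -> : 3 / 4 * m.+1%:R^-1 * (16 * m.+1%:R ^+ 2) = 12 * m.+1%:R :> R by field; lra.
  by lra.
move=> k1 k2; move: (le_trans k1 k2) IH h.
by move: (m.+1%:R^-1 : R) => u; lra.
Qed.

(** Because |pi|^2 = p, the radial weight at a prime is comparable to its harmonic weight 1/p. *)
Lemma kw_prime a b p : sp p -> a ^+ 2 <= p%:R -> 2 * p%:R <= b ^+ 2 -> 0 < a ->
  (2 * p%:R)^-1 <= kw a b (gpr p).
Proof.
move=> spp ap pb a0; have p5 : 5 <= p%:R :> R by rewrite ler_nat sp_ge5.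
have -> : kw a b (gpr p) = Num.max 0 (p%:R^-1 - b^-2).
  rewrite /kw; congr (Num.max 0 (_ - _)); rewrite -[in RHS](gprN spp) -nm_sqr.
  have -> // : Num.max a (nm (gpr p)) = nm (gpr p).
  apply/max_idPr; rewrite -(ler_pXn2r (n := 2)) ?nnegrE ?nm_ge0 ?(ltW a0) // nm_sqr gprN //.
rewrite le_max; apply/orP; right.
have : b^-2 <= (2 * p%:R)^-1 by rewrite lef_pV2 ?posrE //; lra.
have -> : p%:R^-1 = (2 * p%:R)^-1 + (2 * p%:R)^-1 :> R by field; lra.
by lra.
Qed.

End radial_weights.

(** * Construction of one scale from a large parameter *)

Section scale_existence.
Variables (R : realType) (y : nat).
Hypothesis y_large : 24 <= lnn R y.
Implicit Types (l : R) (psi : gint -> R).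

Notation Y := (y%:R : R).
Notation lY := (lnn R y).
(** The primes of the scale lie between y^100 and y^400, so their Gaussian primes have moduli
    between y^50 and y^200, the range of the weight; the 4 in [N] meets the hypothesis of
    [kw_mass_ge]. Sieving by primes up to y at level y^5 costs a factor of order y^20 times the
    variation, which the inner radius y^50 more than compensates. *)
Let A := (y ^ 50)%N.
Let N := (4 * y ^ 200)%N.
Notation a := (A%:R : R).
Notation b := (N%:R : R).
Notation k := (kw a b).
Let s := [seq p <- index_iota (y ^ 100).+1 ((y ^ 100) ^ 4).+1 | sp p].
Let mass := zsum N k.

Let y0 : (0 < y)%N.
Proof. by case: y y_large => // ; rewrite /lnn ln0 //; lra. Qed.

Let Y1 : 1 <= Y. Proof. by rewrite ler1n. Qed.

Let lYY : lY <= Y.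
Proof. by apply: le_trans (ln_sub1 _) _; rewrite ?ltr0n //; lra. Qed.

Let a_gt : Y ^+ 49 <= a / Y /\ 2 <= a.
Proof.
have Y0 : 0 < Y by rewrite ltr0n.
rewrite /A natrX; split; first by rewrite [_ ^+ 50]exprSr mulfK ?gt_eqF.
have h := y_large; apply: (@le_trans _ _ (Y ^+ 1)); first by rewrite expr1; move: lYY; lra.
by rewrite ler_weXn2l.
Qed.

Let N0 : (0 < N)%N. Proof. by rewrite muln_gt0 expn_gt0 y0. Qed.
Let A0 : (0 < A)%N. Proof. by rewrite expn_gt0 y0. Qed.

Let lnN : lnn R N <= 201 * lY.
Proof.
rewrite /N lnnM ?expn_gt0 ?y0 // lnnX // (lnnX R (m := 2) 2) //.
by have := lnn2_le R; have := y_large; lra.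
Qed.

Let mass_le : mass <= (50 * 100) * lY.
Proof.
apply: le_trans (kw_mass_le b N0 _) _; first by have [_] := a_gt; lra.
by have := y_large; move: lnN; lra.
Qed.

Let mass_ge : lY <= mass.
Proof.
apply: (@le_trans _ _ (zsum (y ^ 200) k)); last first.
  by apply: zsum_mono => [|z]; [rewrite /N leq_pmull|exact: kw_ge0].
apply: le_trans (kw_mass_ge (M := y ^ 200) A0 _ _); last first.
- by rewrite /N natrM.
- by rewrite leqnn andbT /A leq_exp2l // -(ltr_nat R); have := y_large; move: lYY; lra.
have h1 : 200 * lY <= lnn R (y ^ 200).+1.
  by rewrite -lnnX // ler_lnn ?expn_gt0 ?y0.
have h2 : lnn R A.+1 <= 51 * lY.
  rewrite -lnnX // ler_lnn // /A.
  have y2 : (2 <= y)%N by rewrite -(ler_nat R); have := y_large; move: lYY; lra.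
  by rewrite ltn_exp2l.
by have := y_large; lra.
Qed.

Let s_sp p : p \in s -> [/\ sp p, a ^+ 2 <= p%:R, 2 * p%:R <= b ^+ 2 & (y ^ 100 < p)%N].
Proof.
rewrite mem_filter mem_index_iota ltnS => /and3P[-> h1 h2]; split => //.
- by rewrite -natrX ler_nat /A -expnM; exact: ltnW.
- rewrite -natrX -natrM ler_nat /N expnMn -!expnM; rewrite -expnM in h2.
  have e : (100 * 4 = 200 * 2)%N by [].
  by rewrite e in h2; apply: leq_mul.
Qed.

Let V := sieve_V R y (y ^ 5).
Let V_ge : lY * expR (- 48) / 2 <= V.
Proof.
apply: sieve_V_ge; first by rewrite -(ler_nat R); have := y_large; move: lYY; lra.
by rewrite lnnX //; have := y_large; lra.
Qed.

Let e := expR (- 48) : R.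
Let e0 : 0 < e. Proof. exact: expR_gt0. Qed.

Let eV : e <= V.
Proof.
apply: le_trans V_ge; rewrite -/e mulrAC ler_peMl ?ltW //; have := y_large; lra.
Qed.

Lemma scale_sieve l psi : 0 <= l -> tame l psi -> (forall z, 0 <= psi z <= 1) ->
  \sum_(p <- s) k (gpr p) * psi (gpr p) <=
  zsum N (fun z => k z * psi z) / V + (8 * (50 * 100)) * (24 + 2 * l) / (Y * e ^+ 2).
Proof.
move=> l0 tp p01.
have Y0 : 0 < Y by rewrite ltr0n.
have V0 : 0 < V by exact: lt_le_trans eV.
have p1 z : `|psi z| <= 1 by have /andP[h1 h2] := p01 z; rewrite ger0_norm.
have f0 z : 0 <= k z * psi z by have /andP[h1 h2] := p01 z; rewrite mulr_ge0 // kw_ge0.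
have fB z : (z.1 == N%:Z) || (z.2 == N%:Z) -> k z * psi z = 0.
  by move=> /(zbox_edge R) h; rewrite kw_eq0 ?mul0r // ltr0n.
have hs : {in s, forall p, [&& sp p, (y < p)%N & gpr p \in zbox N]}.
  move=> p /s_sp[spp _ pb yp]; rewrite spp /=; apply/andP; split.
    by apply: leq_ltn_trans yp; rewrite -{1}[y]expn1 leq_pexp2l.
  apply: contraTT isT => /(zboxPn R); rewrite -(ler_pXn2r (n := 2)) ?nnegrE ?nm_ge0 ?ler0n //.
  rewrite nm_sqr gprN //; have := sp_ge5 spp; rewrite -(ler_nat R); lra.
have us : uniq s by rewrite filter_uniq // iota_uniq.
apply: le_trans (sieve_primes (Rb := y ^ 5) f0 V0 fB us hs) _; rewrite lerD2l -/V.
set va := variation _ _.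
have va_le : va <= (24 + 2 * l) / a * ((50 * 100) * Y).
  apply: le_trans (kw_variation _ N0 _ l0 tp p1) _; first by have [] := a_gt.
  apply: ler_wpM2l; first by rewrite divr_ge0 ?ler0n //; lra.
  by have := y_large; move: lnN lYY; lra.
have va0 : 0 <= va by apply: sumr_ge0 => z _; rewrite addr_ge0.
have T0 : 0 <= 24 + 2 * l by lra.
apply: (@le_trans _ _ (4 * Y ^+ 10 * (2 * Y ^+ 10 * ((24 + 2 * l) / a * ((50 * 100) * Y))) / e ^+ 2)).
  apply: ler_pM; rewrite ?mulr_ge0 ?invr_ge0 ?sqr_ge0 ?ler0n //; last first.
    by apply: inv_sqr_le.
  apply: ler_pM; rewrite ?mulr_ge0 ?ler0n //.
    have h : (y ^ 5).+1%:R <= 2 * Y ^+ 5 :> R.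
      have : 1 <= Y ^+ 5 by rewrite exprn_ege1.
      by rewrite -[(y ^ 5).+1%:R]natr1 natrX; lra.
    rewrite natrX (_ : 4 * Y ^+ 10 = (2 * Y ^+ 5) ^+ 2); last by ring.
    by apply: lerXn2r; rewrite ?nnegrE ?ler0n // mulr_ge0 ?exprn_ge0 ?ler0n.
  by apply: ler_pM; rewrite ?mulr_ge0 ?ler0n // !natrX -exprM.
have a0 : 0 < a by rewrite ltr0n.
have [aY _] := a_gt.
rewrite [leRHS](_ : _ = (8 * (50 * 100)) * (24 + 2 * l) / Y / e ^+ 2); last by rewrite invfM [LHS]mulrA.
rewrite ler_pM2r ?invr_gt0 ?exprn_gt0 // ler_pdivlMr //.
have -> : 4 * Y ^+ 10 * (2 * Y ^+ 10 * ((24 + 2 * l) / a * ((50 * 100) * Y))) * Y =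
  (8 * (50 * 100)) * (24 + 2 * l) * (Y ^+ 21 / (a / Y)) by field; lra.
have c0 : 0 <= (8 * (50 * 100)) * (24 + 2 * l) by move: T0; lra.
have aY0 : 0 < a / Y by rewrite divr_gt0.
move: c0; move: ((8 * (50 * 100)) * (24 + 2 * l)) => c c0.
rewrite ler_piMr // ler_pdivrMr // mul1r; apply: le_trans aY.
by rewrite ler_weXn2l.
Qed.

Lemma count_disc (r : R) n M : r <= n%:R ->
  zsum M (fun z => ((nm z < r)%R)%:R) <= 4 * n%:R ^+ 2 :> R.
Proof.
move=> rn; apply: (@le_trans _ _ (zsum (maxn M n) (fun z => ((nm z < r)%R)%:R))).
  by apply: zsum_mono => [|z]; rewrite ?leq_maxl // ler0n.
rewrite (zsum_supp (N := n)); last 2 first.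
- move=> z /(zboxPn R) h; rewrite ltNge (le_trans rn) //; apply: le_trans h.
  by rewrite ler_nat leq_maxr.
- by move=> z /(zboxPn R) h; rewrite ltNge (le_trans rn).
rewrite -[leRHS]mulr1 -zsum_cst; apply: ler_sum => z _; rewrite lern1.
by case: (_ < _).
Qed.

Let cubic_bound (Q T t : R) : 0 <= Q -> Q <= (t + 1) ^+ 2 -> 0 <= t -> 1 <= T ->
  2 * Q * (T * ((50 * 100) * (t + 1))) + 8 * Q <= 2 * (51 * 100) * (t + 1) ^+ 3 * T.
Proof.
move=> Q0 Qt t0 T1.
have -> : 2 * Q * (T * ((50 * 100) * (t + 1))) + 8 * Q =
  Q * (2 * (50 * 100) * (T * (t + 1)) + 8) by ring.
have -> : 2 * (51 * 100) * (t + 1) ^+ 3 * T =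
  (t + 1) ^+ 2 * (2 * (51 * 100) * (T * (t + 1))) by ring.
have c1 : 1 <= T * (t + 1) by rewrite -[1]mulr1; apply: ler_pM; lra.
move: c1; move: (T * (t + 1)) => c c1.
apply: ler_pM; [exact: Q0|lra|exact: Qt|lra].
Qed.

(** With u = [gpr q], the substitution w = z u turns the first sum into q times a sum over the
    multiples of u with both radii multiplied by |u|. Being a multiple of u is a q-periodic event of
    mean 1/q, which cancels the q; restoring the radii costs 8 q^2. The bound is independent of y,
    whereas the mass is at least ln y. *)
Lemma scale_invariance l psi q S : 0 <= l -> tame l psi -> (forall z, `|psi z| <= 1) ->
  sp q -> (q <= S)%N ->
  `|zsum N (fun z => k z * psi (gmul z (gpr q))) - zsum N (fun z => k z * psi z)| <=
  2 * (51 * 100) * (S%:R + 1) ^+ 3 * (24 + 2 * l).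
Proof.
move=> l0 tp p1 spq qS.
have T1 : 1 <= 24 + 2 * l by lra.
have T0 : 0 < 24 + 2 * l by lra.
have S0 : 0 <= S%:R :> R by rewrite ler0n.
have c0 : 0 <= (24 + 2 * l) * ((50 * 100) * (S%:R + 1)).
  by apply: mulr_ge0; [exact: ltW|move: S0; lra].
have q5 := sp_ge5 spq; have q0 : (0 < q)%N by apply: leq_trans q5.
have q1 : 1 <= q%:R :> R by rewrite ler1n.
set u := gpr q; have un : nm u ^+ 2 = q%:R :> R by rewrite nm_sqr gprN.
have u0 : u != 0 by apply: gpr_neq0.
have s0 : 0 < nm u :> R by rewrite nm_gt0.
set t := nm u : R in un s0 *.
have t1 : 1 <= t by rewrite -(ler_pXn2r (n := 2)) ?nnegrE ?ler01 ?(ltW s0) // un expr1n.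
have tq : t <= q%:R by rewrite -un expr2 ler_peMr // (ltW s0).
have [_ a2] := a_gt; have a0 : 0 < a by rewrite ltr0n.
have b0 : 0 < b by rewrite ltr0n.
have ab : a <= b.
  rewrite ler_nat /A /N (@leq_trans (y ^ 200)) ?leq_pmull //.
  by rewrite leq_pexp2l.
pose k' := kw (a * t) (b * t).
pose N' := (N * q)%N.
have N'0 : (0 < N')%N by rewrite muln_gt0 N0.
have bt0 : 0 < b * t by rewrite mulr_gt0.
have btN' : b * t <= N'%:R by rewrite (natrM _ N q) ler_pM2l.
have bN' : b <= N'%:R by rewrite ler_nat leq_pmulr.
have e1 : zsum N (fun z => k z * psi (gmul z u)) =
    q%:R * zsum N' (fun w => k' w * psi w * (gdvd u w)%:R).
  rewrite -zsumZ -/N'.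
  transitivity (\sum_(w <- map (fun z => gmul z u) (zbox N)) q%:R * (k' w * psi w * (gdvd u w)%:R)).
    rewrite big_map; apply: eq_bigr => z _; rewrite (kw_scale z a0 b0 u0) un.
    have -> : gdvd u (gmul z u) by apply/gdvdP => //; exists z; rewrite gmulC.
    by rewrite -/(k' _) mulr1 mulrA.
  apply: sum_supp.
  - rewrite map_inj_uniq ?zbox_uniq // => z z'; rewrite ![gmul _ u]gmulC; exact: gmul_inj.
  - exact: zbox_uniq.
  - move=> w _ /(zboxPn R) h; rewrite /k' kw_eq0 ?mul0r ?mulr0 //; exact: le_trans h.
  - move=> w _ wn; case: (boolP (gdvd u w)) => [/gdvdP [//|z wz]|_]; last by rewrite !mulr0.
    rewrite /k' kw_eq0 ?mul0r ?mulr0 //.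
    have : z \notin zbox N.
      by apply: contra wn => zN; apply/mapP; exists z => //; rewrite gmulC.
    by move=> /(zboxPn R) h; rewrite wz nm_mul mulrC -/t; apply: ler_wpM2l; rewrite ?(ltW s0).
have e2 : `|zsum N' (fun w => k' w * psi w * (gdvd u w)%:R) -
    q%:R^-1 * zsum N' (fun w => k' w * psi w)| <=
    2 * q%:R * variation N' (fun w => k' w * psi w).
  rewrite -(pmean_gdvd R spq); apply: zsum_periodic => //.
  - exact: periodic_gdvd.
  - by move=> z; case: (gdvd _ _); rewrite ?normr1 ?normr0.
  - by move=> z /(zbox_edge R) h; rewrite /k' kw_eq0 ?mul0r //; exact: le_trans h.
have va : variation N' (fun w => k' w * psi w) <= (24 + 2 * l) / a * ((50 * 100) * Y * (S%:R + 1)).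
  have at2 : 2 <= a * t by rewrite (le_trans a2) // ler_peMr // ltW.
  apply: le_trans (kw_variation _ N'0 at2 l0 tp p1) _.
  have lnN' : lnn R N' <= 201 * Y + S%:R.
    rewrite lnnM //; have : lnn R q <= S%:R.
      apply: le_trans (ln_sub1 _) _; rewrite ?ltr0n //.
      by have : q%:R <= S%:R :> R; [rewrite ler_nat|lra].
    by move: lnN lYY; lra.
  have at0 : 0 < a * t by apply: mulr_gt0.
  apply: ler_pM.
  - by apply: divr_ge0; exact: ltW.
  - by have := lnn_ge0 R N'; lra.
  - apply: ler_wpM2l; first exact: ltW.
    by rewrite lef_pV2 ?posrE // ler_peMr // ltW.
  - have YS : 0 <= (Y - 1) * S%:R by rewrite mulr_ge0 // subr_ge0.
    have -> : (50 * 100) * Y * (S%:R + 1) = (50 * 100) * ((Y - 1) * S%:R) + (50 * 100) * S%:R + (50 * 100) * Y by ring.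
    by have := y_large; move: lnN' lYY YS S0; lra.
have e3 : `|zsum N' (fun w => k' w * psi w) - zsum N' (fun w => k w * psi w)| <= 8 * q%:R ^+ 2.
  rewrite -zsumB; apply: le_trans (ler_norm_sum _ _ _) _.
  apply: (@le_trans _ _ (zsum N' (fun z => a^-2 * ((nm z < a * t)%R)%:R + b^-2 * ((nm z < b * t)%R)%:R))).
    apply: ler_sum => z _; rewrite -mulrBl normrM.
    apply: le_trans (ler_piMr (normr_ge0 _) (p1 z)) _.
    by rewrite mulrC [b^-2 * _]mulrC; apply: kw_change.
  rewrite zsumD !zsumZ.
  have h1 : zsum N' (fun z => ((nm z < a * t)%R)%:R) <= 4 * (A * q)%N%:R ^+ 2 :> R.
    by apply: count_disc; rewrite (natrM _ A q) ler_pM2l.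
  have h2 : zsum N' (fun z => ((nm z < b * t)%R)%:R) <= 4 * N'%:R ^+ 2 :> R by apply: count_disc.
  have i1 : a^-2 * zsum N' (fun z => ((nm z < a * t)%R)%:R) <= 4 * q%:R ^+ 2.
    rewrite ler_pdivrMl ?exprn_gt0 //; apply: le_trans h1 _.
    by rewrite (natrM _ A q) le_eqVlt; apply/orP; left; apply/eqP; ring.
  have i2 : b^-2 * zsum N' (fun z => ((nm z < b * t)%R)%:R) <= 4 * q%:R ^+ 2.
    rewrite ler_pdivrMl ?exprn_gt0 //; apply: le_trans h2 _.
    by rewrite (natrM _ N q) le_eqVlt; apply/orP; left; apply/eqP; ring.
  by lra.
have e4 : zsum N' (fun w => k w * psi w) = zsum N (fun w => k w * psi w).
  apply: zsum_supp => z /(zboxPn R) h; rewrite kw_eq0 ?mul0r //; exact: le_trans h.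
rewrite e1 -e4.
set P1 := zsum N' _ in e2 *; set P2 := zsum N' (fun w => k' w * psi w) in e2 e3 *.
set P3 := zsum N' _ in e3 *.
have qS' : q%:R <= S%:R + 1 :> R by rewrite natr1 ler_nat ltnW.
have q2S : q%:R ^+ 2 <= (S%:R + 1) ^+ 2 :> R by rewrite lerXn2r ?nnegrE ?ler0n //; lra.
have f1 : `|q%:R * P1 - P2| <= 2 * q%:R ^+ 2 * ((24 + 2 * l) / a * ((50 * 100) * Y * (S%:R + 1))).
  have -> : q%:R * P1 - P2 = q%:R * (P1 - q%:R^-1 * P2).
    by rewrite mulrBr mulVKf // pnatr_eq0 -lt0n.
  rewrite normrM ger0_norm ?ler0n //.
  have -> : 2 * q%:R ^+ 2 * ((24 + 2 * l) / a * ((50 * 100) * Y * (S%:R + 1))) =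
    q%:R * (2 * q%:R * ((24 + 2 * l) / a * ((50 * 100) * Y * (S%:R + 1)))) by ring.
  apply: ler_wpM2l; first lra.
  by apply: le_trans e2 _; apply: ler_wpM2l va; rewrite mulr_ge0.
have f2 : (24 + 2 * l) / a * ((50 * 100) * Y * (S%:R + 1)) <= (24 + 2 * l) * ((50 * 100) * (S%:R + 1)).
  have -> : (24 + 2 * l) / a * ((50 * 100) * Y * (S%:R + 1)) = (24 + 2 * l) * ((50 * 100) * (S%:R + 1)) / (a / Y).
    by field; rewrite !gt_eqF // ltr0n.
  have [aY _] := a_gt.
  have aY1 : 1 <= a / Y by apply: le_trans aY; rewrite exprn_ege1.
  move: c0; move: ((24 + 2 * l) * ((50 * 100) * (S%:R + 1))) => c c0.
  by rewrite ler_pdivrMr ?(lt_le_trans ltr01 aY1) // ler_peMr.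
have f3 : `|q%:R * P1 - P3| <= 2 * q%:R ^+ 2 * ((24 + 2 * l) * ((50 * 100) * (S%:R + 1))) + 8 * q%:R ^+ 2.
  have -> : q%:R * P1 - P3 = (q%:R * P1 - P2) + (P2 - P3) by ring.
  apply: le_trans (ler_normD _ _) _; apply: lerD => //.
  by apply: le_trans f1 _; apply: ler_wpM2l f2; rewrite mulr_ge0 ?sqr_ge0.
apply: le_trans f3 _; apply: cubic_bound => //; exact: sqr_ge0.
Qed.

Lemma scale_of_large l d S : 0 < l -> 0 < d -> S%:R <= lY ->
  16 * (8 * (50 * 100)) * (24 + 2 * l) / (d * e ^+ 2) <= lY ->
  2 * (51 * 100) * (S%:R + 1) ^+ 3 * (24 + 2 * l) / d <= lY ->
  is_scale 8^-1 (32 * (50 * 100) / e) l d S s.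
Proof.
move=> l0 d0 SY h1 h2.
have Y0 : 0 < Y by rewrite ltr0n.
have lY0 : 0 < lY by have := y_large; lra.
have mass0 : 0 < mass by apply: lt_le_trans mass_ge.
have V0 : 0 < V by exact: lt_le_trans eV.
have L8 : 8^-1 <= inv_mass R s.
  rewrite /inv_mass /s big_filter; apply: split_mass; first by rewrite expn_gt0 y0.
  by rewrite lnnX //; have := y_large; lra.
have L0 : 0 < inv_mass R s by apply: lt_le_trans L8.
have wavE f : wav (zbox N) (fun z => k z / mass) f = zsum N (fun z => k z * f z) / mass.
  by rewrite /wav /zsum mulr_suml; apply: eq_bigr => z _; ring.
split => //.
- by rewrite filter_uniq // iota_uniq.
- move=> p /s_sp[spp _ _ yp]; rewrite spp /=; apply: leq_ltn_trans yp.
  apply: (@leq_trans y); first by rewrite -(ler_nat R); move: lYY; lra.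
  by rewrite -{1}[y]expn1 leq_pexp2l.
exists (zbox N), (fun z => k z / mass); split.
- by move=> z; rewrite divr_ge0 ?kw_ge0 ?ltW.
- rewrite wavE (_ : zsum _ _ = mass) ?mulfV ?gt_eqF //.
  by apply: eq_bigr => z _; rewrite mulr1.
- move=> psi tp p01; rewrite wavE; set W := zsum N _.
  have W0 : 0 <= W.
    by apply: sumr_ge0 => z _; rewrite mulr_ge0 ?kw_ge0 //; case/andP: (p01 z).
  have := scale_sieve (ltW l0) tp p01; rewrite -/W => hs.
  have g1 : \sum_(p <- s) p%:R^-1 * psi (gpr p) <= 2 * \sum_(p <- s) k (gpr p) * psi (gpr p).
    rewrite mulr_sumr big_seq [leRHS]big_seq; apply: ler_sum => p ps.
    have [spp pa pb _] := s_sp ps; have /andP[p0 _] := p01 (gpr p).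
    rewrite mulrA; apply: ler_wpM2r => //.
    have := kw_prime spp pa pb; rewrite ltr0n A0 => /(_ isT).
    have p5 : 0 < p%:R :> R by rewrite ltr0n (leq_trans _ (sp_ge5 spp)).
    by rewrite invfM; lra.
  have g2 : wav s (pwt R s) (psi \o gpr) <= 8 * (2 * (W / V + (8 * (50 * 100)) * (24 + 2 * l) / (Y * e ^+ 2))).
    rewrite pwtE; apply: ler_pM.
    + by rewrite invr_ge0 ltW.
    + apply: sumr_ge0 => p _; rewrite mulr_ge0 ?invr_ge0 ?ler0n //=.
      by case/andP: (p01 (gpr p)).
    + by rewrite -[8]invrK lef_pV2 ?posrE.
    + by apply: le_trans g1 _; rewrite ler_pM2l.
  apply: le_trans g2 _.
  have g3 : 16 * (8 * (50 * 100)) * (24 + 2 * l) / (Y * e ^+ 2) <= d.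
    have Ye : 0 < Y * e ^+ 2 by rewrite mulr_gt0 ?exprn_gt0.
    rewrite ler_pdivrMr //; move: h1; rewrite ler_pdivrMr ?mulr_gt0 ?exprn_gt0 // => h1.
    apply: le_trans h1 _.
    have -> : d * (Y * e ^+ 2) = Y * (d * e ^+ 2) by ring.
    apply: ler_wpM2r lYY; apply: mulr_ge0; [exact: ltW|exact: sqr_ge0].
  (* The factor 16 is the inverse of the mass 1/8 times the 2 of [kw_prime]. The sieve saves V >= e
     ln y / 2 and the mass is at most 5000 ln y, so the logarithms cancel and the constant does not
     depend on y. *)
  have g4 : 16 * (W / V) <= 32 * (50 * 100) / e * (W / mass).
    have -> : 16 * (W / V) = W * (16 / V) by ring.
    have -> : 32 * (50 * 100) / e * (W / mass) = W * (32 * (50 * 100) / (e * mass)) by field; rewrite !gt_eqF.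
    apply: ler_wpM2l => //; rewrite ler_pdivrMr // mulrAC ler_pdivlMr ?mulr_gt0 //.
    have : e * mass <= 2 * (50 * 100) * V.
      apply: (@le_trans _ _ (e * ((50 * 100) * lY))); first by rewrite ler_pM2l.
      by move: V_ge; rewrite -/e; lra.
    by lra.
  have -> : 8 * (2 * (W / V + (8 * (50 * 100)) * (24 + 2 * l) / (Y * e ^+ 2))) =
    16 * (W / V) + 16 * (8 * (50 * 100)) * (24 + 2 * l) / (Y * e ^+ 2) by ring.
  exact: lerD.
- move=> q psi spq qS tp p1; rewrite !wavE -mulrBl normrM normfV [`|mass|]gtr0_norm //.
  rewrite ler_pdivrMr //; apply: le_trans (scale_invariance (ltW l0) tp p1 spq qS) _.
  move: h2; rewrite ler_pdivrMr // => h2; apply: le_trans h2 _.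
  by rewrite mulrC ler_pM2l.
Qed.

End scale_existence.

Lemma scale_exists (R : realType) (l d : R) S : 0 < l -> 0 < d ->
  exists s, is_scale 8^-1 (32 * (50 * 100) / expR (- 48)) l d S s.
Proof.
move=> l0 d0; set X1 := 16 * (8 * (50 * 100)) * (24 + 2 * l) / (d * expR (- 48) ^+ 2).
set X2 := 2 * (51 * 100) * (S%:R + 1) ^+ 3 * (24 + 2 * l) / d.
have X10 : 0 <= X1 by rewrite divr_ge0 ?mulr_ge0 ?sqr_ge0 ?(ltW d0) //; lra.
have X20 : 0 <= X2.
  by rewrite divr_ge0 ?(ltW d0) // mulr_ge0 ?exprn_ge0 ?addr_ge0 ?mulr_ge0 ?ler0n //; lra.
have S0 : 0 <= S%:R :> R by rewrite ler0n.
pose X := 24 + S%:R + X1 + X2.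
have [y hy] : exists y : nat, X <= lnn R y.
  exists (Num.truncn (expR X)).+1; rewrite /lnn -{1}[X]expRK ler_ln ?posrE ?expR_gt0 ?ltr0n //.
  by rewrite ltW // truncnS_gt.
exists ([seq p <- index_iota (y ^ 100).+1 ((y ^ 100) ^ 4).+1 | sp p]).
by apply: scale_of_large => //; move: hy; rewrite /X -/X1 -/X2; lra.
Qed.

(** * Limits along ultrafilters *)

Section ultralimit.
Variables (R : realType) (U : set_system nat).
Hypotheses (UU : UltraFilter U) (Uoo : \oo `<=` U).
Implicit Types u v : nat -> R.

Definition bounded_seq u := exists C : R, forall n, `|u n| <= C.

Definition ultralim u : R := lim (u @ U).

#[local] Instance ultra_proper_instance : ProperFilter U := @ultra_proper _ _ UU.

(** By compactness of [-C, C] the image filter has a cluster point, and a cluster point of an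
    ultrafilter is a limit. *)
Lemma ultralim_cvg u : bounded_seq u -> u @ U --> ultralim u.
Proof.
move=> [C uC]; suff [l ul] : exists l : R, u @ U --> l.
  by rewrite /ultralim (cvg_lim _ ul).
have im : (u @ U) `[- C, C]%classic.
  apply: (@filterS _ U _ setT) => [n _ /=|]; last exact: filterT.
  by rewrite in_itv /= -ler_norml.
have [p [_ pc]] := @segment_compact R (- C) C (u @ U) _ im.
exists p => B pB.
have [//|nB] := in_ultra_setVsetC (u @^-1` B) UU.
have [x [nx Bx]] : (~` B) `&` B !=set0 by apply: pc.
by case: nx.
Qed.

Lemma ultralim_eq u l : u @ \oo --> l -> ultralim u = l.
Proof.
move=> ul; apply: cvg_lim; first exact: Rhausdorff.
by move=> B /ul; apply: Uoo.
Qed.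

Lemma bounded_seqD u v : bounded_seq u -> bounded_seq v -> bounded_seq (fun n => u n + v n).
Proof.
by move=> [C uC] [D vD]; exists (C + D) => n; apply: le_trans (ler_normD _ _) _; apply: lerD.
Qed.

Lemma bounded_seqZ c u : bounded_seq u -> bounded_seq (fun n => c * u n).
Proof. by move=> [C uC]; exists (`|c| * C) => n; rewrite normrM ler_wpM2l. Qed.

Lemma ultralimD u v : bounded_seq u -> bounded_seq v ->
  ultralim (fun n => u n + v n) = ultralim u + ultralim v.
Proof.
move=> bu bv; apply: cvg_lim; first exact: Rhausdorff.
by apply: cvgD; apply: ultralim_cvg.
Qed.

Lemma ultralimZ c u : bounded_seq u -> ultralim (fun n => c * u n) = c * ultralim u.
Proof.
move=> bu; apply: cvg_lim; first exact: Rhausdorff.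
by apply: cvgMr; apply: ultralim_cvg.
Qed.

Lemma ultralim_le u v n0 : bounded_seq u -> bounded_seq v ->
  (forall n, (n0 <= n)%N -> u n <= v n) -> ultralim u <= ultralim v.
Proof.
move=> bu bv uv; apply: ler_cvg_to (ultralim_cvg bu) (ultralim_cvg bv) _.
by apply: Uoo; exists n0 => // n /= /uv.
Qed.

Lemma ultralim_norm_le u n0 C : bounded_seq u ->
  (forall n, (n0 <= n)%N -> `|u n| <= C) -> `|ultralim u| <= C.
Proof.
move=> bu uC; rewrite ler_norml; apply/andP; split.
  rewrite -(@ultralim_eq (fun=> - C) (- C)); last exact: cvg_cst.
  apply: (@ultralim_le _ _ n0) => //; first by exists `|- C|.
  by move=> n /uC; rewrite ler_norml => /andP[].
rewrite -(@ultralim_eq (fun=> C) C); last exact: cvg_cst.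
apply: (@ultralim_le _ _ n0) => //; first by exists `|C|.
by move=> n /uC; rewrite ler_norml => /andP[].
Qed.

End ultralimit.

(** If convergence failed, the indices far from l would meet every neighbourhood of infinity; an
    ultrafilter containing all of these sets would have a limit other than l. *)
Lemma cvg_of_ultralim (R : realType) (u : nat -> R) l : bounded_seq u ->
  (forall U, UltraFilter U -> \oo `<=` U -> ultralim U u = l) -> u @ \oo --> l.
Proof.
move=> bu h; apply/cvgrPdist_lt => e e0.
apply: contrapT => ne.
pose B := [set n | ~ `|l - u n| < e].
have pB : ProperFilter (within B \oo).
  apply: Build_ProperFilter_ex => A wA; apply: contrapT => A0; apply: ne.
  rewrite /within /= in wA; apply: filterS wA => n nA.
  by apply: contrapT => nB; apply: A0; exists n; apply: nA.
have [U [UU BU]] := ultraFilterLemma pB.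
have Uoo : \oo `<=` U by move=> A nA; apply: BU; apply: filterS nA => n An _.
have UB : U B by apply: BU; exists 0%N.
have := ultralim_cvg UU bu; rewrite (h U UU Uoo) => /cvgrPdist_lt /(_ e e0) Ue.
have [n [nB ne2]] := @filter_ex _ _ (@ultra_proper _ _ UU) (B `&` _) (filterI UB Ue).
exact: nB.
Qed.

(** * Averages over boxes *)

Lemma gmul0l z : gmul 0 z = 0.
Proof. by rewrite /gmul /= !mul0r. Qed.

Lemma Omega_sum n N : (0 < n <= N)%N -> Omega n = (\sum_(0 <= q < N.+1) logn q n)%N.
Proof.
move=> /andP[n0 nN]; rewrite /Omega [RHS](bigID (mem (primes n))) /= [X in (_ + X)%N]big1 ?addn0; last first.
  by move=> q; rewrite -logn_gt0 lt0n negbK => /eqP.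
rewrite -[RHS]big_filter; apply: perm_big; apply: uniq_perm.
- exact: primes_uniq.
- by rewrite filter_uniq // iota_uniq.
- move=> q; rewrite mem_filter mem_index_iota /=; case qn : (q \in primes n) => //=.
  by move: qn; rewrite mem_primes => /and3P[_ _ /dvdn_leq]; rewrite ltnS => /(_ n0) h; rewrite (leq_trans h).
Qed.

Lemma Omega_mul_prime p n : prime p -> (0 < n)%N -> Omega (p * n) = (Omega n).+1.
Proof.
move=> pp n0; have p0 := prime_gt0 pp.
have np : (0 < n <= p * n)%N by rewrite n0 leq_pmull.
have ppn : (0 < p <= p * n)%N by rewrite p0 leq_pmulr.
have pnn : (0 < p * n <= p * n)%N by rewrite muln_gt0 p0 n0 leqnn.
rewrite (Omega_sum pnn) (Omega_sum np).
under eq_bigr do rewrite lognM //.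
rewrite big_split /= -(Omega_sum ppn) /Omega primes_prime // big_seq1.
by rewrite logn_prime // eqxx.
Qed.

(** * Averages with a Lipschitz cutoff *)

Section bump_averages.
Variables (R : realType) (j : nat).
Implicit Types (z w : gint) (f g h : gint -> R).

(** A trapezoid approximating the indicator of the unit interval, with slopes j at both ends. An
    indicator would not make the averages Lipschitz in z. *)
Definition tau (x : R) : R := Num.max 0 (Num.min 1 (j%:R * Num.min x (1 - x))).

Lemma tau_bounds x : 0 <= tau x <= 1.
Proof. by rewrite /tau le_max lexx /= ge_max ler01 ge_min lexx. Qed.

Lemma tau_eq0 x : (x <= 0) || (1 <= x) -> tau x = 0.
Proof.
move=> h; apply/max_idPl; rewrite ge_min; apply/orP; right.
by rewrite mulr_ge0_le0 ?ler0n // ge_min; case/orP: h => ?; apply/orP; [left|right]; lra.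
Qed.

Lemma tau_eq1 x : 1 <= j%:R * x -> 1 <= j%:R * (1 - x) -> tau x = 1.
Proof.
move=> h1 h2; have -> : tau x = Num.max 0 1; last by apply/max_idPr.
congr (Num.max 0 _); apply/min_idPl.
by have [_|_] := leP x (1 - x).
Qed.

Lemma tau_lip x y : `|tau x - tau y| <= j%:R * `|x - y|.
Proof.
have j0 : 0 <= j%:R :> R by rewrite ler0n.
have mono (a b : R) : tau a - tau b <= j%:R * `|a - b|.
  have h1 : a - b <= `|a - b| by exact: ler_norm.
  have h2 : b - a <= `|a - b| by rewrite distrC; exact: ler_norm.
  have d0 : 0 <= j%:R * `|a - b| by rewrite mulr_ge0.
  rewrite lerBlDr /tau ge_max; apply/andP; split.
    by rewrite addr_ge0 // le_max lexx.
  apply: (@le_trans _ _ (j%:R * `|a - b| + Num.min 1 (j%:R * Num.min b (1 - b)))); last first.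
    by rewrite lerD2l le_max lexx orbT.
  rewrite [X in _ <= _ + X]minEle; case: ifP => _.
    by apply: (@le_trans _ _ 1); rewrite ?ge_min ?lexx //; lra.
  apply: (@le_trans _ _ (j%:R * Num.min a (1 - a))); first by rewrite ge_min lexx orbT.
  rewrite -mulrDr ler_wpM2l // [X in _ <= _ + X]minEle; case: ifP => _.
    by apply: (@le_trans _ _ a); rewrite ?ge_min ?lexx //; lra.
  by apply: (@le_trans _ _ (1 - a)); rewrite ?ge_min ?lexx ?orbT //; lra.
rewrite ler_norml; apply/andP; split; last exact: mono.
by have := mono y x; rewrite distrC; lra.
Qed.

Definition phi (N : nat) (x : gint) : R := tau (x.1%:~R / N%:R) * tau (x.2%:~R / N%:R).

Lemma phi_bounds N x : 0 <= phi N x <= 1.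
Proof.
have /andP[a0 a1] := tau_bounds (x.1%:~R / N%:R); have /andP[b0 b1] := tau_bounds (x.2%:~R / N%:R).
by rewrite /phi mulr_ge0 //= mulr_ile1.
Qed.

Lemma phi_coord N x : phi N x != 0 -> (0 < x.1 < N%:Z)%R && (0 < x.2 < N%:Z)%R.
Proof.
move=> h; have [N0|N0] := posnP N.
  by move: h; rewrite /phi N0 invr0 mulr0 tau_eq0 ?lexx // mul0r eqxx.
have NR : 0 < N%:R :> R by rewrite ltr0n.
have coord (a : int) : tau (a%:~R / N%:R) != 0 -> (0 < a < N%:Z)%R.
  move=> ta; apply/andP; split; rewrite ltNge; apply: contraNN ta => ha; rewrite tau_eq0 //.
    by apply/orP; left; rewrite pmulr_lle0 ?invr_gt0 // -[0]/(0%:~R) ler_int.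
  by apply/orP; right; rewrite ler_pdivlMr // mul1r -[N%:R]/(N%:Z%:~R) ler_int.
by move: h; rewrite mulf_eq0 negb_or => /andP[/coord -> /coord ->].
Qed.

Lemma phi_supp N x : phi N x != 0 -> nm x < 2 * N%:R :> R.
Proof.
move=> /phi_coord /andP[h1 h2].
rewrite -(ltr_pXn2r (n := 2)) ?nnegrE ?nm_ge0 ?mulr_ge0 ?ler0n // nm_sqr -natrM -natrX ltr_nat.
by rewrite /gN; case: x h1 h2 => a b /=; rewrite -!mulnn; nia.
Qed.

Lemma phi_lip N z w : `|phi N z - phi N w| <= 2 * j%:R / N%:R * nm (z - w).
Proof.
have coord (a b : int) (m : R) : `|a%:~R - b%:~R| <= m -> `|tau (a%:~R / N%:R) - tau (b%:~R / N%:R)| <= j%:R / N%:R * m.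
  move=> h; apply: le_trans (tau_lip _ _) _; rewrite -mulrBl normrM normfV normr_nat.
  by rewrite mulrCA mulrC ler_wpM2l // mulr_ge0 ?invr_ge0 ?ler0n.
have h1 : `|z.1%:~R - w.1%:~R| <= nm (z - w) :> R.
  rewrite -(ler_pXn2r (n := 2)) ?nnegrE ?nm_ge0 // nm_sqr gNr real_normK ?num_real // -rmorphB /=.
  by rewrite lerDl sqr_ge0.
have h2 : `|z.2%:~R - w.2%:~R| <= nm (z - w) :> R.
  rewrite -(ler_pXn2r (n := 2)) ?nnegrE ?nm_ge0 // nm_sqr gNr real_normK ?num_real // -rmorphB /=.
  by rewrite lerDr sqr_ge0.
have {}h1 := coord _ _ _ h1; have {}h2 := coord _ _ _ h2.
have /andP[a0 a1] := tau_bounds (z.1%:~R / N%:R); have /andP[b0 b1] := tau_bounds (w.2%:~R / N%:R).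
rewrite /phi; set A := tau _ in h1 a0 a1 *; set B := tau _ in h2 *.
set C := tau _ in h1 *; set D := tau _ in h2 b0 b1 *.
have -> : A * B - C * D = A * (B - D) + (A - C) * D by ring.
apply: le_trans (ler_normD _ _) _; rewrite !normrM (ger0_norm a0) (ger0_norm b0).
have i1 : A * `|B - D| <= `|B - D| by rewrite ler_piMl.
have i2 : `|A - C| * D <= `|A - C| by rewrite ler_piMr.
by move: h1 h2; lra.
Qed.

Lemma phi0 N : phi N 0 = 0.
Proof. by rewrite /phi mul0r tau_eq0 ?lexx // mul0r. Qed.

(** Normalised by the area N^2 / |z|^2 of the region and not by the number of its points, so that
    multiplying z by a Gaussian prime above p gives exactly a factor p. For z nonzero every w with a
    nonzero cutoff lies in the box of size 2N. *)
Definition avg N z f : R :=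
  (gN z)%:R / N%:R ^+ 2 * zsum (2 * N) (fun w => phi N (gmul z w) * f w).

Lemma avg0 N f : avg N 0 f = 0.
Proof. by rewrite /avg /gN /= mul0r mul0r. Qed.

Lemma avgD N z f g : avg N z (fun w => f w + g w) = avg N z f + avg N z g.
Proof.
rewrite /avg -mulrDr -zsumD; congr (_ * _); apply: eq_bigr => w _; ring.
Qed.

Lemma avgZ N z c f : avg N z (fun w => c * f w) = c * avg N z f.
Proof.
rewrite /avg [RHS]mulrCA; congr (_ * _); rewrite -zsumZ; apply: eq_bigr => w _; ring.
Qed.

Lemma avg_le N z f g : (forall w, f w <= g w) -> avg N z f <= avg N z g.
Proof.
move=> fg; rewrite /avg ler_wpM2l ?divr_ge0 ?ler0n ?sqr_ge0 //.
by apply: ler_sum => w _; rewrite ler_wpM2l //; case/andP: (phi_bounds N (gmul z w)).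
Qed.

Lemma avg_norm_le N z f : `|avg N z f| <= avg N z (fun w => `|f w|).
Proof.
rewrite /avg normrM ger0_norm ?divr_ge0 ?ler0n ?sqr_ge0 // ler_wpM2l ?divr_ge0 ?ler0n ?sqr_ge0 //.
apply: le_trans (ler_norm_sum _ _ _) _; apply: ler_sum => w _; rewrite normrM.
by have /andP[p0 _] := phi_bounds N (gmul z w); rewrite (ger0_norm p0).
Qed.

Lemma avg_bounded z f : (exists C : R, forall w, `|f w| <= C) ->
  bounded_seq (fun N => avg N z f).
Proof.
move=> [C fC]; have C0 : 0 <= C by apply: le_trans (fC 0).
exists ((gN z)%:R * (16 * C)) => N.
apply: le_trans (avg_norm_le _ _ _) _; rewrite /avg -mulrA ler_wpM2l ?ler0n //.
have [->|N0] := posnP N.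
  by rewrite expr0n /= invr0 mul0r mulr_ge0.
rewrite ler_pdivrMl ?exprn_gt0 ?ltr0n //.
apply: (@le_trans _ _ (zsum (2 * N) (fun=> C))).
  apply: ler_sum => w _; have /andP[p0 p1] := phi_bounds N (gmul z w).
  by rewrite -[leRHS]mul1r; apply: ler_pM.
by rewrite zsum_cst natrM; lra.
Qed.

Lemma disc_count z N (c : R) : z != 0 -> 0 <= c -> nm z <= N%:R :> R ->
  (gN z)%:R / N%:R ^+ 2 * zsum (2 * N) (fun w => (((nm w : R) < c * N%:R / nm z)%R)%:R) <=
  4 * (c + 2) ^+ 2 :> R.
Proof.
move=> z0 c0 zN; have n0 : 0 < nm z :> R by rewrite nm_gt0.
have N0 : 0 < N%:R :> R by lra.
have cz0 : 0 <= c * N%:R / nm z by rewrite divr_ge0 ?mulr_ge0 ?(ltW N0) ?(ltW n0).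
have := @count_disc R (c * N%:R / nm z) (Num.truncn (c * N%:R / nm z)).+1 (2 * N) (ltW (truncnS_gt _)).
have hn : (Num.truncn (c * N%:R / nm z)).+1%:R <= (c + 2) * N%:R / nm z :> R.
  rewrite -natr1; have : (Num.truncn (c * N%:R / nm z))%:R <= c * N%:R / nm z :> R by rewrite truncn_le.
  have : 1 <= N%:R / nm z :> R by rewrite ler_pdivlMr // mul1r.
  have -> : (c + 2) * N%:R / nm z = c * N%:R / nm z + 2 * (N%:R / nm z) by ring.
  lra.
move=> h; rewrite -nm_sqr mulrAC ler_pdivrMr ?exprn_gt0 //.
apply: (@le_trans _ _ (nm z ^+ 2 * (4 * ((c + 2) * N%:R / nm z) ^+ 2))).
  rewrite ler_wpM2l ?sqr_ge0 //; apply: le_trans h _; rewrite ler_pM2l //.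
  by apply: lerXn2r; rewrite ?nnegrE ?ler0n // divr_ge0 ?mulr_ge0 ?(ltW N0) ?(ltW n0) ?addr_ge0.
by rewrite le_eqVlt; apply/orP; left; apply/eqP; field; rewrite gt_eqF.
Qed.

Lemma phi_le_disc N z w : z != 0 -> phi N (gmul z w) <= (((nm w : R) < 2 * N%:R / nm z)%R)%:R.
Proof.
move=> z0; have n0 : 0 < nm z :> R by rewrite nm_gt0.
have /andP[p0 p1] := phi_bounds N (gmul z w).
case: ltP => h //=; rewrite le_eqVlt; apply/orP; left; apply: contraTT h => /phi_supp.
by rewrite nm_mul -ltNge ltr_pdivlMr // mulrC.
Qed.

Lemma avg_norm_le_cst N z f C : (forall w, `|f w| <= C) -> nm z <= N%:R :> R ->
  `|avg N z f| <= 64 * C.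
Proof.
move=> fC zN; have C0 : 0 <= C by apply: le_trans (fC 0).
have [->|z0] := eqVneq z 0; first by rewrite avg0 normr0 mulr_ge0.
apply: le_trans (avg_norm_le _ _ _) _.
apply: (@le_trans _ _ (avg N z (fun=> C))); first exact: avg_le.
apply: (@le_trans _ _ (C * (4 * (2 + 2) ^+ 2))); last by lra.
rewrite /avg; apply: le_trans (ler_wpM2l C0 (disc_count z0 _ zN)) => //.
rewrite mulrCA ler_wpM2l ?divr_ge0 ?ler0n ?sqr_ge0 // -zsumZ.
by apply: ler_sum => w _; rewrite mulrC ler_wpM2l // phi_le_disc.
Qed.

(** If |z - z'| >= |z|/2 the trivial bound suffices. Otherwise the difference has two parts: the
    cutoff moves by at most 8 j |z - z'| / |z| on a disc of radius 4N/|z|, giving 1152 = 8 * 144,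
    and the normalisations |z|^2 and |z'|^2 differ, giving 12 * 64 <= 1000. *)
Lemma avg_tame N z z' f : (forall w, `|f w| <= 1) ->
  nm z <= N%:R :> R -> nm z' <= N%:R :> R ->
  `|avg N z f - avg N z' f| * nm z <= (1152 * j%:R + 1000) * nm (z - z').
Proof.
move=> f1 zN z'N; set d := nm (z - z'); set a := nm z.
have d0 : 0 <= d by apply: nm_ge0.
have a0 : 0 <= a by apply: nm_ge0.
have j0 : 0 <= j%:R :> R by rewrite ler0n.
have bz : `|avg N z f| <= 64 by have := avg_norm_le_cst f1 zN; lra.
have bz' : `|avg N z' f| <= 64 by have := avg_norm_le_cst f1 z'N; lra.
have [far|near] := leP a (2 * d).
  apply: (@le_trans _ _ (128 * a)).
    by rewrite ler_wpM2r //; apply: le_trans (ler_normB _ _) _; lra.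
  have : 0 <= j%:R * d by rewrite mulr_ge0.
  have -> : (1152 * j%:R + 1000) * d = 1152 * (j%:R * d) + 1000 * d by ring.
  by lra.
have a0' : 0 < a by lra.
have z0 : z != 0 by rewrite -(nm_gt0 R).
have zz' : a <= nm z' + d.
  by have := nm_triangle R z' (z - z'); rewrite addrC subrK.
have z'z : nm z' <= a + d.
  by have := nm_triangle R z (z' - z); rewrite addrC subrK [nm (z' - z)]nmB.
set b := nm z' in zz' z'z z'N; have b0 : 0 < b by lra.
have z'0 : z' != 0 by rewrite -(nm_gt0 R).
have N0 : 0 < N%:R :> R by apply: lt_le_trans zN.
pose K := (gN z)%:R / N%:R ^+ 2 *
  zsum (2 * N) (fun w => (phi N (gmul z w) - phi N (gmul z' w)) * f w).
have split_avg : avg N z f - avg N z' f = K + ((gN z)%:R - (gN z')%:R) / (gN z')%:R * avg N z' f.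
  have -> : K = avg N z f - (gN z)%:R / N%:R ^+ 2 * zsum (2 * N) (fun w => phi N (gmul z' w) * f w).
    rewrite /K /avg -mulrBr -zsumB; congr (_ * _); apply: eq_bigr => w _; ring.
  have : (gN z')%:R != 0 :> R by rewrite pnatr_eq0 gN_eq0.
  rewrite /avg; move: ((gN z')%:R : R) ((gN z)%:R : R) => G G' G0; field.
  by rewrite G0 gt_eqF.
have hK : `|K| * a <= 1152 * j%:R * d.
  have step w : `|(phi N (gmul z w) - phi N (gmul z' w)) * f w| <=
      8 * j%:R * d / a * ((nm w < 4 * N%:R / a)%R)%:R.
    rewrite normrM; apply: le_trans (ler_piMr (normr_ge0 _) (f1 w)) _.
    have [h|h] := ltP (nm w) (4 * N%:R / a).
      rewrite mulr1; apply: le_trans (phi_lip _ _ _) _.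
      rewrite -gmulBl nm_mul -/d.
      have : 2 * j%:R / N%:R * (d * nm w) <= 2 * j%:R / N%:R * (d * (4 * N%:R / a)).
        by rewrite ler_wpM2l ?divr_ge0 ?mulr_ge0 ?(ltW N0) // ler_wpM2l // (ltW h).
      move/le_trans; apply; rewrite le_eqVlt; apply/orP; left; apply/eqP; field.
      by rewrite !gt_eqF.
    rewrite mulr0; have -> : phi N (gmul z w) = 0.
      apply: contraTeq h => /phi_supp; rewrite nm_mul -/a -ltNge ltr_pdivlMr // mulrC => h.
      by apply: lt_trans h _; lra.
    have -> : phi N (gmul z' w) = 0.
      apply: contraTeq h => /phi_supp; rewrite nm_mul -/b -ltNge ltr_pdivlMr // => h.
      have : a * nm w <= 2 * b * nm w by rewrite ler_wpM2r ?nm_ge0 //; lra.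
      by lra.
    by rewrite subrr normr0.
  have : `|K| <= 8 * j%:R * d / a * (4 * (4 + 2) ^+ 2).
    rewrite /K normrM ger0_norm ?divr_ge0 ?ler0n ?sqr_ge0 //.
    have c0 : 0 <= 8 * j%:R * d / a by rewrite divr_ge0 ?mulr_ge0.
    apply: le_trans (ler_wpM2l c0 (disc_count z0 _ zN)) => //.
    rewrite mulrCA ler_wpM2l ?divr_ge0 ?ler0n ?sqr_ge0 // -zsumZ.
    by apply: le_trans (ler_norm_sum _ _ _) _; apply: ler_sum => w _.
  rewrite -(ler_pM2r a0') => h; apply: le_trans h _.
  by rewrite le_eqVlt; apply/orP; left; apply/eqP; field; rewrite gt_eqF.
have hL : `|((gN z)%:R - (gN z')%:R) / (gN z')%:R * avg N z' f| * a <= 1000 * d.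
  rewrite -!nm_sqr -/a -/b.
  have ab : `|a ^+ 2 - b ^+ 2| <= d * (a + b).
    rewrite (_ : a ^+ 2 - b ^+ 2 = (a - b) * (a + b)); last ring.
    rewrite normrM (ger0_norm (x := a + b)); last lra.
    by apply: ler_wpM2r; [lra|rewrite ler_norml; apply/andP; split; lra].
  rewrite normrM normrM normfV (ger0_norm (x := b ^+ 2)) ?sqr_ge0 //.
  have h1 : `|a ^+ 2 - b ^+ 2| / b ^+ 2 * a <= 12 * d.
    rewrite mulrAC ler_pdivrMr ?exprn_gt0 //.
    apply: (@le_trans _ _ (d * ((a + b) * a))); first by rewrite mulrA ler_wpM2r.
    have -> : 12 * d * b ^+ 2 = d * (12 * b ^+ 2) by ring.
    by rewrite ler_wpM2l //; nra.
  have h2 : `|a ^+ 2 - b ^+ 2| / b ^+ 2 * `|avg N z' f| * a =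
    `|a ^+ 2 - b ^+ 2| / b ^+ 2 * a * `|avg N z' f| by ring.
  rewrite h2; apply: (@le_trans _ _ (12 * d * 64)); last by lra.
  apply: ler_pM => //; by rewrite mulr_ge0 // divr_ge0 // sqr_ge0.
rewrite split_avg; apply: (@le_trans _ _ ((`|K| + `|((gN z)%:R - (gN z')%:R) / (gN z')%:R * avg N z' f|) * a)).
  by rewrite ler_wpM2r // ler_normD.
rewrite [leLHS]mulrDl [leRHS]mulrDl; exact: lerD.
Qed.

Lemma avg_periodic N z q h : (0 < q)%N -> (0 < N)%N -> periodic q h -> (forall w, `|h w| <= 1) ->
  `|avg N z h - pmean q h * avg N z (fun=> 1)| <=
  128 * (gN z)%:R * q%:R * j%:R * nm z / N%:R.
Proof.
move=> q0 N0 hq h1; have [->|z0] := eqVneq z 0.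
  by rewrite !avg0 mulr0 subrr normr0 nm0 mulr0 mul0r.
have NR : 0 < N%:R :> R by rewrite ltr0n.
have n1 : 1 <= nm z :> R.
  by rewrite -sqrtr1 ler_wsqrtr // ler1n lt0n gN_eq0.
have e1 : zsum (2 * N) (fun w => phi N (gmul z w) * 1) = zsum (2 * N) (fun w => phi N (gmul z w)).
  by apply: eq_bigr => w _; rewrite mulr1.
have -> : avg N z h - pmean q h * avg N z (fun=> 1) = (gN z)%:R / N%:R ^+ 2 *
    (zsum (2 * N) (fun w => phi N (gmul z w) * h w) - pmean q h * zsum (2 * N) (fun w => phi N (gmul z w))).
  by rewrite /avg e1; ring.
rewrite normrM ger0_norm ?divr_ge0 ?ler0n ?sqr_ge0 //.
have edge w : (w.1 == (2 * N)%N%:Z) || (w.2 == (2 * N)%N%:Z) -> phi N (gmul z w) = 0.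
  move=> /(zbox_edge R) hw; apply: contraTeq (hw) => /phi_supp; rewrite -ltNge nm_mul natrM.
  by apply: le_lt_trans; rewrite ler_peMl ?nm_ge0.
have := zsum_periodic q0 hq h1 edge.
have va : variation (2 * N) (fun w => phi N (gmul z w)) <= 64 * N%:R * j%:R * nm z.
  have step w w' : nm (w - w') = 1 :> R ->
      `|phi N (gmul z w) - phi N (gmul z w')| <= 2 * j%:R / N%:R * nm z.
    by move=> e; apply: le_trans (phi_lip _ _ _) _; rewrite -gmulBr nm_mul e mulr1.
  apply: (@le_trans _ _ (zsum (2 * N) (fun=> 2 * (2 * j%:R / N%:R * nm z)))).
    apply: ler_sum => w _; rewrite mulr_natl mulr2n; apply: lerD; apply: step.
      by rewrite /nm (_ : gN _ = 1%N) ?sqrtr1 //; case: w => c d; rewrite /gN -!mulnn /=; lia.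
    by rewrite /nm (_ : gN _ = 1%N) ?sqrtr1 //; case: w => c d; rewrite /gN -!mulnn /=; lia.
  rewrite zsum_cst natrM le_eqVlt; apply/orP; left; apply/eqP; field; by rewrite gt_eqF.
set E := `|_|; move=> hE.
apply: (@le_trans _ _ ((gN z)%:R / N%:R ^+ 2 * (2 * q%:R * (64 * N%:R * j%:R * nm z)))).
  rewrite ler_wpM2l ?divr_ge0 ?ler0n ?sqr_ge0 //; apply: le_trans hE _.
  by rewrite ler_wpM2l // mulr_ge0 ?ler0n.
by rewrite le_eqVlt; apply/orP; left; apply/eqP; field; rewrite gt_eqF.
Qed.

(** Substitution of the multiples of [gpr p]. The relation between f and g is asked only for w
    nonzero, since Omega does not increase at 0; the cutoff vanishes there. *)
Lemma avg_mul N z p f g : sp p -> (forall w, w != 0 -> f w = g (gmul (gpr p) w)) ->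
  avg N (gmul z (gpr p)) f = p%:R * avg N z (fun w => g w * (gdvd (gpr p) w)%:R).
Proof.
move=> spp fg; have [->|z0] := eqVneq z 0.
  by rewrite gmul0l !avg0 mulr0.
have n1 : 1 <= nm z :> R by rewrite -sqrtr1 ler_wsqrtr // ler1n lt0n gN_eq0.
have u0 := gpr_neq0 spp; set u := gpr p in fg u0 *.
have u1 : 1 <= nm u :> R by rewrite -sqrtr1 ler_wsqrtr // ler1n lt0n gN_eq0.
have far w : 2 * N%:R <= nm w :> R -> phi N (gmul z w) = 0.
  move=> hw; apply: contraTeq (hw) => /phi_supp; rewrite -ltNge nm_mul.
  by apply: le_lt_trans; rewrite ler_peMl ?nm_ge0.
rewrite /avg gN_mul gprN // natrM.
have -> : (gN z)%:R * p%:R / N%:R ^+ 2 * zsum (2 * N) (fun w => phi N (gmul (gmul z u) w) * f w) =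
   p%:R * ((gN z)%:R / N%:R ^+ 2 * zsum (2 * N) (fun w => phi N (gmul (gmul z u) w) * f w)) by ring.
congr (_ * (_ * _)).
transitivity (\sum_(v <- map (gmul u) (zbox (2 * N))) phi N (gmul z v) * (g v * (gdvd u v)%:R)).
  rewrite big_map; apply: eq_bigr => w _; rewrite -gmulA.
  have -> : gdvd u (gmul u w) by apply/gdvdP => //; exists w.
  have [->|w0] := eqVneq w 0; last by rewrite fg // mulr1.
  by rewrite [gmul u 0]gmulC gmul0l [gmul z 0]gmulC gmul0l phi0 !mul0r.
apply: sum_supp.
- by rewrite map_inj_uniq ?zbox_uniq //; apply: gmul_inj.
- exact: zbox_uniq.
- by move=> v _ /(zboxPn R); rewrite natrM => /far ->; rewrite mul0r.
- move=> v _ vn; case: (boolP (gdvd u v)) => [/gdvdP [//|w vw]|_]; last by rewrite !mulr0.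
  rewrite far ?mul0r //.
  have : w \notin zbox (2 * N) by apply: contra vn => wN; apply/mapP; exists w.
  move=> /(zboxPn R); rewrite natrM vw nm_mul => h; apply: le_trans h _.
  by rewrite ler_peMl ?nm_ge0.
Qed.

End bump_averages.

(** * Limiting averages and the Turan-Kubilius inequality *)

Section bump_functional.
Variables (R : realType) (U : set_system nat) (j : nat).
Hypotheses (UU : UltraFilter U) (Uoo : \oo `<=` U).
Implicit Types (z w : gint) (f g h : gint -> R).

Definition rho z f : R := ultralim U (fun N => avg j N z f).

Definition bounded_gfun f := exists C : R, forall w, `|f w| <= C.

Lemma bounded_gfunD f g : bounded_gfun f -> bounded_gfun g -> bounded_gfun (fun w => f w + g w).
Proof.
by move=> [C fC] [D gD]; exists (C + D) => w; apply: le_trans (ler_normD _ _) _; apply: lerD.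
Qed.

Lemma bounded_gfunM f g : bounded_gfun f -> bounded_gfun g -> bounded_gfun (fun w => f w * g w).
Proof. by move=> [C fC] [D gD]; exists (C * D) => w; rewrite normrM; apply: ler_pM. Qed.

Lemma bounded_gfun_cst (c : R) : bounded_gfun (fun=> c).
Proof. by exists `|c|. Qed.

Lemma bounded_gfun_sum (P : seq nat) (f : nat -> gint -> R) :
  (forall p, bounded_gfun (f p)) -> bounded_gfun (fun w => \sum_(p <- P) f p w).
Proof.
move=> bf; elim: P => [|p P IH].
  by exists 0 => w; rewrite big_nil normr0.
have := bounded_gfunD (bf p) IH; congr bounded_gfun.
by apply/funext => w; rewrite big_cons.
Qed.

Lemma rhoD z f g : bounded_gfun f -> bounded_gfun g ->
  rho z (fun w => f w + g w) = rho z f + rho z g.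
Proof.
move=> bf bg; rewrite /rho -ultralimD //; try exact: avg_bounded.
by congr ultralim; apply/funext => N; rewrite avgD.
Qed.

Lemma rhoZ z c f : bounded_gfun f -> rho z (fun w => c * f w) = c * rho z f.
Proof.
move=> bf; rewrite /rho -ultralimZ //; last exact: avg_bounded.
by congr ultralim; apply/funext => N; rewrite avgZ.
Qed.

Lemma rho0 z : rho z (fun=> 0) = 0.
Proof.
transitivity (rho z (fun=> 0 * 0)); first by rewrite mul0r.
by rewrite rhoZ ?mul0r //; exact: bounded_gfun_cst.
Qed.

Lemma rho_sum z (P : seq nat) (f : nat -> gint -> R) : (forall p, bounded_gfun (f p)) ->
  rho z (fun w => \sum_(p <- P) f p w) = \sum_(p <- P) rho z (f p).
Proof.
move=> bf; elim: P => [|p P IH].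
  rewrite big_nil -[RHS](rho0 z); congr rho; apply/funext => w; exact: big_nil.
rewrite big_cons -IH -rhoD //; last exact: bounded_gfun_sum.
by congr rho; apply/funext => w; rewrite big_cons.
Qed.

Lemma rho_le z f g : bounded_gfun f -> bounded_gfun g -> (forall w, f w <= g w) ->
  rho z f <= rho z g.
Proof.
move=> bf bg fg; apply: (ultralim_le UU Uoo (n0 := 0)); try exact: avg_bounded.
by move=> N _; apply: avg_le.
Qed.

Lemma rho_norm_le z f : bounded_gfun f -> `|rho z f| <= rho z (fun w => `|f w|).
Proof.
move=> bf; have bn : bounded_gfun (fun w => `|f w|).
  by have [C fC] := bf; exists C => w; rewrite normr_id.
rewrite ler_norml; apply/andP; split; last by apply: rho_le => // w; apply: ler_norm.
rewrite -mulN1r -rhoZ //; apply: rho_le => // [|w].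
  exact: bounded_gfunM (bounded_gfun_cst _) bn.
by rewrite mulN1r lerNl -normrN ler_norm.
Qed.

Lemma rho_norm_le_cst z f C : (forall w, `|f w| <= C) -> `|rho z f| <= 64 * C.
Proof.
move=> fC; apply: (ultralim_norm_le UU Uoo (n0 := (Num.truncn (nm z : R)).+1)).
  by apply: avg_bounded; exists C.
move=> N hN; apply: avg_norm_le_cst => //.
by apply: le_trans (ltW (truncnS_gt _)) _; rewrite ler_nat.
Qed.

Lemma rho_tame f : (forall w, `|f w| <= 1) -> tame (1152 * j%:R + 1000) (fun z => rho z f).
Proof.
move=> f1 z z'; have bf : bounded_gfun f by exists 1.
have -> : `|rho z f - rho z' f| * nm z =
    `|ultralim U (fun N => nm z * (avg j N z f + (-1) * avg j N z' f))|.
  have bz := avg_bounded j z bf; have bz' := avg_bounded j z' bf.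
  rewrite ultralimZ ?ultralimD ?ultralimZ //; try exact: bounded_seqZ.
    by rewrite mulN1r normrM (ger0_norm (nm_ge0 _ _)) mulrC.
  by apply: bounded_seqD => //; apply: bounded_seqZ.
apply: (ultralim_norm_le UU Uoo (n0 := maxn (Num.truncn (nm z : R)).+1 (Num.truncn (nm z' : R)).+1)).
  apply: bounded_seqZ; apply: bounded_seqD; first exact: avg_bounded.
  by apply: bounded_seqZ; apply: avg_bounded.
move=> N; rewrite geq_max => /andP[h1 h2].
rewrite mulN1r normrM (ger0_norm (nm_ge0 _ _)) mulrC; apply: avg_tame => //.
  by apply: le_trans (ltW (truncnS_gt _)) _; rewrite ler_nat.
by apply: le_trans (ltW (truncnS_gt _)) _; rewrite ler_nat.
Qed.

Lemma rho_periodic z q h : (0 < q)%N -> periodic q h -> (forall w, `|h w| <= 1) ->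
  rho z h = pmean q h * rho z (fun=> 1).
Proof.
move=> q0 hq h1; have bh : bounded_gfun h by exists 1.
apply/eqP; rewrite -subr_eq0 -normr_le0 leNgt; apply/negP; set e := `|_| => e0.
pose K := 128 * (gN z)%:R * q%:R * j%:R * nm z : R.
have K0 : 0 <= K by rewrite !mulr_ge0 ?nm_ge0.
(* The error K/N for the box of size N is below e/2 for large N, so a positive defect e is
   impossible. *)
suff : e <= e / 2 by move: e0; lra.
have he : e = `|ultralim U (fun N => avg j N z h + (- pmean q h) * avg j N z (fun=> 1))|.
  have b1 := avg_bounded j z (bounded_gfun_cst 1); have b2 := avg_bounded j z bh.
  by rewrite ultralimD ?ultralimZ ?mulNr //; apply: bounded_seqZ.
rewrite {1}he; apply: (ultralim_norm_le UU Uoo (n0 := (Num.truncn (2 * K / e)).+1)).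
  apply: bounded_seqD; first exact: avg_bounded.
  apply: bounded_seqZ; apply: avg_bounded; exact: bounded_gfun_cst.
move=> N hN; have N0 : (0 < N)%N by exact: leq_trans hN.
rewrite mulNr; apply: le_trans (avg_periodic _ z q0 N0 hq h1) _.
have NR : 0 < N%:R :> R by rewrite ltr0n.
rewrite ler_pdivrMr // -/K.
have : 2 * K / e <= N%:R.
  by apply: le_trans (ltW (truncnS_gt _)) _; rewrite ler_nat.
by rewrite ler_pdivrMr //; lra.
Qed.

Lemma rho1_ge0 z : 0 <= rho z (fun=> 1).
Proof.
rewrite -(rho0 z); by apply: rho_le => [||w //]; exact: bounded_gfun_cst.
Qed.

Let one p w : R := (gdvd (gpr p) w)%:R.

Let bounded_one p : bounded_gfun (one p).
Proof. by exists 1 => w; rewrite /one; case: (gdvd _ _); rewrite ?normr1 ?normr0. Qed.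

Let one_norm p w : `|one p w| <= 1.
Proof. by rewrite /one; case: (gdvd _ _); rewrite ?normr1 ?normr0. Qed.

Let rho_one z p : sp p -> rho z (one p) = p%:R^-1 * rho z (fun=> 1).
Proof.
move=> spp; rewrite -(pmean_gdvd R spp); apply: rho_periodic => //.
  by case/andP: spp => /prime_gt0.
exact: periodic_gdvd.
Qed.

Let rho_two z p q : sp p -> sp q -> rho z (fun w => one p w * one q w) <=
  (p%:R^-1 * q%:R^-1 + (p == q)%:R * p%:R^-1) * rho z (fun=> 1).
Proof.
move=> spp spq; have pp : prime p by case/andP: spp.
have pq : prime q by case/andP: spq.
have [<-|ne] := eqVneq p q; last first.
  rewrite mul0r addr0.
  have -> : p%:R^-1 * q%:R^-1 = pmean (p * q) (fun w => one p w * one q w).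
    rewrite pmean_mul ?pmean_gdvd ?prime_gt0 //; try exact: periodic_gdvd.
    by rewrite prime_coprime // dvdn_prime2.
  rewrite le_eqVlt; apply/orP; left; apply/eqP; apply: rho_periodic.
  - by rewrite muln_gt0 !prime_gt0.
  - apply: periodic_mulf; first by apply: periodic_mull; exact: periodic_gdvd.
    by rewrite mulnC; apply: periodic_mull; exact: periodic_gdvd.
  - by move=> w; rewrite normrM -[1]mulr1; apply: ler_pM.
have -> : (fun w => one p w * one p w) = one p.
  by apply/funext => w; rewrite /one; case: (gdvd _ _); rewrite ?mulr1 ?mulr0.
rewrite rho_one // mul1r ler_wpM2r ?rho1_ge0 // lerDr.
by rewrite mulr_ge0 // invr_ge0 ler0n.
Qed.

Section turan_kubilius_inequality.
Variable P : seq nat.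
Hypotheses (uP : uniq P) (spP : {in P, forall p, sp p}) (L0 : 0 < inv_mass R P).
Notation L := (inv_mass R P).
Let X w : R := \sum_(p <- P) one p w.

Let bounded_X : bounded_gfun X.
Proof. exact: bounded_gfun_sum. Qed.

(** X counts the Gaussian primes [gpr p], p in P, that divide w. In the limit these events have
    densities exactly 1/p and are pairwise independent, so X has mean L and second moment at most
    L^2 + L, relative to the total mass. *)
Lemma rho_variance z : rho z (fun w => (1 - X w / L) ^+ 2) <= L^-1 * rho z (fun=> 1).
Proof.
have bXX : bounded_gfun (fun w => \sum_(p <- P) \sum_(q <- P) one p w * one q w).
  by apply: bounded_gfun_sum => p; apply: bounded_gfun_sum => q; apply: bounded_gfunM.
have -> : (fun w => (1 - X w / L) ^+ 2) =
    fun w => 1 + ((- 2 / L) * X w + L^-2 * \sum_(p <- P) \sum_(q <- P) one p w * one q w).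
  apply/funext => w; have -> : \sum_(p <- P) \sum_(q <- P) one p w * one q w = X w ^+ 2.
    by rewrite expr2 /X mulr_suml; apply: eq_bigr => p _; rewrite mulr_sumr.
  by field; rewrite gt_eqF.
have b1 : bounded_gfun (fun w => - 2 / L * X w) by apply: bounded_gfunM; first exact: bounded_gfun_cst.
have b2 := bounded_gfunM (bounded_gfun_cst (L^-2)) bXX.
rewrite rhoD; [|exact: bounded_gfun_cst|exact: bounded_gfunD b1 b2].
rewrite rhoD // !rhoZ // rho_sum //.
have -> : \sum_(p <- P) rho z (one p) = L * rho z (fun=> 1).
  by rewrite mulr_suml big_seq [RHS]big_seq; apply: eq_bigr => p /spP; exact: rho_one.
have : rho z (fun w => \sum_(p <- P) \sum_(q <- P) one p w * one q w) <= (L ^+ 2 + L) * rho z (fun=> 1).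
  rewrite rho_sum; last by move=> p; apply: bounded_gfun_sum => q; apply: bounded_gfunM.
  apply: (@le_trans _ _ (\sum_(p <- P) \sum_(q <- P)
      (p%:R^-1 * q%:R^-1 + (p == q)%:R * p%:R^-1) * rho z (fun=> 1))).
    rewrite big_seq [leRHS]big_seq; apply: ler_sum => p pP.
    rewrite rho_sum; last by move=> q; apply: bounded_gfunM.
    rewrite big_seq [leRHS]big_seq; apply: ler_sum => q qP; apply: rho_two; exact: spP.
  rewrite le_eqVlt; apply/orP; left; apply/eqP.
  have -> : L ^+ 2 + L = \sum_(p <- P) (p%:R^-1 * L + p%:R^-1).
    by rewrite big_split /= -mulr_suml expr2.
  rewrite mulr_suml big_seq [RHS]big_seq; apply: eq_bigr => p pP.
  rewrite -mulr_suml; congr (_ * _); rewrite big_split /= -mulr_sumr; congr (_ + _).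
  rewrite -mulr_suml (bigD1_seq p) //= eqxx big1 ?addr0 ?mul1r // => q qp.
  by rewrite eq_sym (negPf qp).
set S2 := rho z _; set r1 := rho z _ => h.
have : L^-2 * S2 <= L^-2 * ((L ^+ 2 + L) * r1).
  by rewrite ler_wpM2l // invr_ge0 sqr_ge0.
have -> : L^-2 * ((L ^+ 2 + L) * r1) = r1 + L^-1 * r1 by field; rewrite gt_eqF.
have -> : - 2 / L * (L * r1) = - 2 * r1 by field; rewrite gt_eqF.
by lra.
Qed.

End turan_kubilius_inequality.

Variable F : nat -> R.
Hypothesis F1 : forall n, `|F n| <= 1.

(** The total mass is at most 64; dividing by it gives the bound 1. *)
Definition orbit_avg (k : nat) z : R := rho z (fun w => F (Omega (gN w) + k)%N) / 64.

Lemma orbit_avg_norm k z : `|orbit_avg k z| <= 1.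
Proof.
rewrite /orbit_avg normrM normfV (ger0_norm (x := 64)) // ler_pdivrMr //.
by rewrite mul1r -[leRHS]mulr1; apply: rho_norm_le_cst.
Qed.

Lemma orbit_avg_tame k : tame (1152 * j%:R + 1000) (orbit_avg k).
Proof.
move=> z w; rewrite /orbit_avg -mulrBl normrM normfV (ger0_norm (x := 64)) //.
have := @rho_tame (fun w => F (Omega (gN w) + k)%N) (fun w => F1 _) z w.
apply: le_trans; rewrite ler_wpM2r ?nm_ge0 // ler_piMr //.
by rewrite invf_le1 //; lra.
Qed.

(** By the substitution w = pi v the average at z pi is p times the average at z over multiples of
    pi, and the shift k + 1 becomes k. The harmonic weights cancel p, so the mean over P is the
    average of f X / L, and the defect is the average of f (1 - X / L). *)
Lemma orbit_avg_turan_kubilius : turan_kubilius 1 orbit_avg.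
Proof.
move=> P uP spP L0 k z; set L := inv_mass R P in L0 *.
pose f w := F (Omega (gN w) + k)%N.
pose X w := \sum_(p <- P) one p w.
have bf : bounded_gfun f by exists 1 => w; exact: F1.
have bX : bounded_gfun X by apply: bounded_gfun_sum.
have s0 : 0 < Num.sqrt L by rewrite sqrtr_gt0.
have sL : Num.sqrt L ^+ 2 = L by rewrite sqr_sqrtr // ltW.
have -> : wav P (pwt R P) (fun p => orbit_avg k.+1 (gmul z (gpr p))) =
    rho z (fun w => f w * (X w / L)) / 64.
  rewrite pwtE -/L.
  have -> : (fun w => f w * (X w / L)) = fun w => L^-1 * \sum_(p <- P) f w * one p w.
    by apply/funext => w; rewrite -mulr_sumr -/(X w); ring.
  rewrite rhoZ; last by apply: bounded_gfun_sum => p; apply: bounded_gfunM.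
  rewrite rho_sum; last by move=> p; apply: bounded_gfunM.
  rewrite -mulrA; congr (_ * _); rewrite mulr_suml big_seq [RHS]big_seq.
  apply: eq_bigr => p pP; have spp := spP p pP; have pp : prime p by case/andP: spp.
  have p0 : p%:R != 0 :> R by rewrite pnatr_eq0 -lt0n prime_gt0.
  rewrite /orbit_avg.
  have -> : rho (gmul z (gpr p)) (fun w => F (Omega (gN w) + k.+1)%N) =
      p%:R * rho z (fun w => f w * one p w).
    rewrite /rho -ultralimZ //; last by apply: avg_bounded; apply: bounded_gfunM.
    congr ultralim; apply/funext => N; apply: avg_mul => // w w0.
    by rewrite /f gN_mul gprN // Omega_mul_prime ?lt0n ?gN_eq0 // addSnnS.
  by field.
have -> : orbit_avg k z - rho z (fun w => f w * (X w / L)) / 64 =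
    rho z (fun w => f w * (1 - X w / L)) / 64.
  rewrite /orbit_avg -mulrBl; congr (_ / _).
  have bfX : bounded_gfun (fun w => f w * (X w / L)).
    apply: bounded_gfunM => //; apply: bounded_gfunM => //; exact: bounded_gfun_cst.
  rewrite -[X in _ - X]mul1r -mulNr -rhoZ // -rhoD //.
    by congr rho; apply/funext => w; rewrite /f; ring.
  by apply: bounded_gfunM => //; exact: bounded_gfun_cst.
have bD : bounded_gfun (fun w => 1 - X w / L).
  apply: bounded_gfunD; first exact: bounded_gfun_cst.
  have := bounded_gfunM (bounded_gfun_cst (- L^-1)) bX; congr bounded_gfun.
  by apply/funext => w; ring.
have bD2 : bounded_gfun (fun w => (1 - X w / L) ^+ 2).
  have := bounded_gfunM bD bD; congr bounded_gfun.
rewrite normrM normfV (ger0_norm (x := 64)) // ler_pdivrMr //.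
apply: le_trans (rho_norm_le _ (bounded_gfunM bf bD)) _.
have bN : bounded_gfun (fun w => `|f w * (1 - X w / L)|).
  by have [C fC] := bounded_gfunM bf bD; exists C => w; rewrite normr_id.
(* AM-GM: |t| <= (s t^2 + 1/s) / 2 with s = sqrt L. *)
apply: (@le_trans _ _ (rho z (fun w => (Num.sqrt L / 2) * (1 - X w / L) ^+ 2 + ((Num.sqrt L)^-1 / 2) * 1))).
  apply: rho_le => // [|w].
    apply: bounded_gfunD; apply: bounded_gfunM => //; exact: bounded_gfun_cst.
  rewrite normrM; apply: le_trans (ler_piMl (normr_ge0 _) (F1 _)) _.
  set t := 1 - X w / L; rewrite -[t ^+ 2]real_normK ?num_real //; set u := `|t|.
  have sV : 0 <= (Num.sqrt L)^-1 by rewrite invr_ge0 ltW.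
  have := mulr_ge0 sV (sqr_ge0 (Num.sqrt L * u - 1)).
  have -> : (Num.sqrt L)^-1 * (Num.sqrt L * u - 1) ^+ 2 =
    Num.sqrt L * u ^+ 2 - 2 * u + (Num.sqrt L)^-1 by field; rewrite gt_eqF.
  by lra.
rewrite rhoD; [|by apply: bounded_gfunM => //; exact: bounded_gfun_cst|exact: bounded_gfun_cst].
rewrite rhoZ // rhoZ; last exact: bounded_gfun_cst.
have r64 : rho z (fun=> 1) <= 64.
  apply: le_trans (ler_norm _) _; rewrite -[leRHS]mulr1; apply: rho_norm_le_cst => w.
  by rewrite normr1.
have := rho_variance uP spP L0 z; rewrite -/L.
set v := rho z _; set r1 := rho z _ in r64 * => hv.
have : Num.sqrt L / 2 * v <= (Num.sqrt L)^-1 / 2 * r1.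
  apply: le_trans (ler_wpM2l _ hv) _; first by rewrite divr_ge0 // ltW.
  rewrite -{2}sL le_eqVlt; apply/orP; left; apply/eqP; field; by rewrite gt_eqF.
have : (Num.sqrt L)^-1 * r1 <= (Num.sqrt L)^-1 * 64 by rewrite ler_wpM2l // invr_ge0 ltW.
by rewrite mul1r; lra.
Qed.

End bump_functional.

(** * Comparison with averages over the square *)

Section box_average.
Variable R : realType.
Implicit Types (F : nat -> R) (N j : nat).

Definition box_avg F N : R := (N%:R ^+ 2)^-1 *
  \sum_(1 <= m < N.+1) \sum_(1 <= n < N.+1) F (Omega (m ^ 2 + n ^ 2)%N).

Lemma box_avgD F G N : box_avg (fun n => F n + G n) N = box_avg F N + box_avg G N.
Proof.
rewrite /box_avg -mulrDr -big_split; congr (_ * _); apply: eq_bigr => m _ /=.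
by rewrite -big_split.
Qed.

Lemma box_avgZ c F N : box_avg (fun n => c * F n) N = c * box_avg F N.
Proof.
rewrite /box_avg [RHS]mulrCA; congr (_ * _); rewrite mulr_sumr; apply: eq_bigr => m _.
by rewrite mulr_sumr.
Qed.

Lemma box_avg_le F G N : (forall n, F n <= G n) -> box_avg F N <= box_avg G N.
Proof.
move=> FG; rewrite /box_avg ler_wpM2l ?invr_ge0 ?sqr_ge0 //.
by apply: ler_sum => m _; apply: ler_sum => n _.
Qed.

Lemma box_avg_cst c N : (0 < N)%N -> box_avg (fun=> c) N = c.
Proof.
move=> N0; rewrite /box_avg !sumr_const_nat subSS subn0 -mulrnA -[c *+ _]mulr_natl natrM -expr2.
by rewrite mulKf // expf_eq0 /= pnatr_eq0 -lt0n.
Qed.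

Lemma box_avg_bounded F C : (forall n, `|F n| <= C) -> bounded_seq (box_avg F).
Proof.
move=> FC; have C0 : 0 <= C by apply: le_trans (FC 0%N).
exists C => -[|N]; first by rewrite /box_avg !big_geq // mulr0 normr0.
rewrite ler_norml -{1}(@box_avg_cst (- C) N.+1) // -[X in _ && (_ <= X)](@box_avg_cst C N.+1) //.
by apply/andP; split; apply: box_avg_le => n; have := FC n; rewrite ler_norml => /andP[].
Qed.

Lemma count_lt (c : R) n : 0 <= c -> \sum_(1 <= m < n.+1) ((m%:R < c)%R)%:R <= c :> R.
Proof.
move=> c0; elim: n => [|n IH]; first by rewrite big_geq.
rewrite big_nat_recr //=; have [h|h] := ltP (n.+1%:R) c; last by rewrite addr0.
apply: le_trans (ltW h); rewrite -[n.+1%:R]natr1 lerD2r.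
apply: (@le_trans _ _ (\sum_(1 <= m < n.+1) 1)).
  by apply: ler_sum => m _; rewrite lern1; case: (_ < _).
by rewrite sumr_const_nat subSS subn0.
Qed.

Lemma tau_defect j N : (0 < j)%N -> (0 < N)%N ->
  \sum_(1 <= m < N.+1) (1 - tau j (m%:R / N%:R)) <= 2 * N%:R / j%:R + 1 :> R.
Proof.
move=> j0 N0; have jR : 0 < j%:R :> R by rewrite ltr0n.
have NR : 0 < N%:R :> R by rewrite ltr0n.
pose c : R := N%:R / j%:R; have c0 : 0 <= c by rewrite divr_ge0 ?ltW.
have cj : c * j%:R = N%:R by rewrite mulfVK // gt_eqF.
apply: (@le_trans _ _ (\sum_(1 <= m < N.+1) (((m%:R < c)%R)%:R + (((N.+1 - m)%:R < c + 1)%R)%:R))).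
  rewrite big_nat [leRHS]big_nat; apply: ler_sum => m /andP[m1 mN].
  have /andP[t0 t1] := tau_bounds j (m%:R / N%:R : R).
  have [h1|h1] := ltP (m%:R) c; first by rewrite (@le_trans _ _ 1) ?lerDl ?ler0n //; lra.
  have [h2|h2] := ltP ((N.+1 - m)%:R) (c + 1); first by rewrite add0r (@le_trans _ _ 1) //; lra.
  rewrite tau_eq1 ?subrr ?addr0 //.
    rewrite mulrA ler_pdivlMr // mul1r -cj mulrC ler_pM2l //.
  have -> : 1 - m%:R / N%:R = (N%:R - m%:R) / N%:R :> R by field; rewrite gt_eqF.
  rewrite mulrA ler_pdivlMr // mul1r -[leLHS]cj mulrC ler_pM2l //.
  by move: h2; rewrite natrB ?(ltnW mN) // -[N.+1%:R]natr1; lra.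
rewrite big_split /= [X in _ + X]big_nat_rev /=.
have -> : \sum_(1 <= i < N.+1) (((N.+1 - (1 + N.+1 - i.+1))%:R < c + 1)%R)%:R =
    \sum_(1 <= i < N.+1) ((i%:R < c + 1)%R)%:R :> R.
  rewrite big_nat [RHS]big_nat; apply: eq_bigr => i /andP[i1 iN].
  by have -> : (N.+1 - (1 + N.+1 - i.+1) = i)%N by lia.
have h1 := count_lt N c0.
have h2 : \sum_(1 <= i < N.+1) ((i%:R < c + 1)%R)%:R <= c + 1 by apply: count_lt; lra.
have -> : 2 * N%:R / j%:R = c + c by rewrite /c; ring.
by lra.
Qed.

(** The cutoff differs from 1 only within about N/j of the sides, and 1 - t t' <= (1 - t) + (1 -
    t'). This gives 4/j + 2/N, at most 5/j once 2 j <= N. *)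
Lemma box_avg_bump F N j : (0 < j)%N -> (2 * j <= N)%N -> (forall n, `|F n| <= 1) ->
  `|box_avg F N - avg j N (1, 0) (fun w => F (Omega (gN w)))| <= 5 / j%:R.
Proof.
move=> j0 jN F1; have N0 : (0 < N)%N by apply: leq_trans jN; rewrite muln_gt0.
have NR : 0 < N%:R :> R by rewrite ltr0n.
have jR : 0 < j%:R :> R by rewrite ltr0n.
pose t (m : nat) : R := tau j (m%:R / N%:R).
have t01 m : 0 <= t m <= 1 by exact: tau_bounds.
have avgE : avg j N (1, 0) (fun w => F (Omega (gN w))) = (N%:R ^+ 2)^-1 *
    \sum_(1 <= m < N.+1) \sum_(1 <= n < N.+1) t m * t n * F (Omega (m ^ 2 + n ^ 2)%N).
  rewrite /avg (_ : gN (1, 0) = 1%N) // mul1r; congr (_ * _).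
  transitivity (\sum_(w <- [seq (m%:Z, n%:Z) | m <- index_iota 1 N.+1, n <- index_iota 1 N.+1])
      phi R j N w * F (Omega (gN w))); last first.
    by rewrite big_allpairs_dep; apply: eq_bigr => m _; apply: eq_bigr => n _.
  under [LHS]eq_bigr do rewrite gmul1.
  apply: sum_supp.
  - exact: zbox_uniq.
  - by apply: allpairs_uniq; rewrite ?iota_uniq // => -[m n] [m' n'] _ _ /= [-> ->].
  - move=> w _ wn; case: (eqVneq (phi R j N w) 0) => [->|]; rewrite ?mul0r // => /phi_coord hw.
    case/negP: wn; apply/allpairsP; exists (`|w.1|%N, `|w.2|%N) => /=.
    rewrite !mem_index_iota; case: w hw => a b /= hw; split; [lia|lia|congr pair; lia].
  - move=> w _ wn; case: (eqVneq (phi R j N w) 0) => [->|]; rewrite ?mul0r // => /phi_coord hw.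
    by case/negP: wn; rewrite mem_zbox; case: w hw => a b /= hw; lia.
rewrite avgE /box_avg -mulrBr normrM ger0_norm ?invr_ge0 ?sqr_ge0 //.
have h : `|\sum_(1 <= m < N.+1) \sum_(1 <= n < N.+1) F (Omega (m ^ 2 + n ^ 2)%N) -
    \sum_(1 <= m < N.+1) \sum_(1 <= n < N.+1) t m * t n * F (Omega (m ^ 2 + n ^ 2)%N)| <=
    \sum_(1 <= m < N.+1) \sum_(1 <= n < N.+1) ((1 - t m) + (1 - t n)).
  rewrite -sumrB; apply: le_trans (ler_norm_sum _ _ _) _; apply: ler_sum => m _.
  rewrite -sumrB; apply: le_trans (ler_norm_sum _ _ _) _; apply: ler_sum => n _.
  have /andP[a0 a1] := t01 m; have /andP[b0 b1] := t01 n.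
  rewrite -{1}[F _]mul1r -mulrBl normrM; apply: le_trans (ler_piMr (normr_ge0 _) (F1 _)) _.
  have ab : t m * t n <= 1 by rewrite mulr_ile1.
  rewrite ger0_norm ?subr_ge0 //.
  by have : 0 <= (1 - t m) * (1 - t n); [rewrite mulr_ge0 ?subr_ge0|lra].
have e2 : \sum_(1 <= m < N.+1) \sum_(1 <= n < N.+1) ((1 - t m) + (1 - t n)) =
    2 * N%:R * \sum_(1 <= m < N.+1) (1 - t m).
  under eq_bigr do rewrite big_split /= sumr_const_nat subSS subn0.
  rewrite big_split /= sumr_const_nat subSS subn0 -sumrMnl.
  by rewrite sumrMnl -[_ *+ N]mulr_natl; ring.
have := tau_defect j0 N0; rewrite -/t => td.
rewrite ler_pdivrMl ?exprn_gt0 //; apply: le_trans h _; rewrite e2.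
apply: (@le_trans _ _ (2 * N%:R * (2 * N%:R / j%:R + 1))).
  by rewrite ler_wpM2l // mulr_ge0 // ltW.
have -> : N%:R ^+ 2 * (5 / j%:R) = 2 * N%:R * (2 * N%:R / j%:R + (N%:R / j%:R) / 2) :> R by field; rewrite gt_eqF.
rewrite ler_wpM2l ?mulr_ge0 ?ler0n // lerD2l.
rewrite ler_pdivlMr // mul1r ler_pdivlMr //.
by rewrite -natrM ler_nat.
Qed.

End box_average.

(** Sharpening the cutoff raises the Lipschitz constant, but r does not depend on it. So the exact
    equality holds for every j with the same r, and the comparison error 5/j can be made arbitrarily
    small. *)
Theorem box_avg_shift (R : realType) : exists2 r, (0 < r)%N &
  forall (U : set_system nat), UltraFilter U -> \oo `<=` U ->
  forall F : nat -> R, (forall n, `|F n| <= 1) ->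
  ultralim U (box_avg F) = ultralim U (box_avg (fun n => F (n + r)%N)).
Proof.
have c0 : 0 < 8^-1 :> R by rewrite invr_gt0.
have C0 : 0 < 32 * (50 * 100) / expR (- 48) :> R by rewrite divr_gt0 ?expR_gt0 ?mulr_gt0.
have [r r0 hr] := shift_rigidity c0 C0 (fun l d S => @scale_exists R l d S).
exists r => // U UU Uoo F F1.
have bump j : (0 < j)%N -> rho U j (1, 0) (fun w => F (Omega (gN w))) =
    rho U j (1, 0) (fun w => F (Omega (gN w) + r)%N).
  move=> j0; have l0 : 0 < 1152 * j%:R + 1000 :> R by rewrite addr_gt0 ?mulr_gt0 ?ltr0n.
  have := hr _ 1 (orbit_avg U j F) l0 ltr01 (orbit_avg_norm j UU Uoo F1)
    (orbit_avg_tame j UU Uoo F1) (orbit_avg_turan_kubilius j UU Uoo F1).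
  rewrite /orbit_avg => /(congr1 ( *%R^~ 64)); rewrite !mulfVK ?pnatr_eq0 // => <-.
  by congr rho; apply/funext => w; rewrite addn0.
have close (G : nat -> R) j : (forall n, `|G n| <= 1) -> (0 < j)%N ->
    `|ultralim U (box_avg G) - rho U j (1, 0) (fun w => G (Omega (gN w)))| <= 5 / j%:R.
  move=> G1 j0; have b1 := box_avg_bounded G1.
  have b2 : bounded_seq (fun N => avg j N (1, 0) (fun w => G (Omega (gN w)))).
    by apply: avg_bounded; exists 1.
  have -> : ultralim U (box_avg G) - rho U j (1, 0) (fun w => G (Omega (gN w))) =
      ultralim U (fun N => box_avg G N + (-1) * avg j N (1, 0) (fun w => G (Omega (gN w)))).
    by rewrite (ultralimD UU) ?(ultralimZ UU) ?mulN1r //; apply: bounded_seqZ.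
  apply: (ultralim_norm_le UU Uoo (n0 := 2 * j)).
    by apply: bounded_seqD => //; apply: bounded_seqZ.
  by move=> N hN; rewrite mulN1r; apply: box_avg_bump.
apply/eqP; rewrite -subr_eq0 -normr_le0 leNgt; apply/negP; set e := `|_| => e0.
pose j := (Num.truncn (20 / e)).+1.
have jR : 0 < j%:R :> R by rewrite ltr0n.
have je : 20 / j%:R < e.
  rewrite ltr_pdivrMr // mulrC -ltr_pdivrMr //; exact: truncnS_gt.
have h1 := close F j F1 (ltn0Sn _).
have h2 := close (fun n => F (n + r)%N) j (fun n => F1 _) (ltn0Sn _).
rewrite -/j -bump // in h2.
have : e <= 10 / j%:R.
  have -> : e = `|(ultralim U (box_avg F) - rho U j (1, 0) (fun w => F (Omega (gN w)))) -
     (ultralim U (box_avg (fun n => F (n + r)%N)) - rho U j (1, 0) (fun w => F (Omega (gN w))))|.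
    by rewrite /e; congr `|_|; ring.
  apply: le_trans (ler_normB _ _) _; apply: le_trans (lerD h1 h2) _; by rewrite -mulrDl; lra.
by have : 0 < j%:R^-1 :> R; [rewrite invr_gt0|move: je; lra].
Qed.

(** * Van der Corput's method *)

Lemma irrationalMz (R : realType) (x : R) (n : int) : n != 0 -> irrational x ->
  irrational (n%:~R * x).
Proof.
rewrite irrationalE => n0 hx q _ [_ -> e]; apply: (hx (q / n%:~R)) => //.
exists (q / n%:~R) => //; rewrite fmorph_div rmorph_int /= e mulrC mulKf //.
by rewrite intr_eq0.
Qed.

Lemma irrational_neq_int (R : realType) (x : R) (n : int) : irrational x -> x != n%:~R.
Proof.
rewrite irrationalE => hx; apply/eqP => e; apply: (hx n%:~R) => //.
by exists n%:~R; rewrite // ratr_int.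
Qed.

Section turns.
Variable R : realType.
Implicit Types (x y t d : R).

Definition ct x : R := cos (2 * pi * x).
Definition st x : R := sin (2 * pi * x).

Lemma ctD x y : ct (x + y) = ct x * ct y - st x * st y.
Proof. by rewrite /ct mulrDr cosD. Qed.

Lemma stD x y : st (x + y) = st x * ct y + ct x * st y.
Proof. by rewrite /st mulrDr sinD. Qed.

Lemma ctN x : ct (- x) = ct x.
Proof. by rewrite /ct mulrN cosN. Qed.

Lemma stN x : st (- x) = - st x.
Proof. by rewrite /st mulrN sinN. Qed.

Lemma ctB x y : ct (x - y) = ct x * ct y + st x * st y.
Proof. by rewrite ctD ctN stN mulrN opprK. Qed.

Lemma ct2st2 x : ct x ^+ 2 + st x ^+ 2 = 1.
Proof. exact: cos2Dsin2. Qed.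

Lemma ct0 : ct 0 = 1. Proof. by rewrite /ct mulr0 cos0. Qed.

Lemma st0 : st 0 = 0. Proof. by rewrite /st mulr0 sin0. Qed.

Lemma ct_norm x : `|ct x| <= 1. Proof. exact: cos_max. Qed.

(** Lets every statement on sines follow from the one on cosines by moving the constant
    coefficient. *)
Lemma st_ct x : st x = ct (x - 4^-1).
Proof.
rewrite /st /ct mulrBr (_ : 2 * pi * 4^-1 = pi / 2) ?cosBpihalf //.
by field.
Qed.

Lemma ct_addn x (n : nat) : ct (x + n%:R) = ct x.
Proof.
rewrite /ct mulrDr (_ : 2 * pi * n%:R = (pi *+ 2) *+ n); last first.
  by rewrite mulr_natr mulr_natl.
exact: (periodicn (@cosD2pi R)).
Qed.

Lemma ct_addz x (n : int) : ct (x + n%:~R) = ct x.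
Proof.
case: n => n; first exact: ct_addn.
by rewrite NegzE -[RHS](ct_addn _ n.+1) -{2}[x](subrK n.+1%:R) !ct_addn rmorphN.
Qed.

Lemma half_turn x : 0 <= x -> x <= 2^-1 -> 0 <= 2 * pi * x <= pi.
Proof.
move=> x0 x2; have p0 : 0 <= pi :> R by exact: pi_ge0.
have -> : 2 * pi * x = pi * (2 * x) by ring.
by apply/andP; split; [apply: mulr_ge0 => //|rewrite ler_piMr //]; lra.
Qed.

Lemma ct_le d t : 0 <= d -> d <= t -> t <= 1 - d -> ct t <= ct d.
Proof.
have base x y : 0 <= x -> x <= y -> y <= 2^-1 -> ct y <= ct x.
  move=> x0 xy y2; move: xy; rewrite le_eqVlt => /orP[/eqP -> //|xy].
  apply/ltW; rewrite ltr_cos ?in_itv /=; [|apply: half_turn; lra|apply: half_turn; lra].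
  by rewrite ltr_pM2l // mulr_gt0 // pi_gt0.
move=> d0 dt td; have [t2|t2] := leP t 2^-1; first exact: base.
have -> : ct t = ct (1 - t) by rewrite addrC (ct_addn _ 1) ctN.
by apply: base => //; lra.
Qed.

Lemma ct_lt1 x : (forall n : int, x != n%:~R) -> ct x < 1.
Proof.
move=> hx; set n := Num.floor x; set t := x - n%:~R.
have /andP[t0 t1] := floor_itv x; rewrite -/n rmorphD /= in t0 t1.
have -> : ct x = ct t by rewrite -[RHS](ct_addz _ n) subrK.
have t00 : 0 < t by rewrite subr_gt0 lt_neqAle t0 andbT eq_sym.
pose d := Num.min t (1 - t) / 2.
have d0 : 0 < d by rewrite divr_gt0 // lt_min t00 /t; lra.
have d1 : d <= t / 2 by rewrite /d ler_pM2r ?invr_gt0 // ge_min lexx.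
have d2 : d <= (1 - t) / 2 by rewrite /d ler_pM2r ?invr_gt0 // ge_min lexx orbT.
apply: (@le_lt_trans _ _ (ct d)).
  by apply: ct_le; move: t00 d0 d1 d2; lra.
rewrite -ct0 /ct ltr_cos ?in_itv /=; [|apply: half_turn; lra|apply: half_turn; lra].
by rewrite mulr0; apply: mulr_gt0 => //; apply: mulr_gt0 => //; exact: pi_gt0.
Qed.

(** The geometric sum (1 - e(x)) (1 + ... + e((K-1)x)) = 1 - e(Kx), with e(x) = exp(2 pi i x), in
    real and imaginary parts. *)
Lemma turn_sum K x :
  let C := \sum_(j < K) ct (j%:R * x) in let S := \sum_(j < K) st (j%:R * x) in
  C - (ct x * C - st x * S) = 1 - ct (K%:R * x) /\
  S - (st x * C + ct x * S) = - st (K%:R * x).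
Proof.
elim: K => [|K [h1 h2]] /=.
  by rewrite !big_ord0 mul0r ct0 st0 !mulr0 !subrr addr0 subrr oppr0.
rewrite !big_ord_recr /= -natr1 mulrDl mul1r ctD stD.
set C := \sum_(j < K) _ in h1 h2 *; set S := \sum_(j < K) _ in h1 h2 *.
by split; [move: h1|move: h2]; lra.
Qed.

Lemma turn_sum_norm K x :
  2 * (1 - ct x) * ((\sum_(j < K) ct (j%:R * x)) ^+ 2 + (\sum_(j < K) st (j%:R * x)) ^+ 2) =
  2 * (1 - ct (K%:R * x)).
Proof.
have [] := turn_sum K x; set C := \sum_(j < K) _; set S := \sum_(j < K) _ => h1 h2.
have := ct2st2 x; have := ct2st2 (K%:R * x) => e1 e2.
have -> : 2 * (1 - ct (K%:R * x)) = (1 - ct (K%:R * x)) ^+ 2 + (- st (K%:R * x)) ^+ 2.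
  by rewrite sqrrN sqrrB -addrA [_ + st _ ^+ 2]addrC; move: e1; lra.
rewrite -h1 -h2.
have -> : 2 * (1 - ct x) = (1 - ct x) ^+ 2 + st x ^+ 2 by move: e2; rewrite sqrrB; lra.
ring.
Qed.

End turns.

Section bounded_sequences.
Variable R : realType.
Implicit Types F G : nat -> R.

Lemma bounded_seq_cst (c : R) : bounded_seq (fun=> c).
Proof. by exists `|c|. Qed.

Lemma bounded_seqM F G : bounded_seq F -> bounded_seq G -> bounded_seq (fun n => F n * G n).
Proof. by move=> [C FC] [D GD]; exists (C * D) => n; rewrite normrM; apply: ler_pM. Qed.

Lemma bounded_seq_sum (I : Type) (s : seq I) (F : I -> nat -> R) :
  (forall i, bounded_seq (F i)) -> bounded_seq (fun n => \sum_(i <- s) F i n).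
Proof.
move=> bF; elim: s => [|i s IH]; first by exists 0 => n; rewrite big_nil normr0.
have := bounded_seqD (bF i) IH; congr bounded_seq.
by apply/funext => n; rewrite big_cons.
Qed.

Lemma bounded_seq_comp F (g : nat -> nat) : bounded_seq F -> bounded_seq (fun n => F (g n)).
Proof. by move=> [C FC]; exists C. Qed.

Lemma bounded_ct (f : nat -> R) : bounded_seq (fun n => ct (f n)).
Proof. by exists 1 => n; exact: ct_norm. Qed.

Lemma bounded_st (f : nat -> R) : bounded_seq (fun n => st (f n)).
Proof. by exists 1 => n; rewrite st_ct ct_norm. Qed.

End bounded_sequences.

(** The total mass is only bounded by 1, so that the restriction to a residue class is again such a
    functional. *)
Definition invariant_functional (R : realType) (r : nat) (mu : (nat -> R) -> R) :=
  [/\ forall F G, bounded_seq F -> bounded_seq G ->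
        mu (fun n => F n + G n) = mu F + mu G,
      forall c F, bounded_seq F -> mu (fun n => c * F n) = c * mu F,
      forall F, bounded_seq F -> (forall n, 0 <= F n) -> 0 <= mu F,
      mu (fun=> 1) <= 1
    & forall F, bounded_seq F -> mu (fun n => F (n + r)%N) = mu F].

Section functional.
Variables (R : realType) (r : nat) (mu : (nat -> R) -> R).
Hypothesis mu_inv : invariant_functional r mu.
Implicit Types F G : nat -> R.

Lemma muD F G : bounded_seq F -> bounded_seq G -> mu (fun n => F n + G n) = mu F + mu G.
Proof. by case: mu_inv => h _ _ _ _; exact: h. Qed.

Lemma muZ c F : bounded_seq F -> mu (fun n => c * F n) = c * mu F.
Proof. by case: mu_inv => _ h _ _ _; exact: h. Qed.

Lemma mu_ge0 F : bounded_seq F -> (forall n, 0 <= F n) -> 0 <= mu F.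
Proof. by case: mu_inv => _ _ h _ _; exact: h. Qed.

Lemma mu1_le1 : mu (fun=> 1) <= 1.
Proof. by case: mu_inv. Qed.

Lemma mu_shift F : bounded_seq F -> mu (fun n => F (n + r)%N) = mu F.
Proof. by case: mu_inv => _ _ _ _ h; exact: h. Qed.

Lemma mu_le F G : bounded_seq F -> bounded_seq G -> (forall n, F n <= G n) -> mu F <= mu G.
Proof.
move=> bF bG FG; have bN : bounded_seq (fun n => (-1) * F n) by exact: bounded_seqZ.
have := mu_ge0 (bounded_seqD bG bN); rewrite muD // muZ // mulN1r subr_ge0; apply => n.
by rewrite mulN1r subr_ge0.
Qed.

Lemma mu0 : mu (fun=> 0) = 0.
Proof.
transitivity (mu (fun=> 0 * 0)); first by rewrite mul0r.
by rewrite muZ ?mul0r //; exact: bounded_seq_cst.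
Qed.

Lemma mu_sum (I : Type) (s : seq I) (F : I -> nat -> R) : (forall i, bounded_seq (F i)) ->
  mu (fun n => \sum_(i <- s) F i n) = \sum_(i <- s) mu (F i).
Proof.
move=> bF; elim: s => [|i s IH].
  rewrite big_nil -[RHS]mu0; congr mu; apply/funext => n; exact: big_nil.
rewrite big_cons -IH -muD //; last exact: bounded_seq_sum.
by congr mu; apply/funext => n; rewrite big_cons.
Qed.

Lemma mu_shiftM k F : bounded_seq F -> mu (fun n => F (n + r * k)%N) = mu F.
Proof.
move=> bF; elim: k => [|k IH].
  by congr mu; apply/funext => n; rewrite muln0 addn0.
rewrite -IH -(mu_shift (F := fun n => F (n + r * k)%N)); last exact: bounded_seq_comp.
by congr mu; apply/funext => n; rewrite mulnS addnA.
Qed.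

End functional.

Section van_der_corput.
Variables (R : realType) (r : nat) (mu : (nat -> R) -> R).
Hypothesis r0 : (0 < r)%N.
Hypothesis mu_inv : invariant_functional r mu.

(** Replace e(f) by its average over H shifts, which has the same mean, and apply Cauchy-Schwarz.
    Among the H^2 correlations only the H diagonal ones survive, so C^2 <= 1/H, contradicting the
    choice of H when C is nonzero. *)
Lemma van_der_corput (f : nat -> R) :
  (forall h h', h != h' -> mu (fun m => ct (f (m + r * h)%N - f (m + r * h')%N)) = 0) ->
  mu (fun m => ct (f m)) = 0.
Proof.
move=> hf; set C := mu _; apply: contrapT => /eqP C0.
have C2 : 0 < C ^+ 2 by rewrite exprn_even_gt0.
pose H := (Num.truncn (C ^- 2)).+1.
have HR : 0 < H%:R :> R by rewrite ltr0n.
suff : C ^+ 2 <= H%:R^-1.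
  apply/negP; rewrite -ltNge -[C ^+ 2]invrK ltf_pV2 ?posrE ?invr_gt0 //.
  exact: truncnS_gt.
pose g m := \sum_(h < H) H%:R^-1 * ct (f (m + r * h)%N).
pose g' m := \sum_(h < H) H%:R^-1 * st (f (m + r * h)%N).
have bg : bounded_seq g.
  apply: bounded_seq_sum => h; apply: bounded_seqZ; exact: bounded_ct.
have bg' : bounded_seq g'.
  apply: bounded_seq_sum => h; apply: bounded_seqZ; exact: bounded_st.
have mug : mu g = C.
  rewrite (mu_sum mu_inv); last by move=> h; apply: bounded_seqZ; exact: bounded_ct.
  transitivity (\sum_(h < H) H%:R^-1 * C).
    apply: eq_bigr => h _; rewrite (muZ mu_inv); last exact: bounded_ct.
    congr (_ * _); rewrite /C -(mu_shiftM mu_inv h (F := fun m => ct (f m))) //; exact: bounded_ct.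
  by rewrite sumr_const card_ord -[_ *+ H]mulr_natl mulVKf // gt_eqF.
have b2 := bounded_seqM bg bg; have b2' := bounded_seqM bg' bg'.
have le1 : C ^+ 2 <= mu (fun m => g m * g m).
  have : 0 <= mu (fun m => (g m * g m + (- 2 * C) * g m) + C ^+ 2 * 1).
    apply: (mu_ge0 mu_inv) => [|m].
      apply: bounded_seqD; last exact: bounded_seq_cst.
      by apply: bounded_seqD => //; apply: bounded_seqZ.
    by have := sqr_ge0 (g m - C); lra.
  have bc := bounded_seqZ (- 2 * C) bg.
  rewrite (muD mu_inv); [|exact: bounded_seqD b2 bc|exact: bounded_seq_cst].
  rewrite (muD mu_inv) // !(muZ mu_inv) ?mug //; last exact: bounded_seq_cst.
  have : C ^+ 2 * mu (fun=> 1) <= C ^+ 2 by rewrite ler_piMr ?sqr_ge0 // (mu1_le1 mu_inv).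
  by lra.
have le2 : mu (fun m => g m * g m) <= mu (fun m => g m * g m + g' m * g' m).
  apply: (mu_le mu_inv) => // [|m]; first exact: bounded_seqD.
  by rewrite lerDl -expr2 sqr_ge0.
apply: le_trans le1 (le_trans le2 _).
have -> : (fun m => g m * g m + g' m * g' m) =
    fun m => \sum_(h < H) \sum_(h' < H) H%:R^-2 * ct (f (m + r * h)%N - f (m + r * h')%N).
  apply/funext => m; rewrite /g /g' !mulr_suml -big_split; apply: eq_bigr => h _ /=.
  rewrite !mulr_sumr -big_split; apply: eq_bigr => h' _ /=; rewrite ctB; by field; rewrite gt_eqF.
rewrite (mu_sum mu_inv); last first.
  move=> h; apply: bounded_seq_sum => h'; apply: bounded_seqZ; exact: bounded_ct.
apply: (@le_trans _ _ (\sum_(h < H) H%:R^-2)); last first.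
  rewrite sumr_const card_ord -[_ *+ H]mulr_natl le_eqVlt; apply/orP; left; apply/eqP.
  by field; rewrite gt_eqF.
apply: ler_sum => h _.
rewrite (mu_sum mu_inv); last by move=> h'; apply: bounded_seqZ; exact: bounded_ct.
rewrite (bigD1 h) //= big1 ?addr0; last first.
  by move=> h' hh'; rewrite (muZ mu_inv) ?hf ?mulr0 //; [rewrite eq_sym|exact: bounded_ct].
rewrite (muZ mu_inv); last exact: bounded_ct.
rewrite (_ : (fun m => ct _) = fun=> 1); last by apply/funext => m; rewrite subrr ct0.
by rewrite ler_piMr ?invr_ge0 ?sqr_ge0 // (mu1_le1 mu_inv).
Qed.

(** Invariance gives mu(e(f)) = e(x) mu(e(f)), and e(x) differs from 1. The two real equations [e1]
    and [e2] express this. *)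
Lemma weyl_linear (f : nat -> R) (x : R) : irrational x -> (forall m, f (m + r)%N = f m + x) ->
  mu (fun m => ct (f m)) = 0.
Proof.
move=> hx fS; set C := mu _; pose S := mu (fun m => st (f m)).
have bc := bounded_ct f; have bs := bounded_st f.
have e1 : C = ct x * C + (- st x) * S.
  rewrite -!(muZ mu_inv) // -(muD mu_inv); try exact: bounded_seqZ.
  rewrite {1}/C -(mu_shift mu_inv bc); congr mu; apply/funext => m; rewrite fS ctD; ring.
have e2 : S = ct x * S + st x * C.
  rewrite -!(muZ mu_inv) // -(muD mu_inv); try exact: bounded_seqZ.
  rewrite {1}/S -(mu_shift mu_inv bs); congr mu; apply/funext => m; rewrite fS stD; ring.
have lt1 : ct x < 1 by apply: ct_lt1 => n; exact: irrational_neq_int.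
have h : (2 * (1 - ct x)) * C = 0.
  have -> : 2 * (1 - ct x) = (1 - ct x) ^+ 2 + st x ^+ 2 by have := ct2st2 x; lra.
  have -> : ((1 - ct x) ^+ 2 + st x ^+ 2) * C = (1 - ct x) * (C - ct x * C + st x * S)
     - st x * (S - ct x * S - st x * C) by ring.
  have -> : C - ct x * C + st x * S = 0 by move: e1; lra.
  have -> : S - ct x * S - st x * C = 0 by move: e2; lra.
  by rewrite !mulr0 subrr.
by move/eqP: h; rewrite mulf_eq0 => /orP[/eqP|/eqP //]; lra.
Qed.

Lemma weyl_leading d (P : {poly R}) : (size P <= d.+2)%N -> irrational P`_d.+1 ->
  mu (fun m => ct P.[m%:R]) = 0.
Proof.
elim: d P => [|d IH] P sP irr.
  have rz : r%:Z != 0 by rewrite eqz_nat -lt0n.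
  apply: (weyl_linear (irrationalMz rz irr)) => m.
  by rewrite !(horner_coef_wide _ sP) !big_ord_recr !big_ord0 /= natrD; ring.
apply: van_der_corput => h h' hh'.
pose D := \poly_(i < d.+2) (P^`N(i).[(r * h)%:R] - P^`N(i).[(r * h')%:R]).
have shiftP (m k : nat) : P.[(m + k)%:R] = \sum_(i < d.+3) P^`N(i).[k%:R] * m%:R ^+ i.
  by rewrite addnC natrD (nderiv_taylor_wide _ sP) //; exact: mulrC.
have topE k : P^`N(d.+2).[k] = P`_d.+2.
  rewrite (horner_coef_wide (n := 1)); last first.
    by apply/leq_sizeP => i i1; rewrite coef_nderivn nth_default ?mul0rn // (leq_trans sP) //; lia.
  by rewrite big_ord1 expr0 mulr1 coef_nderivn addn0 binn mulr1n.
have nextE k : P^`N(d.+1).[k] = P`_d.+1 + d.+2%:R * P`_d.+2 * k.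
  rewrite (horner_coef_wide (n := 2)); last first.
    by apply/leq_sizeP => i i1; rewrite coef_nderivn nth_default ?mul0rn // (leq_trans sP) //; lia.
  rewrite !big_ord_recr big_ord0 /= !coef_nderivn addn0 binn mulr1n addn1 binSn expr0 expr1.
  by rewrite -[P`_d.+2 *+ _]mulr_natl; ring.
have -> : (fun m => ct (P.[(m + r * h)%:R] - P.[(m + r * h')%:R])) = fun m => ct D.[m%:R].
  apply/funext => m; congr ct; rewrite !shiftP -sumrB big_ord_recr /= !topE subrr addr0.
  rewrite horner_poly; apply: eq_bigr => i _; by rewrite mulrBl.
apply: IH; first exact: size_poly.
rewrite coef_poly ltnSn !nextE.
have -> : P`_d.+1 + d.+2%:R * P`_d.+2 * (r * h)%:R - (P`_d.+1 + d.+2%:R * P`_d.+2 * (r * h')%:R) =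
   ((d.+2 * r)%N%:Z * (h%:Z - h'%:Z))%:~R * P`_d.+2.
  by rewrite intrM rmorphB /= -pmulrn !natrM; ring.
apply: irrationalMz => //; rewrite mulf_neq0 // ?subr_eq0 eqz_nat //.
by rewrite muln_eq0 negb_or /= -lt0n.
Qed.

End van_der_corput.

Lemma common_denominator (R : realType) (s : seq R) : (forall x, x \in s -> ~ irrational x) ->
  exists2 q : nat, (0 < q)%N & forall x, x \in s -> exists z : int, q%:R * x = z%:~R.
Proof.
elim: s => [|x s IH] hs; first by exists 1%N.
have [|q q0 hq] := IH; first by move=> y ys; apply: hs; rewrite inE ys orbT.
have [t tx] : exists t : rat, x = ratr t.
  apply: contrapT => /forallNP h; apply: (hs x); first exact: mem_head.
  rewrite irrationalE => t _ [_ -> e]; exact: (h t).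
have d0 := denq_gt0 t; pose d := `|denq t|%N.
have dE : d%:R = (denq t)%:~R :> R by rewrite -[d%:R]/((d%:Z)%:~R) /d gez0_abs // ltW.
exists (d * q)%N; first by rewrite muln_gt0 q0 absz_gt0 gt_eqF.
move=> y; rewrite inE => /orP[/eqP ->|/hq [z hz]].
  exists (numq t * q%:Z); rewrite tx natrM dE intrM -pmulrn mulrAC; congr (_ * _).
  by rewrite -[RHS]ratr_int numqE rmorphM /= ratr_int mulrC.
by exists (d%:Z * z); rewrite natrM -mulrA hz intrM -pmulrn.
Qed.

(** * Polynomials whose leading coefficients may be rational *)

Section residues.
Variables (R : realType) (r : nat) (nu : (nat -> R) -> R).
Hypothesis r0 : (0 < r)%N.
Hypothesis nu_inv : invariant_functional r nu.

Let bounded_class M c (F : nat -> R) : bounded_seq F ->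
  bounded_seq (fun k => ((k %% M == c)%N)%:R * F k).
Proof.
by move=> [C FC]; exists C => k; case: (_ == _); rewrite ?mul1r ?mul0r ?normr0 //; apply: le_trans (FC 0%N).
Qed.

Lemma residue_functional M c : (r %| M)%N ->
  invariant_functional M (fun F => nu (fun k => ((k %% M == c)%N)%:R * F k)).
Proof.
move=> /dvdnP[q ->]; split.
- move=> F G bF bG; rewrite -(muD nu_inv); try exact: bounded_class.
  by congr nu; apply/funext => k; rewrite mulrDr.
- move=> a F bF; rewrite -(muZ nu_inv); last exact: bounded_class.
  by congr nu; apply/funext => k; rewrite mulrCA.
- move=> F bF F0; apply: (mu_ge0 nu_inv) => [|k]; first exact: bounded_class.
  by rewrite mulr_ge0.
- apply: le_trans (mu1_le1 nu_inv); apply: (mu_le nu_inv).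
  + by apply: bounded_class; exact: bounded_seq_cst.
  + exact: bounded_seq_cst.
  + by move=> k; case: (_ == _); rewrite ?mul1r ?mul0r.
- move=> F bF; rewrite -[RHS](mu_shiftM nu_inv q); last exact: bounded_class.
  by congr nu; apply/funext => k; rewrite [(r * q)%N]mulnC modnDr.
Qed.

Lemma weyl_poly (P : {poly R}) : (exists i, (0 < i)%N /\ irrational P`_i) ->
  nu (fun k => ct P.[k%:R]) = 0.
Proof.
move=> [i [i0 irr]].
have [d dirr dmax] : exists2 d, irrational P`_d.+1 & forall i, (d.+1 < i)%N -> ~ irrational P`_i.
  have small n : irrational P`_n -> (n < size P)%N.
    move=> hn; rewrite ltnNge; apply/negP => /(nth_default 0) e.
    by have := irrational_neq_int 0 hn; rewrite e eqxx.
  have ex : exists n, `[< irrational P`_n /\ (0 < n)%N >] by exists i; apply/asboolP.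
  have bd n : `[< irrational P`_n /\ (0 < n)%N >] -> (n <= size P)%N.
    by move=> /asboolP[/small/ltnW].
  case: (ex_maxnP ex bd) => -[|d] /asboolP[dirr d0] dmax //.
  exists d => // n dn irn; have /asboolP/dmax : irrational P`_n /\ (0 < n)%N by split => //; lia.
  by rewrite leqNgt dn.
pose n := size P.
have [q q0 hq] : exists2 q : nat, (0 < q)%N &
    forall j, (d.+1 < j)%N -> exists z : int, q%:R * P`_j = z%:~R.
  have [|q q0 hq] := @common_denominator R [seq P`_j | j <- iota d.+2 n].
    by move=> x /mapP[j]; rewrite mem_iota => /andP[dj _] ->; apply: dmax.
  exists q => // j dj; have [jn|nj] := ltnP j (d.+2 + n).
    by apply: hq; apply/mapP; exists j; rewrite // mem_iota dj.
  by exists 0; rewrite nth_default ?mulr0 // (leq_trans _ nj) // leq_addl.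
pose M := (r * q)%N; have M0 : (0 < M)%N by rewrite muln_gt0 r0.
have rM : (r %| M)%N by exact: dvdn_mulr.
have -> : (fun k => ct P.[k%:R]) = fun k => \sum_(c < M) ((k %% M == c)%N)%:R * ct P.[k%:R].
  apply/funext => k; rewrite (bigD1 (Ordinal (ltn_pmod k M0))) //= eqxx mul1r big1 ?addr0 //.
  by move=> c /eqP ne; case: eqP => [e|]; rewrite ?mul0r //; case: ne; apply: val_inj.
rewrite (mu_sum nu_inv); last by move=> c; apply: bounded_class; exact: bounded_ct.
apply: big1 => c _.
(* On a residue class modulo a common denominator the rational top coefficients
   only contribute a constant modulo 1. *)
pose top (x : R) := \sum_(d.+2 <= j < d.+2 + n) P`_j * x ^+ j.
pose low := \poly_(j < d.+2) P`_j + (top c%:R)%:P.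
have -> : (fun k => ((k %% M == c)%N)%:R * ct P.[k%:R]) =
    fun k => ((k %% M == c)%N)%:R * ct low.[k%:R].
  apply/funext => k; case: eqP => [kc|]; last by rewrite !mul0r.
  rewrite !mul1r hornerD hornerC horner_poly.
  have -> : P.[k%:R] = \sum_(j < d.+2) P`_j * k%:R ^+ j + top k%:R.
    rewrite (@horner_coef_wide _ (d.+2 + n)) ?leq_addl // -(big_mkord xpredT (fun j => P`_j * k%:R ^+ j)).
    by rewrite (@big_cat_nat _ _ _ d.+2) //= ?leq_addr // big_mkord.
  have [z ->] : exists z : int, top k%:R = top c%:R + z%:~R.
    rewrite /top; elim: (n) => [|n' [z IH]].
      by exists 0; rewrite addn0 !big_geq // addr0.
    rewrite addnS; move: IH (leq_addr n' d.+2); move: (d.+2 + n')%N => e IH de.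
    rewrite !big_nat_recr //= IH; have [w hw] := hq e de.
    have [v hv] : exists v : int, k%:R ^+ e = c%:R ^+ e + M%:R * v%:~R :> R.
      have : (M%:Z %| (k ^ e)%N%:Z - (c ^ e)%N%:Z)%Z.
        by rewrite -eqz_mod_dvd !modz_nat eqz_nat -modnXm kc.
      move=> /dvdzP[v ve]; exists v; rewrite -!natrX.
      have : ((k ^ e)%N%:Z - (c ^ e)%N%:Z)%:~R = (v * M%:Z)%:~R :> R by rewrite ve.
      by rewrite rmorphB intrM /= -!pmulrn => /eqP; rewrite subr_eq => /eqP ->; ring.
    exists (z + w * (r%:Z * v)); rewrite intrD !intrM -hw -pmulrn hv /M natrM; ring.
  by rewrite addrA ct_addz.
have size_low : (size low <= d.+2)%N.
  apply: leq_trans (size_polyD _ _) _; rewrite geq_max size_poly /=.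
  by apply: leq_trans (size_polyC_leq1 _) _.
apply: (weyl_leading M0 (residue_functional c rM) size_low).
by rewrite coefD coefC /= addr0 coef_poly ltnSn.
Qed.

End residues.

Section fejer_kernel.
Variable R : realType.
Implicit Types (x y t : R) (K n : nat).

Definition fejer K y : R :=
  K%:R^-1 * ((\sum_(j < K) ct (j%:R * y)) ^+ 2 + (\sum_(j < K) st (j%:R * y)) ^+ 2).

Lemma fejer_ge0 K y : 0 <= fejer K y.
Proof. by rewrite mulr_ge0 ?invr_ge0 ?ler0n // addr_ge0 ?sqr_ge0. Qed.

Lemma fejer_decay K y : (0 < K)%N -> fejer K y * (1 - ct y) <= 2 / K%:R.
Proof.
move=> K0; have KR : 0 < K%:R :> R by rewrite ltr0n.
have := turn_sum_norm K y; rewrite /fejer; set A := _ + _ => e.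
rewrite -mulrA mulrC ler_pM2r ?invr_gt0 // mulrC.
by have := ct_norm (K%:R * y); rewrite ler_norml => /andP[]; lra.
Qed.

Lemma fejerE K y :
  fejer K y = K%:R^-1 * \sum_(j < K) \sum_(j' < K) ct (j%:R * y - j'%:R * y).
Proof.
rewrite /fejer !expr2 !mulr_suml -big_split; congr (_ * _); apply: eq_bigr => j _ /=.
by rewrite !mulr_sumr -big_split; apply: eq_bigr => j' _ /=; rewrite ctB.
Qed.

Lemma ct_diff (j j' : nat) : j != j' -> exists2 h : nat, (0 < h <= maxn j j')%N &
  forall y : R, ct (j%:R * y - j'%:R * y) = ct (h%:R * y).
Proof.
move=> ne; have [jj'|j'j] := ltnP j j'.
  exists (j' - j)%N; first lia.
  by move=> z; rewrite -ctN natrB ?(ltnW jj') //; congr ct; ring.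
exists (j - j')%N; first lia.
by move=> z; rewrite natrB //; congr ct; ring.
Qed.

Lemma ct_grid_sum h n y : (0 < h < n)%N -> \sum_(i < n) ct (h%:R * (y - i%:R / n%:R)) = 0.
Proof.
move=> /andP[h0 hn]; have n0 : (0 < n)%N by lia.
have nR : 0 < n%:R :> R by rewrite ltr0n.
pose x : R := h%:R / n%:R.
have x1 : ct x < 1.
  have x0 : 0 < x < 1 by rewrite divr_gt0 ?ltr0n //= ltr_pdivrMr // mul1r ltr_nat.
  move/andP: x0 => [a b]; apply: ct_lt1 => m; apply/eqP => e.
  rewrite e -[0]/(0%:~R) -[1]/(1%:~R) !ltr_int in a b; lia.
have := turn_sum_norm n x.
have -> : ct (n%:R * x) = 1 by rewrite /x mulrCA mulfV ?gt_eqF // mulr1 -[h%:R]add0r ct_addn ct0.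
rewrite subrr mulr0 => /eqP; rewrite mulf_eq0 => /orP[/eqP|]; first by lra.
rewrite paddr_eq0 ?sqr_ge0 // !sqrf_eq0 => /andP[/eqP C0 /eqP S0].
transitivity (\sum_(i < n) (ct (h%:R * y) * ct (i%:R * x) + st (h%:R * y) * st (i%:R * x))).
  by apply: eq_bigr => i _; rewrite -ctB; congr ct; rewrite /x; ring.
by rewrite big_split /= -!mulr_sumr C0 S0 !mulr0 addr0.
Qed.

(** The kernel has frequencies below K <= n, and every nonzero one sums to 0 over n equally spaced
    points. This exact discrete identity takes the place of integration over the circle. *)
Lemma fejer_grid K n y : (0 < K <= n)%N -> \sum_(i < n) fejer K (y - i%:R / n%:R) = n%:R.
Proof.
move=> /andP[K0 Kn]; under eq_bigr do rewrite fejerE.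
rewrite -mulr_sumr exchange_big /=.
under eq_bigr do rewrite exchange_big /=.
transitivity (K%:R^-1 * \sum_(j < K) (n%:R : R)); last first.
  by rewrite sumr_const card_ord -[n%:R *+ K]mulr_natl mulKf // pnatr_eq0 -lt0n.
congr (_ * _); apply: eq_bigr => j _.
rewrite (bigD1 j) //= [X in _ + X]big1 ?addr0.
  by rewrite (eq_bigr (fun=> 1)) ?sumr_const ?card_ord // => i _; rewrite subrr ct0.
move=> j' jj'; have [|h hh e] := @ct_diff j j'; first by rewrite eq_sym.
under eq_bigr do rewrite e.
apply: ct_grid_sum; move: hh (ltn_ord j) (ltn_ord j'); lia.
Qed.

Lemma fejer_shifted_grid K n y (i0 : int) : (0 < K <= n)%N ->
  \sum_(i < n) fejer K (y - (i0%:~R + i%:R) / n%:R) = n%:R.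
Proof.
move=> h; rewrite -[RHS](fejer_grid (y - i0%:~R / n%:R) h).
by apply: eq_bigr => i _; congr fejer; ring.
Qed.

End fejer_kernel.

(** * Equidistribution *)

Section weyl_criterion.
Variables (R : realType) (r : nat) (mu : (nat -> R) -> R) (x : nat -> R).
Hypothesis mu_inv : invariant_functional r mu.
Hypothesis mu1 : mu (fun=> 1) = 1.
Hypothesis mu_ct : forall h : nat, (0 < h)%N -> mu (fun k => ct (h%:R * x k)) = 0.
Hypothesis mu_st : forall h : nat, (0 < h)%N -> mu (fun k => st (h%:R * x k)) = 0.
Implicit Types (a b t : R) (A : set R).

Lemma bounded_indic A (y : nat -> R) : bounded_seq (fun k => \1_A (y k) : R).
Proof. by exists 1 => k; rewrite indicE normr_nat lern1; case: (_ \in _). Qed.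

Let bounded_fejer K t : bounded_seq (fun k => fejer K (x k - t)).
Proof.
have bs (f : nat -> R -> R) : (forall h, bounded_seq (fun k => f h (x k))) ->
    bounded_seq (fun k => (\sum_(j < K) f j (x k)) ^+ 2).
  move=> bf; have b1 : bounded_seq (fun k => \sum_(j < K) f j (x k)).
    by apply: (@bounded_seq_sum R _ _ (fun (j : 'I_K) k => f j (x k))).
  by have := bounded_seqM b1 b1; congr bounded_seq.
apply: bounded_seqZ; apply: bounded_seqD.
  by apply: (bs (fun j y => ct (j%:R * (y - t)))) => h; exact: bounded_ct.
by apply: (bs (fun j y => st (j%:R * (y - t)))) => h; exact: bounded_st.
Qed.

Lemma mu_fejer K t : (0 < K)%N -> mu (fun k => fejer K (x k - t)) = 1.
Proof.
move=> K0; have -> : (fun k => fejer K (x k - t)) = fun k =>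
    \sum_(j < K) \sum_(j' < K) K%:R^-1 * ct (j%:R * (x k - t) - j'%:R * (x k - t)).
  apply/funext => k; rewrite fejerE mulr_sumr; apply: eq_bigr => j _; by rewrite mulr_sumr.
rewrite (mu_sum mu_inv); last first.
  by move=> j; apply: bounded_seq_sum => j'; apply: bounded_seqZ; exact: bounded_ct.
transitivity (\sum_(j < K) (K%:R^-1 : R)).
  apply: eq_bigr => j _; rewrite (mu_sum mu_inv); last first.
    by move=> j'; apply: bounded_seqZ; exact: bounded_ct.
  rewrite (bigD1 j) //= big1 ?addr0.
    rewrite (muZ mu_inv); last exact: bounded_ct.
    by rewrite (_ : (fun k => _) = fun=> 1) ?mu1 ?mulr1 //; apply/funext => k; rewrite subrr ct0.
  move=> j' jj'; rewrite (muZ mu_inv); last exact: bounded_ct.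
  have [|h /andP[h0 _] e] := @ct_diff R j j'; first by rewrite eq_sym.
  have -> : (fun k => ct (j%:R * (x k - t) - j'%:R * (x k - t))) =
      fun k => ct (h%:R * t) * ct (h%:R * x k) + st (h%:R * t) * st (h%:R * x k).
    by apply/funext => k; rewrite e mulrBr ctB; ring.
  have bc := bounded_ct (fun k => h%:R * x k); have bs := bounded_st (fun k => h%:R * x k).
  rewrite (muD mu_inv); try exact: bounded_seqZ.
  by rewrite !(muZ mu_inv) // mu_ct // mu_st // !mulr0 addr0 mulr0.
by rewrite sumr_const card_ord -[_ *+ K]mulr_natr mulVf // pnatr_eq0 -lt0n.
Qed.

Lemma mu_indic_le1 A : mu (fun k => \1_A (mod1 (x k))) <= 1.
Proof.
rewrite -mu1; apply: (mu_le mu_inv); [exact: bounded_indic|exact: bounded_seq_cst|].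
by move=> k; rewrite indicE; case: (_ \in _).
Qed.

(** The indicator is bounded, up to e, by [G], an average of Fejer kernels centred at the points of
    an n-point grid lying in [a - w, b + w]. All n kernels average to 1, and those omitted are
    centred at distance at least w modulo 1 from [a, b], where they are small. The mean of [G] is
    the proportion of points kept. *)
Lemma mu_interval_le A a b : 0 <= a -> a <= b -> b <= 1 ->
  (forall y, A y -> a <= y <= b) -> mu (fun k => \1_A (mod1 (x k))) <= b - a.
Proof.
move=> a0 ab b1 Aab; rewrite leNgt; apply/negP; set m := mu _ => hm.
(* The excess is 4e; the losses are e from the omitted kernels, 2w = e from the widening and less
   than e from counting grid points, too little to account for it. *)
pose e := (m - (b - a)) / 4.
have e0 : 0 < e by rewrite divr_gt0 // subr_gt0.
have m1 : m <= 1 by exact: mu_indic_le1.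
have ab1 : b - a + 4 * e <= 1 by rewrite /e; lra.
pose w := e / 2; have w0 : 0 < w by rewrite divr_gt0.
have cw : ct w < 1.
  apply: ct_lt1 => z; apply/eqP => ez.
  have : 0 < w < 1 by rewrite w0 /w; lra.
  rewrite ez -[0]/(0%:~R) -[1]/(1%:~R) !ltr_int; lia.
pose K := (Num.truncn (2 / (e * (1 - ct w)))).+1.
have KR : 0 < K%:R :> R by rewrite ltr0n.
have hK : 2 / (K%:R * (1 - ct w)) <= e.
  have : 2 / (e * (1 - ct w)) <= K%:R by rewrite ltW // truncnS_gt.
  rewrite !ler_pdivrMr ?mulr_gt0 ?subr_gt0 // => h; apply: le_trans h _.
  by rewrite le_eqVlt; apply/orP; left; apply/eqP; ring.
pose n := (K + (Num.truncn (2 / e)).+1)%N.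
have nK : (0 < K <= n)%N by apply/andP; split => //; exact: leq_addr.
have nR : 0 < n%:R :> R by rewrite ltr0n (leq_trans _ (leq_addr _ _)).
have hn : 2 / n%:R < e.
  rewrite ltr_pdivrMr // mulrC -ltr_pdivrMr //; apply: lt_le_trans (truncnS_gt _) _.
  by rewrite ler_nat leq_addl.
(* The grid starts at the first multiple of 1/n from a - w on and covers one period, so omitted
   points lie between b + w and a - w + 1. *)
pose i0 := Num.ceil ((a - w) * n%:R).
have i0_ge : (a - w) * n%:R <= i0%:~R by exact: ceil_ge.
have i0_lt : i0%:~R < (a - w) * n%:R + 1 by have := ceilB1_lt ((a - w) * n%:R); rewrite -/i0 rmorphB /=; lra.
pose s (i : nat) : R := (i0%:~R + i%:R) / n%:R.
pose G k := \sum_(i < n | s i <= b + w) n%:R^-1 * fejer K (x k - s i).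
have bG : bounded_seq G.
  suff : bounded_seq (fun k => \sum_(i < n) ((s i <= b + w)%R)%:R * (n%:R^-1 * fejer K (x k - s i))).
    congr bounded_seq; apply/funext => k; rewrite /G [RHS]big_mkcond; apply: eq_bigr => i _.
    by case: ifP => _; rewrite ?mul1r ?mul0r.
  by apply: bounded_seq_sum => i; apply: bounded_seqZ; apply: bounded_seqZ.
have muG : mu G = n%:R^-1 * \sum_(i < n) ((s i <= b + w)%R)%:R.
  have -> : G = fun k => \sum_(i < n) (((s i <= b + w)%R)%:R * n%:R^-1) * fejer K (x k - s i).
    apply/funext => k; rewrite /G [LHS]big_mkcond; apply: eq_bigr => i _.
    by case: ifP => _; rewrite ?mul1r ?mul0r.
  rewrite (mu_sum mu_inv) => [|i]; last exact: bounded_seqZ.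
  rewrite mulr_sumr; apply: eq_bigr => i _; rewrite (muZ mu_inv) // mu_fejer // mulr1.
  by rewrite mulrC.
have count : \sum_(i < n) ((s i <= b + w)%R)%:R <= (b - a + 2 * w) * n%:R + 2 :> R.
  rewrite -(big_mkord xpredT (fun i => ((s i <= b + w)%R)%:R)).
  pose c := (b - a + 2 * w) * n%:R + 2.
  have c0 : 0 <= c by rewrite addr_ge0 // mulr_ge0 ?ler0n //; lra.
  apply: le_trans (count_lt n c0); rewrite big_add1 /=.
  apply: ler_sum => i _; rewrite ler_nat; case: (leP (s i) (b + w)) => //= h.
  have : i.+1%:R < c; last by move=> ->.
  move: h; rewrite /s ler_pdivrMr // /c -[i.+1%:R]natr1 => h.
  by move: h i0_ge; rewrite !mulrDl !mulNr; lra.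
have Gle k : \1_A (mod1 (x k)) - e <= G k.
  have G0 : 0 <= G k by apply: sumr_ge0 => i _; rewrite mulr_ge0 ?invr_ge0 ?fejer_ge0.
  rewrite indicE; case: (boolP (_ \in _)) => [/set_mem/Aab /andP[ya yb]|_]; last by move: e0 G0; rewrite /=; lra.
  have full : \sum_(i < n) n%:R^-1 * fejer K (x k - s i) = 1.
    by rewrite -mulr_sumr (fejer_shifted_grid (x k) i0 nK) mulVf // gt_eqF.
  rewrite (bigID (fun i : 'I_n => s i <= b + w)) /= -/(G k) in full.
  suff : \sum_(i < n | ~~ (s i <= b + w)) n%:R^-1 * fejer K (x k - s i) <= e by move: full; rewrite /=; lra.
  apply: (@le_trans _ _ (\sum_(i < n) n%:R^-1 * e)); last first.
    by rewrite sumr_const card_ord -[_ *+ n]mulr_natl mulVKf // gt_eqF.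
  rewrite [leLHS]big_mkcond; apply: ler_sum => i _; case: ifP => [|_]; last first.
    by rewrite mulr_ge0 ?invr_ge0 ?ler0n // ltW.
  rewrite -ltNge => si; apply: ler_wpM2l; first by rewrite invr_ge0 ler0n.
  apply: le_trans hK.
  have ctle : ct (x k - s i) <= ct w.
    have -> : ct (x k - s i) = ct (s i - mod1 (x k)).
      rewrite -ctN opprB -[RHS](ct_addz _ (- Num.floor (x k))); congr ct.
      by rewrite /mod1 rmorphN /=; ring.
    apply: ct_le; first exact: ltW.
      by move: si yb; lra.
    have : s i <= (i0%:~R + (n%:R - 1)) / n%:R.
      rewrite /s ler_pM2r ?invr_gt0 // lerD2l lerBrDr natr1 ler_nat; exact: ltn_ord.
    have : (i0%:~R + (n%:R - 1)) / n%:R <= a - w + 1.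
      by rewrite ler_pdivrMr //; move: i0_lt; rewrite !mulrDl mul1r !mulNr; lra.
    by move: ya; lra.
  have d0 : 0 < 1 - ct w by rewrite subr_gt0.
  rewrite invfM mulrA ler_pdivlMr //; apply: le_trans (fejer_decay (x k - s i) (isT : (0 < K)%N)).
  by rewrite ler_wpM2l ?fejer_ge0 //; lra.
have : mu (fun k => \1_A (mod1 (x k)) + (- e) * 1) <= mu G.
  apply: (mu_le mu_inv) => // [|k]; last by rewrite mulr1; exact: Gle.
  by apply: bounded_seqD; [exact: bounded_indic|exact: bounded_seq_cst].
rewrite (muD mu_inv); [|exact: bounded_indic|exact: bounded_seq_cst].
rewrite (muZ mu_inv); last exact: bounded_seq_cst.
rewrite mu1 mulr1 -/m muG => h.
have : n%:R^-1 * \sum_(i < n) ((s i <= b + w)%R)%:R <= b - a + 2 * w + 2 / n%:R.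
  rewrite ler_pdivrMl // ; apply: le_trans count _.
  by rewrite le_eqVlt; apply/orP; left; apply/eqP; field; rewrite gt_eqF.
by move: h hn; rewrite /w /e; lra.
Qed.

Lemma mod1_itv (y : R) : 0 <= mod1 y < 1.
Proof.
have /andP[h1 h2] := floor_itv y; rewrite rmorphD /= in h2.
by rewrite /mod1; apply/andP; split; lra.
Qed.

(** The upper bound is applied to I and to the two closed intervals that cover its complement. Their
    lengths add up to 1, and so do at least the three means, which forces equality; the kind of the
    endpoints is immaterial since all upper bounds are for closed intervals. *)
Lemma mu_interval (I : interval R) : [set` I] `<=` `[0, 1[%classic ->
  mu (fun k => \1_[set` I] (mod1 (x k))) = fine (lebesgue_measure [set` I]).
Proof.
move=> I01; have [[y0 Iy0]|I0] := pselect (exists y, [set` I] y); last first.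
  have -> : [set` I] = set0 by apply/seteqP; split => // y Iy; case: I0; exists y.
  rewrite measure0 /= -(mu0 mu_inv); congr mu; apply/funext => k; by rewrite indic0.
have H01 y : y \in I -> 0 <= y < 1 by move=> yI; have := I01 y yI; rewrite /= in_itv.
have [a [b [ca [cb [eI ab a0 b1]]]]] : exists a b ca cb,
    [/\ I = Interval (BSide ca a) (BSide cb b), a <= b, 0 <= a & b <= 1].
  case: I I01 Iy0 H01 => -[ca a|ca] [cb b|cb] I01 /= Iy0 H01.
  - exists a, b, ca, cb; have /andP[y00 y01] := H01 _ Iy0.
    have [ya yb] : a <= y0 /\ y0 <= b.
      by move: Iy0; rewrite in_itv /=; case: (ca); case: (cb) => /= /andP[h1 h2]; split; lra.
    split => //; first lra.
      rewrite leNgt; apply/negP => a_lt0.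
      have : a / 2 \in Interval (BSide ca a) (BSide cb b).
        by rewrite in_itv /=; case: (ca); case: (cb) => /=; apply/andP; split; lra.
      by move/H01 => /andP[]; lra.
    rewrite leNgt; apply/negP => b_gt1.
    have : 1 \in Interval (BSide ca a) (BSide cb b).
      by rewrite in_itv /=; case: (ca); case: (cb) => /=; apply/andP; split; lra.
    by move/H01 => /andP[]; lra.
  - have /andP[y00 y01] := H01 _ Iy0; case: cb {I01} Iy0 H01 => Iy0 H01.
      by move: Iy0; rewrite in_itv /= andbF.
    have : y0 + 1 \in Interval (BSide ca a) (BInfty R false).
      by move: Iy0; rewrite !in_itv /= !andbT; case: (ca) => /=; lra.
    by move/H01 => /andP[]; lra.
  - have /andP[y00 y01] := H01 _ Iy0; case: ca {I01} Iy0 H01 => Iy0 H01; last first.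
      by move: Iy0; rewrite in_itv.
    have : y0 - 1 \in Interval (BInfty R true) (BSide cb b).
      by move: Iy0; rewrite !in_itv /=; case: (cb) => /=; lra.
    by move/H01 => /andP[]; lra.
  - case: ca cb {I01} Iy0 H01 => -[] Iy0 H01; try by move: Iy0; rewrite in_itv.
    have : 2 \in Interval (BInfty R true) (BInfty R false) by rewrite in_itv.
    by move/H01 => /andP[]; lra.
have -> : fine (lebesgue_measure [set` I]) = b - a.
  rewrite eI lebesgue_measure_itv /= lte_fin; case: ltP => // ba.
  by have -> : b = a; [apply/eqP; rewrite eq_le ab ba|rewrite subrr].
have Iab y : y \in I -> a <= y <= b.
  by rewrite eI in_itv /=; case: (ca); case: (cb) => /= /andP[h1 h2]; apply/andP; split; lra.
apply/eqP; rewrite eq_le; apply/andP; split.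
  by apply: mu_interval_le => // y; exact: Iab.
have low : mu (fun k => \1_(`[0, a]%classic) (mod1 (x k))) <= a - 0.
  by apply: mu_interval_le => //; lra.
have high : mu (fun k => \1_(`[b, 1]%classic) (mod1 (x k))) <= 1 - b.
  by apply: mu_interval_le => //; lra.
have : mu (fun=> 1) <= mu (fun k => \1_[set` I] (mod1 (x k)) +
    (\1_(`[0, a]%classic) (mod1 (x k)) + \1_(`[b, 1]%classic) (mod1 (x k)))).
  apply: (mu_le mu_inv) => [||k]; first exact: bounded_seq_cst.
    by apply: bounded_seqD; [|apply: bounded_seqD]; exact: bounded_indic.
  have /andP[m0 m1] := mod1_itv (x k).
  have pos (A : set R) y : 0 <= \1_A y :> R by rewrite indicE ler0n.
  have mem (A : set R) y : A y -> \1_A y = 1 :> R by move=> Ay; rewrite indicE mem_set.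
  have p1 := pos [set` I] (mod1 (x k)); have p2 := pos `[0, a]%classic (mod1 (x k)).
  have p3 := pos `[b, 1]%classic (mod1 (x k)).
  have [h|h] := leP (mod1 (x k)) a.
    have -> : \1_(`[0, a]%classic) (mod1 (x k)) = 1 :> R by apply: mem; rewrite /= in_itv /= m0 h.
    by move: p1 p3; lra.
  have [h'|h'] := leP b (mod1 (x k)).
    have -> : \1_(`[b, 1]%classic) (mod1 (x k)) = 1 :> R by apply: mem; rewrite /= in_itv /= h' ltW.
    by move: p1 p2; lra.
  have -> : \1_[set` I] (mod1 (x k)) = 1 :> R; last by move: p2 p3; lra.
  by apply: mem; rewrite /= eI in_itv /=; case: (ca); case: (cb) => /=; apply/andP; split; lra.
rewrite (muD mu_inv); [|exact: bounded_indic|by apply: bounded_seqD; exact: bounded_indic].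
rewrite (muD mu_inv); [|exact: bounded_indic|exact: bounded_indic].
by rewrite mu1; move: low high; lra.
Qed.

End weyl_criterion.

Lemma box_avg_functional (R : realType) : exists2 r, (0 < r)%N &
  forall U : set_system nat, UltraFilter U -> \oo `<=` U ->
    invariant_functional r (fun F : nat -> R => ultralim U (box_avg F)) /\
    ultralim U (box_avg (fun=> 1 : R)) = 1.
Proof.
have [r r0 hr] := box_avg_shift R; exists r => // U UU Uoo.
have bb (F : nat -> R) : bounded_seq F -> bounded_seq (box_avg F).
  by move=> [C]; exact: box_avg_bounded.
have one : ultralim U (box_avg (fun=> 1 : R)) = 1.
  have b1 := bb _ (bounded_seq_cst (1 : R)).
  have e : ultralim U (fun=> 1 : R) = 1 by apply: (ultralim_eq UU Uoo); exact: cvg_cst.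
  apply/eqP; rewrite eq_le -{2 3}e; apply/andP; split.
    apply: (ultralim_le UU Uoo (n0 := 1)) => //; first exact: bounded_seq_cst.
    by move=> N N0; rewrite box_avg_cst.
  apply: (ultralim_le UU Uoo (n0 := 1)) => //; first exact: bounded_seq_cst.
  by move=> N N0; rewrite box_avg_cst.
have Z c (F : nat -> R) : bounded_seq F ->
    ultralim U (box_avg (fun n => c * F n)) = c * ultralim U (box_avg F).
  move=> bF; rewrite -(ultralimZ UU); last exact: bb.
  by congr ultralim; apply/funext => N; rewrite box_avgZ.
split => //; split => //.
- move=> F G bF bG; rewrite -(ultralimD UU); try exact: bb.
  by congr ultralim; apply/funext => N; rewrite box_avgD.
- move=> F bF F0; rewrite -(mul0r (ultralim U (box_avg F))) -Z //.
  apply: (ultralim_le UU Uoo (n0 := 0)); try exact: bb.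
    by apply: bb; exact: bounded_seqZ.
  by move=> N _; apply: box_avg_le => n; rewrite mul0r.
- by rewrite one.
- move=> F [C FC]; have C0 : 0 <= C by apply: le_trans (FC 0%N).
  have bF : bounded_seq F by exists C.
  have C1 : 0 < C + 1 by rewrite ltr_pwDr.
  (* The shift theorem is for functions bounded by 1; homogeneity extends it to all bounded ones. *)
  have F1 n : `|(C + 1)^-1 * F n| <= 1.
    rewrite normrM normfV (gtr0_norm C1) mulrC ler_pdivrMr // mul1r.
    by apply: le_trans (FC n) _; rewrite lerDl.
  have := hr U UU Uoo _ F1; rewrite !Z //; last by exists C.
  by move=> /(mulfI _) ->; rewrite // invr_eq0 gt_eqF.
Qed.

(** With q a common denominator of the nonconstant coefficients, q (Q(k) - Q_0) is an integer, and
    its residue modulo q determines Q(k) modulo 1. *)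
Lemma rational_values (R : realType) (Q : {poly R}) :
  (forall i, (0 < i)%N -> ~ irrational Q`_i) ->
  exists (T : finType) (v : T -> R), forall k : nat, exists t, mod1 Q.[k%:R] = v t.
Proof.
move=> rat; have [q q0 hq] : exists2 q : nat, (0 < q)%N &
    forall i, (0 < i)%N -> exists z : int, q%:R * Q`_i = z%:~R.
  have [|q q0 hq] := @common_denominator R [seq Q`_i | i <- iota 1 (size Q)].
    by move=> x /mapP[i]; rewrite mem_iota => /andP[i0 _] ->; apply: rat.
  exists q => // i i0; have [ile|lti] := ltnP i (1 + size Q).
    by apply: hq; apply/mapP; exists i; rewrite // mem_iota i0.
  by exists 0; rewrite nth_default ?mulr0 // ltnW // -ltnS.
have qR : q%:R != 0 :> R by rewrite pnatr_eq0 -lt0n.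
exists 'I_q, (fun t : 'I_q => mod1 (Q`_0 + t%:R / q%:R)) => k.
have [z hz] : exists z : int, Q.[k%:R] = Q`_0 + z%:~R / q%:R.
  suff [z hz] : exists z : int, q%:R * (Q.[k%:R] - Q`_0) = z%:~R.
    by exists z; rewrite -hz mulrC mulKf // addrC subrK.
  rewrite (@horner_coef_wide _ (size Q).+1) ?leqnSn // big_ord_recl expr0 mulr1 addrAC subrr add0r.
  elim: (size Q) => [|n [z IH]]; first by exists 0; rewrite big_ord0 mulr0.
  have [w hw] := hq n.+1 isT; exists (z + w * (k ^ n.+1)%N%:Z).
  by rewrite big_ord_recr mulrDr IH intrD intrM /= mulrA hw -pmulrn natrX.
have qz : q%:Z != 0 by rewrite eqz_nat -lt0n.
have zq : `|(z %% q)%Z|%N%:Z = (z %% q)%Z by rewrite gez0_abs // modz_ge0.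
have tq : (`|(z %% q)%Z| < q)%N by rewrite -ltz_nat zq ltz_pmod // ltz_nat.
exists (Ordinal tq); rewrite hz /mod1 /=.
have -> : z%:~R / q%:R = `|(z %% q)%Z|%N%:R / q%:R + (z %/ q)%Z%:~R :> R.
  have -> : `|(z %% q)%Z|%N%:R = (z %% q)%Z%:~R :> R by rewrite -zq.
  by rewrite {1}(divz_eq z q) intrD intrM -pmulrn mulrDl mulfK // addrC.
rewrite addrA floorDrz ?intr_int // intrKfloor rmorphD /=; ring.
Qed.

(* The constant coefficient is excluded: it only translates the sequence mod 1,
   and e.g. a constant irrational Q gives a constant sequence. *)
Theorem corollary1p6 (R : realType) (Q : {poly R}) :
  uniformly_distributed_mod1
    (fun m n : nat => Q.[(Omega (m ^ 2 + n ^ 2)%N)%:R]) <->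
  exists i : nat, (0 < i)%N /\ irrational Q`_i.
Proof.
pose F (I : interval R) (k : nat) : R := \1_[set` I] (mod1 Q.[k%:R]).
have FE I : (fun N : nat => (N%:R ^+ 2)^-1 * \sum_(1 <= m < N.+1) \sum_(1 <= n < N.+1)
    \1_[set` I] (mod1 Q.[(Omega (m ^ 2 + n ^ 2)%N)%:R])) = box_avg (F I) by [].
split => [ud|irr I I01].
  apply: contrapT => /forallNP noirr.
  have [|T [v hv]] := @rational_values R Q.
    by move=> i i0 irr; apply: (noirr i).
  (* A value taken modulo 1 is a degenerate interval of length 0, so equidistribution would give
     each of the finitely many values density 0, while together they have density 1. A [v t] outside
     [0, 1) is never attained. *)
  have point t : box_avg (F `[v t, v t]) @ \oo --> (0 : R).
    have [v01|v01] := pselect (0 <= v t < 1).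
      have := ud `[v t, v t]; rewrite FE => /(_ _); rewrite set_itv1.
      rewrite lebesgue_measure_set1 /=; apply => y /= ->.
      by rewrite in_itv.
    rewrite (_ : box_avg _ = fun=> 0); first exact: cvg_cst.
    apply/funext => N; rewrite /box_avg big1 ?mulr0 // => m _; rewrite big1 // => n _.
    rewrite /F indicE memNset // /= in_itv /= => h; apply: v01.
    have -> : v t = mod1 Q.[(Omega (m ^ 2 + n ^ 2)%N)%:R] by apply/eqP; rewrite eq_le.
    exact: mod1_itv.
  have total : (fun N => \sum_(t : T) box_avg (F `[v t, v t]) N) @ \oo --> (0 : R).
    elim: (index_enum T) => [|t s IH].
      rewrite (_ : (fun N => _) = fun=> 0); first exact: cvg_cst.
      by apply/funext => N; rewrite big_nil.
    rewrite (_ : (fun N => _) = fun N => box_avg (F `[v t, v t]) N +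
      \sum_(t <- s) box_avg (F `[v t, v t]) N); last by apply/funext => N; rewrite big_cons.
    by rewrite -[X in _ --> X]addr0; apply: cvgD.
  have : (1 : R) <= 0; last by rewrite ler10.
  apply: ler_cvg_to (cvg_cst (1 : R)) total _.
  exists 1%N => // N /= N0; rewrite -(box_avg_cst (1 : R) N0).
  have -> : \sum_t box_avg (F `[v t, v t]) N = box_avg (fun k => \sum_t F `[v t, v t] k) N.
    rewrite /box_avg -mulr_sumr exchange_big /=; congr (_ * _); apply: eq_bigr => m _.
    by rewrite exchange_big.
  apply: box_avg_le => k; have [t ht] := hv k.
  rewrite (bigD1 t) //= {1}/F ht indicE mem_set /= ?in_itv /= ?lexx //.
  by rewrite lerDl sumr_ge0 // => t' _; rewrite /F indicE ler0n.
rewrite FE; have [r r0 hr] := box_avg_functional R.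
apply: cvg_of_ultralim; first by apply: box_avg_bounded (1 : R) _ => k; rewrite /F indicE normr_nat lern1; case: (_ \in _).
move=> U UU Uoo; have [inv one] := hr U UU Uoo.
(* The constants c = 0 and c = -1/4 give the cosine and the sine of the frequency h. *)
have irr_mul (h : nat) (c : R) : (0 < h)%N -> exists i, (0 < i)%N /\ irrational (h%:R *: Q + c%:P)`_i.
  move=> h0; have [i [i0 hi]] := irr; exists i; split => //.
  rewrite coefD coefZ coefC gtn_eqF // addr0 -[h%:R]/(h%:Z%:~R).
  by apply: irrationalMz => //; rewrite eqz_nat -lt0n.
apply: (mu_interval (x := fun k => Q.[k%:R]) inv one _ _ I01) => h h0.
  have := weyl_poly r0 inv (irr_mul h 0 h0); rewrite (_ : (fun k => _) = fun k => ct (h%:R * Q.[k%:R])) //.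
  by apply/funext => k; rewrite !hornerE.
have := weyl_poly r0 inv (irr_mul h (- 4^-1) h0); rewrite (_ : (fun k => _) = fun k => st (h%:R * Q.[k%:R])) //.
by apply/funext => k; rewrite st_ct !hornerE.
Qed.
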